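(* Let $\mathfrak{g}$ be a simply laced simple Lie algebra over $\mathbb{C}$ of rank $n$ with Serre generators $e_i,f_i,h_i$ ($1\le i\le n$), labelled as in Kac's book. Let $\omega_p$ be a minuscule fundamental weight of $\mathfrak{g}$, let $L_p$ be the irreducible $\mathfrak{g}$-module of highest weight $\omega_p$, and let $P$ be the minuscule poset such that the poset of weights of $L_p$ is isomorphic to $J(P)$. Let $\mathfrak{k}$ be the subalgebra of $\mathfrak{g}$ generated by $\{e_i,f_i,h_i:1\le i\le n,\ i\ne p\}$. Then the restriction of $L_p$ to $\mathfrak{k}$ decomposes as a direct sum $\bigoplus_{i=0}^{k}V_i$, where $k=\mathrm{width}(P)$ and, for each $0\le i\le k$, $V_i$ is a simple $\mathfrak{k}$-module whose poset of weights is isomorphic to $(\mathcal{A}_i(P),\le_i)$.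
   Context: The possible pairs (type of $\mathfrak{g}$, $p$) and the corresponding posets $P$ are: type $A_n$, $p=k\in[n]$, $P\cong[k]\times[n+1-k]$; type $D_n$, $p=1$, $P\cong J^{n-3}([2]\times[2])$; type $D_n$, $p\in\{n-1,n\}$, $P\cong J([n-2]\times[2])$; type $E_6$, $p\in\{1,5\}$, $P\cong J^2([2]\times[3])$; type $E_7$, $p=6$, $P\cong J^3([2]\times[3])$. Here $[m]=\{1,\dots,m\}$, products carry the product order, $J(Q)$ is the poset of order ideals of $Q$ under inclusion, and $J^{m}$ is the $m$-fold iterate of $J$ ($J^0(Q)=Q$). The poset of weights of a finite-dimensional module is its set of weights ordered by $\lambda\le\mu$ iff $\mu-\lambda$ is a nonnegative integer combination of the simple roots of the algebra in question ($\mathfrak{g}$ for $L_p$, $\mathfrak{k}$ for the $V_i$). $\mathrm{width}(P)$ is the maximum size of an antichain in $P$; $\mathcal{A}_i(P)$ is the set of antichains of $P$ of size $i$, and for $A,B\in\mathcal{A}_i(P)$, $A\prec_i B$ means $A\setminus B=\{a\}$, $B\setminus A=\{b\}$ are singletons with $a<_P b$, with $\le_i$ the reflexive transitive closure of $\prec_i$. *)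

(* Defs.v *)
From HB Require Import structures.
From mathcomp Require Import all_boot all_order all_algebra.
From mathcomp Require Import complex Rstruct.
Set Implicit Arguments. Unset Strict Implicit. Unset Printing Implicit Defensive.
Import GRing.Theory Num.Theory.
Local Open Scope ring_scope.

Definition Cplx : fieldType := (complex Rdefinitions.R).

Record finposet : Type := FinPoset {
  fp_T : finType ; fp_elem : pred fp_T ; fp_le : rel fp_T }.

Definition chainprod (m l : nat) : finposet :=
  @FinPoset ('I_m * 'I_l)%type predT
    (fun x y => ((x.1 <= y.1)%N && (x.2 <= y.2)%N)).

Definition is_ideal (Q : finposet) (X : {set fp_T Q}) : bool :=
  [forall x in X, @fp_elem Q x] &&
  [forall x, forall y, ((@fp_elem Q x) && (y \in X) && @fp_le Q x y) ==> (x \in X)].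

Definition Jp (Q : finposet) : finposet :=
  @FinPoset {set fp_T Q} (fun X => is_ideal X) (fun X Y => X \subset Y).

Definition Jpow (m : nat) (Q : finposet) : finposet := iter m Jp Q.

Definition antichain (P : finposet) (A : {set fp_T P}) : bool :=
  [forall x in A, @fp_elem P x] &&
  [forall x in A, forall y in A, (x != y) ==> ~~ @fp_le P x y].

Definition width (P : finposet) : nat :=
  \max_(A : {set fp_T P} | antichain A) #|A|.

Definition Aset (P : finposet) (i : nat) : {set {set fp_T P}} :=
  [set A : {set fp_T P} | antichain A & #|A| == i].

Definition prec_step (P : finposet) (A B : {set fp_T P}) : bool :=
  [exists a, exists b, [&& A :\: B == [set a], B :\: A == [set b],
                           @fp_le P a b & a != b]].

Definition le_i (P : finposet) (i : nat) (A B : {set fp_T P}) : bool :=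
  connect (fun X Y => [&& X \in Aset P i, Y \in Aset P i & prec_step X Y]) A B.

Inductive sltype := TA | TD | TE6 | TE7 | TE8.

Definition valid_rank (t : sltype) (n : nat) : bool :=
  match t with
  | TA => (1 <= n)%N | TD => (4 <= n)%N
  | TE6 => n == 6%N | TE7 => n == 7%N | TE8 => n == 8%N end.

(* adjacency of the nodes labelled i, j in {1..n} (Kac, Table Fin) *)
Definition chain_edge (N i j : nat) : bool :=
  [&& (1 <= i)%N, (1 <= j)%N, (i <= N)%N, (j <= N)%N & ((i == j.+1) || (j == i.+1))].

Definition dyn_adj (t : sltype) (n i j : nat) : bool :=
  match t with
  | TA => chain_edge n i j
  | TD => chain_edge n.-1 i j ||
          ((i == n) && (j == n - 2)%N) || ((j == n) && (i == n - 2)%N)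
  | TE6 => chain_edge 5 i j || ((i == 6%N) && (j == 3%N)) || ((j == 6%N) && (i == 3%N))
  | TE7 => chain_edge 6 i j || ((i == 7%N) && (j == 3%N)) || ((j == 7%N) && (i == 3%N))
  | TE8 => chain_edge 7 i j || ((i == 8%N) && (j == 5%N)) || ((j == 8%N) && (i == 5%N))
  end.

(* Cartan matrix; the index i : 'I_n stands for Kac's label i+1 *)
Definition cartan (t : sltype) (n : nat) (i j : 'I_n) : int :=
  if i == j then 2 else if dyn_adj t n i.+1 j.+1 then -1 else 0.

(* minuscule fundamental weights omega_p (p a Kac label in 1..n) *)
Definition minuscule (t : sltype) (n p : nat) : bool :=
  match t with
  | TA => (1 <= p <= n)%N
  | TD => (p == 1%N) || (p == n.-1) || (p == n)
  | TE6 => (p == 1%N) || (p == 5%N)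
  | TE7 => p == 6%N
  | TE8 => false
  end.

(* the minuscule poset P with J(P) = poset of weights of L_p *)
Definition mposet (t : sltype) (n p : nat) : finposet :=
  match t with
  | TA => chainprod p (n.+1 - p)
  | TD => if p == 1%N then Jpow (n - 3) (chainprod 2 2) else Jp (chainprod (n - 2) 2)
  | TE6 => Jpow 2 (chainprod 2 3)
  | TE7 => Jpow 3 (chainprod 2 3)
  | TE8 => chainprod 0 0
  end.

Section Lie.
Variable K : fieldType.

Definition lie_bracket (g : vectType K) (br : g -> g -> g) : Prop :=
  [/\ forall a x y z, br (a *: x + y) z = a *: br x z + br y z,
      forall a x y z, br z (a *: x + y) = a *: br z x + br z y,
      forall x, br x x = 0 &
      forall x y z, br x (br y z) + br y (br z x) + br z (br x y) = 0].

Definition lie_ideal (g : vectType K) (br : g -> g -> g) (I : {vspace g}) : Prop :=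
  forall x y, y \in I -> br x y \in I.

Definition simple_lie (g : vectType K) (br : g -> g -> g) : Prop :=
  (exists x y, br x y != 0) /\
  forall I : {vspace g}, lie_ideal br I -> I = 0%VS \/ I = fullv.

Definition lie_closed (g : vectType K) (br : g -> g -> g) (U : {vspace g}) : Prop :=
  forall x y, x \in U -> y \in U -> br x y \in U.

Definition lie_generated (g : vectType K) (br : g -> g -> g) (S : g -> Prop)
    (U : {vspace g}) : Prop :=
  [/\ forall x, S x -> x \in U, lie_closed br U &
      forall W : {vspace g}, (forall x, S x -> x \in W) -> lie_closed br W ->
        (U <= W)%VS].

Definition serre_generators (t : sltype) (n : nat) (g : vectType K)
    (br : g -> g -> g) (e f h : 'I_n -> g) : Prop :=
  [/\ forall i j, br (h i) (h j) = 0,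
      forall i j, br (e i) (f j) = (if i == j then h i else 0),
      forall i j, br (h i) (e j) = (cartan t i j)%:~R *: e j &
      forall i j, br (h i) (f j) = - ((cartan t i j)%:~R *: f j)] /\
  [/\ forall i j, i != j -> iter `|1 - cartan t i j|%N (br (e i)) (e j) = 0,
      forall i j, i != j -> iter `|1 - cartan t i j|%N (br (f i)) (f j) = 0 &
      lie_generated br (fun x => exists i, x = e i \/ x = f i \/ x = h i) fullv].

Definition lie_module (g : vectType K) (br : g -> g -> g) (V : vectType K)
    (act : g -> V -> V) : Prop :=
  [/\ forall a x y v, act (a *: x + y) v = a *: act x v + act y v,
      forall a x v w, act x (a *: v + w) = a *: act x v + act x w &
      forall x y v, act (br x y) v = act x (act y v) - act y (act x v)].

Definition submodule (g V : vectType K) (act : g -> V -> V) (k : {vspace g})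
    (W : {vspace V}) : Prop :=
  forall x w, x \in k -> w \in W -> act x w \in W.

Definition simple_submodule (g V : vectType K) (act : g -> V -> V) (k : {vspace g})
    (W : {vspace V}) : Prop :=
  [/\ submodule act k W, W != 0%VS &
      forall W' : {vspace V}, submodule act k W' -> (W' <= W)%VS ->
        W' = 0%VS \/ W' = W].

Definition highest_weight_fund (n : nat) (g V : vectType K) (act : g -> V -> V)
    (e h : 'I_n -> g) (p : nat) : Prop :=
  simple_submodule act fullv fullv /\
  exists2 v : V, v != 0 &
    forall i : 'I_n, act (e i) v = 0 /\
                     act (h i) v = (if i.+1 == p then 1 else 0) *: v.

(* Weights of W for the Cartan subalgebra span{h_i : i in S}; a weight is
   recorded by its values on the h_i (i in S), and by 0 outside S. *)
Definition is_weight (n : nat) (g V : vectType K) (act : g -> V -> V)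
    (h : 'I_n -> g) (S : {set 'I_n}) (W : {vspace V}) (mu : {ffun 'I_n -> K}) : Prop :=
  (forall i, i \notin S -> mu i = 0) /\
  exists w, [/\ w \in W, w != 0 &
                forall i, i \in S -> act (h i) w = mu i *: w].

(* lam <= mu iff mu - lam is a nonnegative integer combination of the simple
   roots alpha_j (j in S), where alpha_j(h_i) = a_ij. *)
Definition weight_le (t : sltype) (n : nat) (S : {set 'I_n})
    (lam mu : {ffun 'I_n -> K}) : Prop :=
  exists c : 'I_n -> nat, forall i, i \in S ->
    mu i - lam i = \sum_(j in S) (c j)%:R * (cartan t i j)%:~R.

Definition weights_iso_antichains (t : sltype) (n : nat) (g V : vectType K)
    (act : g -> V -> V) (h : 'I_n -> g) (S : {set 'I_n}) (W : {vspace V})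
    (P : finposet) (i : nat) : Prop :=
  exists psi : {set fp_T P} -> {ffun 'I_n -> K},
  [/\ forall A, A \in Aset P i -> is_weight act h S W (psi A),
      forall mu, is_weight act h S W mu -> exists2 A, A \in Aset P i & psi A = mu,
      {in Aset P i &, injective psi} &
      forall A B, A \in Aset P i -> B \in Aset P i ->
        (@le_i P i A B <-> weight_le t S (psi A) (psi B))].

End Lie.

(* Main.v *)
Require Import Defs.
From HB Require Import structures.
From mathcomp Require Import all_boot all_order all_algebra.
From mathcomp Require Import zify ring.
From Stdlib Require Import Classical.
Import Order.TTheory GRing.Theory Num.Theory.
Set Implicit Arguments. Unset Strict Implicit. Unset Printing Implicit Defensive.
Local Open Scope ring_scope.

(** The weights of a minuscule module form one Weyl orbit, the weight spaces are lines, and each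
    weight takes only the values -1, 0, 1 on simple coroots. Write [omega_p - mu] in the simple
    roots: the generators with [i != p] do not change the coefficient of [alpha_p], so this
    coefficient, the level, splits [L] into $\mathfrak{k}$-submodules [V_i]. What remains is to see
    that each level is simple and that its weights are matched with antichains of size [i].

    The combinatorial input is isolated in two notions: [minuscule_model] (a finite set with
    weights, root coordinates and reflections) and [antichain_model] (a matching of that set with
    the antichains of [P] in which the level is the size). Given these, the argument is uniform in
    the type.

    Basis: lowering a highest weight vector along the model gives well-defined nonzero weight
    vectors ([lowered_weight]), and irreducibility makes them span [L] ([module_weight_basis]).
    Simplicity: the [h_j] with [j != p] separate the basis vectors of a level, so a nonzero
    submodule contains one of them ([eigen_components], [level_wt_inj]); a level has a single
    dominant element for the Levi subalgebra, so its basis vectors are all linked by some [e_j],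
    [f_j] ([level_connected]). Order: a comparison of two $\mathfrak{k}$-weights of a level refines
    into steps by one simple root ([levi_le_steps]), and each such step exchanges one element of an
    antichain ([antichain_model_le]).

    The models are built type by type. In type A and for the half-spin modules a weight is a set [U]
    of sign changes and an antichain is a family of nested arcs; the matching takes the set of end
    points, so the level is the number of arcs ([pair_antichain_model]). The vector module of type D
    is treated by hand ([vector_antichain_model]), E6 and E7 by verified tables
    ([table_antichain_model]). The matching is not the usual one through maximal elements of ideals,
    which does not turn size into level. *)

(** * Linear algebra: eigenvectors and sl2-strings *)

Section LinearAlgebra.
Variables (K : fieldType) (V : vectType K).

(** As long as some vector satisfying [Pr] lies outside the current subspace, which classical logic
    decides, it is adjoined; the dimension bounds the number of rounds. *)
Lemma vspace_of_pred (Pr : V -> Prop) :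
    Pr 0 -> (forall a x y, Pr x -> Pr y -> Pr (a *: x + y)) ->
  exists U : {vspace V}, forall x, x \in U <-> Pr x.
Proof.
move=> Pr0 PrD.
suff: forall k (U : {vspace V}), (forall x, x \in U -> Pr x) ->
    (\dim {:V} - \dim U <= k)%N ->
    exists U' : {vspace V}, forall x, x \in U' <-> Pr x.
  move/(_ (\dim {:V}) 0%VS); apply; last by rewrite leq_subr.
  by move=> x; rewrite memv0 => /eqP->.
elim=> [|k IH] U UP hk.
  exists U => x; split; first exact: UP.
  suff -> : U = fullv by rewrite memvf.
  by apply/eqP; rewrite eqEdim subvf -subn_eq0 -leqn0.
case: (classic (exists2 x, Pr x & x \notin U)) => [[x Px xU]|noP]; last first.
  exists U => x; split; first exact: UP.
  by move=> Px; apply: NNPP => xU; apply: noP; exists x => //; apply/negP.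
apply: (IH (U + <[x]>)%VS) => [y|].
  case/memv_addP => u uU [w /vlineP[c ->] ->].
  by rewrite addrC; apply: PrD => //; exact: UP.
have ltU : (\dim U < \dim (U + <[x]>))%N.
  rewrite ltn_neqAle dimvS ?addvSl // andbT.
  apply: contra xU => /eqP eqd.
  have /eqP -> : U == (U + <[x]>)%VS by rewrite eqEdim addvSl eqd /=.
  by apply: (subvP (addvSr U _)); exact: memv_line.
by lia.
Qed.

Lemma raw_linear0 (T : V -> V) :
  (forall a v v', T (a *: v + v') = a *: T v + T v') -> T 0 = 0.
Proof. by move=> linT; have := linT (-1) 0 0; rewrite scaler0 addr0 scaleN1r addNr. Qed.

Lemma raw_linearZ (T : V -> V) a v :
  (forall a v v', T (a *: v + v') = a *: T v + T v') -> T (a *: v) = a *: T v.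
Proof. by move=> linT; have := linT a v 0; rewrite (raw_linear0 linT) !addr0. Qed.

Lemma raw_linear_sum (T : V -> V) (I : Type) (r : seq I) (P : pred I) (w : I -> V) :
    (forall a v v', T (a *: v + v') = a *: T v + T v') ->
  T (\sum_(i <- r | P i) w i) = \sum_(i <- r | P i) T (w i).
Proof.
move=> linT.
apply: (big_morph T) => [x y|]; last exact: raw_linear0.
by have := linT 1 x y; rewrite !scale1r.
Qed.

(* Subtracting an eigenvalue kills one summand and rescales the others, whence
   an induction on the number of summands. *)
Lemma eigen_components (I : finType) (J : Type) (Q : J -> Prop) (T : J -> V -> V)
    (chi : I -> J -> K) (D : {set I}) (w : I -> V) (U : {vspace V}) :
    (forall j a v v', T j (a *: v + v') = a *: T j v + T j v') ->
    (forall j v, Q j -> v \in U -> T j v \in U) ->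
    {in D &, forall i i', i != i' -> exists2 j, Q j & chi i j != chi i' j} ->
    (forall i j, i \in D -> Q j -> T j (w i) = chi i j *: w i) ->
  \sum_(i in D) w i \in U -> forall i, i \in D -> w i \in U.
Proof.
move=> linT UT; move: {2}#|D| (leqnn #|D|) w => k.
elim: k D => [|k IH] D.
  by rewrite leqn0 => /eqP/cards0_eq -> w _ _ _ i; rewrite inE.
move=> leD w sepD eigD sumU i iD.
have [/eqP D1|] := boolP (D :\ i == set0).
  by move: sumU; rewrite (big_setD1 i) //= D1 big_set0 addr0.
case/set0Pn => i'; rewrite !inE => /andP[ni' i'D].
have [j Qj cj] := sepD i i' iD i'D (negbT (introF eqP (fun E => elimN eqP ni' (esym E)))).
pose w' l := (chi l j - chi i' j) *: w l.
suff /(IH (D :\ i') _ w') : \sum_(l in D :\ i') w' l \in U.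
  rewrite /w'; move=> /(_ _ _ _ i) H.
  have: (chi i j - chi i' j) *: w i \in U.
    apply: H; rewrite ?inE ?iD ?andbT 1?eq_sym //.
    - by move: leD; rewrite (cardsD1 i') i'D.
    - by move=> x y; rewrite !inE => /andP[_ xD] /andP[_ yD]; exact: sepD.
    - move=> l j'; rewrite !inE => /andP[_ lD] Qj'.
      by rewrite (raw_linearZ _ _ (linT j')) eigD // !scalerA mulrC.
  move/(memvZ (chi i j - chi i' j)^-1).
  by rewrite scalerA mulVf ?scale1r // subr_eq0.
have -> : \sum_(l in D :\ i') w' l =
    T j (\sum_(l in D) w l) - chi i' j *: \sum_(l in D) w l.
  rewrite (raw_linear_sum _ _ _ (linT j)) scaler_sumr -sumrB [RHS](big_setD1 i') //=.
  rewrite eigD // subrr add0r; apply: eq_bigr => l; rewrite inE => /andP[_ lD].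
  by rewrite eigD // -scalerBl.
by rewrite rpredB ?rpredZ ?UT.
Qed.

Hypothesis char0 : forall m : int, m%:~R = 0 :> K -> m = 0.

Lemma intr_inj0 : injective (fun m : int => m%:~R : K).
Proof.
move=> x y /eqP; rewrite -subr_eq0 -intrB => /eqP/char0/eqP.
by rewrite subr_eq0 => /eqP.
Qed.

(** Nonzero eigenvectors for distinct eigenvalues are independent, so one of the first
    [\dim {:V} + 1] vectors vanishes. *)
Lemma eigenvectors_bounded (H : V -> V) (w : nat -> V) (c : nat -> int) :
    (forall a v v', H (a *: v + v') = a *: H v + H v') ->
    (forall k, H (w k) = (c k)%:~R *: w k) -> injective c ->
  exists k, w k = 0.
Proof.
move=> linH Hw injc; apply: NNPP => nz.
have {}nz k : w k != 0 by apply/eqP => wk; apply: nz; exists k.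
pose N := (\dim {:V}).+1.
pose t := [tuple w i | i < N].
suff /eqnP : free t by move/eqP; rewrite size_tuple eqn_leq /N ltnNge dimvS ?subvf ?andbF.
apply/freeP => kk sum0 i.
suff: kk i *: w i \in 0%VS by rewrite memv0 scaler_eq0 (negbTE (nz i)) orbF => /eqP.
apply: (@eigen_components 'I_N unit (fun=> True) (fun=> H)
  (fun i _ => (c i)%:~R) setT (fun i => kk i *: w i)) => //.
- by move=> _ v _; rewrite memv0 => /eqP->; rewrite (raw_linear0 linH) mem0v.
- move=> x y _ _ xy; exists tt => //; apply: contra xy => /eqP/intr_inj0/injc E.
  by apply/eqP/val_inj.
- by move=> l _ _ _; rewrite (raw_linearZ _ _ linH) Hw !scalerA mulrC.
- rewrite memv0; apply/eqP; rewrite -[RHS]sum0.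
  apply: eq_big => [l|l _]; first by rewrite inE.
  by rewrite (nth_map l) ?size_enum_ord // nth_ord_enum.
Qed.

(** A finite-dimensional sl2-module has no highest weight vector of negative weight. Some [F^k y]
    vanishes because these vectors have distinct weights, and [E F^(k+1) y] is [F^k y] times
    [-(k+1)(m+k+1)], which is nonzero in characteristic 0, so the vanishing descends to [y]. *)
Lemma sl2_singular_eq0 (E F H : V -> V) (m : nat) (y : V) :
    (forall a v v', E (a *: v + v') = a *: E v + E v') ->
    (forall a v v', F (a *: v + v') = a *: F v + F v') ->
    (forall a v v', H (a *: v + v') = a *: H v + H v') ->
    (forall v, E (F v) - F (E v) = H v) ->
    (forall v, H (F v) = F (H v) - 2 *: F v) ->
  E y = 0 -> H y = (- m.+1%:Z)%:~R *: y -> y = 0.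
Proof.
move=> linE linF linH EF HF Ey Hy.
have FZ c v : F (c *: v) = c *: F v by exact: raw_linearZ.
have F0 : F 0 = 0 by exact: raw_linear0.
pose w k := iter k F y.
pose c k : int := - (m.+1 + k.*2)%:Z.
have Hw k : H (w k) = (c k)%:~R *: w k.
  elim: k => [|k IH]; first by rewrite Hy /c addn0.
  rewrite /= HF -/(w k) IH FZ -scalerBl; congr (_ *: _).
  by rewrite -[2]/(2%:~R) -intrB; congr (_%:~R); rewrite /c; lia.
have Ew k : E (w k.+1) = (- (k.+1 * (m + k.+1))%:Z)%:~R *: w k.
  elim: k => [|k IH].
    move/eqP: (EF y); rewrite Ey F0 subr0 => /eqP /= ->.
    by rewrite Hy; congr (_%:~R *: _); lia.
  have -> : E (w k.+2) = H (w k.+1) + F (E (w k.+1)) by rewrite -EF subrK.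
  rewrite IH FZ Hw -[F (w k)]/(w k.+1) -scalerDl -intrD; congr (_%:~R *: _).
  by rewrite /c; lia.
have [|k wk0] := @eigenvectors_bounded H w c linH Hw.
  by move=> k k'; rewrite /c; lia.
elim: k wk0 => [//|k IH] wk0; apply: IH.
have := Ew k; rewrite wk0 (raw_linear0 linE) => /esym/eqP.
by rewrite scaler_eq0 => /orP[/eqP/char0|/eqP//]; lia.
Qed.

End LinearAlgebra.

(** The elements of [g] that stabilise [W] form a subspace closed under the bracket, so stability
    need only be tested on generators. *)
Lemma lie_generated_submodule (K : fieldType) (g : vectType K) (br : g -> g -> g)
    (L : vectType K) (act : g -> L -> L) (S : g -> Prop) (U : {vspace g})
    (W : {vspace L}) :
    lie_module br act -> lie_generated br S U ->
    (forall x w, S x -> w \in W -> act x w \in W) ->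
  submodule act U W.
Proof.
case=> actl actr actbr [_ _ gen] SW.
have act0 w : act 0 w = 0.
  by have := actl (-1) 0 0 w; rewrite scaler0 addr0 scaleN1r addNr.
have [|a x y xW yW w wW|U' U'P] :=
    @vspace_of_pred K g (fun x => forall w, w \in W -> act x w \in W).
- by move=> w _; rewrite act0 mem0v.
- by rewrite actl rpredD ?rpredZ ?xW ?yW.
suff /subvP UU' : (U <= U')%VS by move=> x w /UU'/U'P; apply.
apply: gen => [x Sx|x y /U'P xW /U'P yW]; apply/U'P => w wW; first exact: SW.
by rewrite actbr rpredB ?xW ?yW // ?xW ?yW.
Qed.

(** * Abstract minuscule weight systems and their modules *)

Record simply_laced n (a : 'I_n -> 'I_n -> int) : Prop := SimplyLaced {
  cartan_diag : forall i, a i i = 2;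
  cartan_offdiag : forall i j, i != j -> a i j = 0 \/ a i j = -1;
  cartan_sym : forall i j, a i j = a j i;
  (* Such a [u] forces [a] to be of finite type. *)
  cartan_pos : exists u : 'I_n -> int,
    (forall i, 0 <= u i) /\ (forall j, 0 < \sum_i u i * a i j) }.

(* [refl] is the action of the simple reflections on the Weyl orbit of [omega_p],
   and [cf x] are the coordinates of [omega_p - wt x] in the simple roots, so that
   [cf x p] is the index of the summand containing the weight space of [x]. *)
Record minuscule_model n (a : 'I_n -> 'I_n -> int) (p : 'I_n) := MinusculeModel {
  model_carrier :> finType;
  wt : model_carrier -> 'I_n -> int;
  cf : model_carrier -> 'I_n -> int;
  refl : 'I_n -> model_carrier -> model_carrier;
  top : model_carrier;
  wt_range : forall x i, -1 <= wt x i <= 1;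
  wt_refl : forall x i j, wt (refl i x) j = wt x j - a j i * wt x i;
  cf_refl : forall x i j, cf (refl i x) j = cf x j + (i == j)%:Z * wt x i;
  reflK : forall i, involutive (refl i);
  wt_top : forall i, wt top i = (i == p)%:Z;
  cf_top : forall i, cf top i = 0;
  dominant_top : forall x, (forall i, wt x i != -1) -> x = top;
  level_dominant_uniq : forall x y, cf x p = cf y p ->
    (forall i, i != p -> wt x i != -1) -> (forall i, i != p -> wt y i != -1) ->
    x = y }.

Section Model.
Variables (n : nat) (a : 'I_n -> 'I_n -> int) (p : 'I_n).
Hypothesis SL : simply_laced a.
Variable M : minuscule_model a p.
Implicit Types (x y : M) (i j : 'I_n).

(** The height of [omega_p - wt x]. Reflecting where the weight is -1 lowers it by one, which makes
    it the induction measure. *)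
Definition depth x : int := \sum_i cf x i.

Lemma depth_refl i x : depth (refl i x) = depth x + wt x i.
Proof.
rewrite /depth; under eq_bigr => j _ do rewrite cf_refl.
rewrite big_split /=; congr (_ + _).
rewrite (bigD1 i) //= eqxx mul1r big1 ?addr0 // => j ji.
by rewrite eq_sym (negbTE ji) mul0r.
Qed.

Lemma depth_ind (Pr : M -> Prop) :
  (forall x, (forall y, depth y < depth x -> Pr y) -> Pr x) -> forall x, Pr x.
Proof.
move=> step x; pose r y := #|[set z : M | depth z < depth y]|.
have [m] := ubnP (r x); elim: m x => // m IH x; rewrite ltnS => rx.
apply: step => y yx; apply: IH; apply: leq_trans rx; apply: proper_card.
rewrite properE; apply/andP; split.
  by apply/subsetP => z; rewrite !inE => /lt_trans; apply.
by apply/subsetPn; exists y; rewrite !inE ?ltxx.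
Qed.

Lemma wt_reflC i x : wt (refl i x) i = - wt x i.
Proof. by rewrite wt_refl (cartan_diag SL); lia. Qed.

Lemma cartan_neg i j : i != j -> a i j <> 0 -> a i j = -1.
Proof. by move/(cartan_offdiag SL) => []. Qed.

(** Which reflections raise an element depends only on its weight, so [x] and [y] climb together
    until both are the top. *)
Lemma wt_inj x y : wt x =1 wt y -> x = y.
Proof.
elim/depth_ind: x y => x IH y xy.
case: (pickP (fun i => wt x i == -1)) => [i /eqP xi|dom]; last first.
  have topx i : wt x i != -1 by have := dom i; case: eqP.
  rewrite (dominant_top topx) (@dominant_top _ _ _ _ y) // => i.
  by rewrite -xy.
apply: (can_inj (reflK i)); apply: IH; first by rewrite depth_refl; lia.
by move=> j; rewrite !wt_refl !xy.
Qed.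

(** Both sides agree at the top and change alike under reflections; this is what makes [cf x] the
    coordinates of [omega_p - wt x]. *)
Lemma wt_cf x i : wt x i = (i == p)%:Z - \sum_j a i j * cf x j.
Proof.
elim/depth_ind: x i => x IH i.
case: (pickP (fun i => wt x i == -1)) => [j /eqP xj|dom]; last first.
  have topx j : wt x j != -1 by have := dom j; case: eqP.
  rewrite (dominant_top topx) wt_top big1 ?subr0 // => j _.
  by rewrite cf_top mulr0.
have := IH (refl j x); rewrite depth_refl xj => /(_ _ i) E.
have {E}: wt (refl j x) i = (i == p)%:Z - \sum_j0 a i j0 * cf (refl j x) j0.
  by apply: E; lia.
rewrite wt_refl xj; under eq_bigr => l _ do rewrite cf_refl mulrDr.
rewrite big_split /= xj.
have -> : \sum_l a i l * ((j == l)%:Z * -1) = - a i j.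
  rewrite (bigD1 j) //= eqxx big1 ?addr0 ?mul1r ?mulrN1 // => l lj.
  by rewrite eq_sym (negbTE lj) mul0r mulr0.
move=> E; rewrite [LHS](_ : _ = wt x i - a i j * -1 - a i j); last by lia.
rewrite E; move: (\sum_l _) => c; lia.
Qed.

Lemma reflC i j x : i != j -> a i j = 0 -> refl i (refl j x) = refl j (refl i x).
Proof.
move=> ij aij; apply: wt_inj => l; rewrite !wt_refl aij (cartan_sym SL j i) aij.
by lia.
Qed.

(** The quantifier over [Pr] records a path of raising moves from [x] to the Levi-dominant [t]
    without naming it: any property invariant under these moves transfers between the two ends. *)
Lemma level_climb x : exists t,
  [/\ cf t p = cf x p, forall i, i != p -> wt t i != -1 &
   forall Pr : M -> Prop,
     (forall y i, i != p -> cf y p = cf x p -> wt y i = -1 -> Pr (refl i y) <-> Pr y) ->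
     Pr t <-> Pr x].
Proof.
elim/depth_ind: x => x IH.
case: (pickP (fun i => (i != p) && (wt x i == -1))) => [i /andP[ip /eqP xi]|dom].
  have cfi : cf (refl i x) p = cf x p by rewrite cf_refl (negbTE ip) mul0r addr0.
  have [|t [ct dt Pt]] := IH (refl i x); first by rewrite depth_refl; lia.
  exists t; split=> //; first by rewrite ct.
  move=> Pr PrP; apply: (iff_trans (Pt _ _)); first by rewrite cfi.
  exact: PrP.
exists x; split=> // i ip; have := dom i; rewrite ip /=.
by case: eqP.
Qed.

(** Both elements climb to the unique Levi-dominant element of their level. The simplicity of the
    summands rests on this. *)
Lemma level_connected (Pr : M -> Prop) x y : cf x p = cf y p ->
    (forall z i, i != p -> cf z p = cf x p -> wt z i = -1 -> Pr (refl i z) <-> Pr z) ->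
  Pr x -> Pr y.
Proof.
move=> xy PrP Px; have [t [ct dt Pt]] := level_climb x.
have [t' [ct' dt' Pt']] := level_climb y.
have E : t = t' by apply: level_dominant_uniq; rewrite // ct ct'.
by apply/(Pt' Pr); rewrite -?E; [rewrite -xy | apply/(Pt Pr)].
Qed.

(** The climb of [wt_inj] with the node [p] left out; [level_dominant_uniq] takes the place of
    [dominant_top]. *)
Lemma level_wt_inj x y : cf x p = cf y p ->
  (forall i, i != p -> wt x i = wt y i) -> x = y.
Proof.
elim/depth_ind: x y => x IH y cxy xy.
case: (pickP (fun i => (i != p) && (wt x i == -1))) => [i /andP[ip /eqP xi]|dom].
  apply: (can_inj (reflK i)); apply: IH; first by rewrite depth_refl; lia.
    by rewrite !cf_refl (negbTE ip); lia.
  by move=> j jp; rewrite !wt_refl !xy.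
have dx i : i != p -> wt x i != -1.
  by move=> ip; have := dom i; rewrite ip /=; case: eqP.
by apply: level_dominant_uniq => // i ip; rewrite -xy ?dx.
Qed.

Section Operators.
Variables (K : fieldType) (L : vectType K) (E F H : 'I_n -> L -> L) (v : L).
Hypothesis char0 : forall m : int, m%:~R = 0 :> K -> m = 0.
Hypothesis linE : forall i b u w, E i (b *: u + w) = b *: E i u + E i w.
Hypothesis linF : forall i b u w, F i (b *: u + w) = b *: F i u + F i w.
Hypothesis linH : forall i b u w, H i (b *: u + w) = b *: H i u + H i w.
Hypothesis EF : forall i j w, E i (F j w) - F j (E i w) = if i == j then H i w else 0.
Hypothesis HF : forall i j w, H i (F j w) = F j (H i w) - (a i j)%:~R *: F j w.
Hypothesis FF : forall i j w, i != j -> a i j = 0 -> F i (F j w) = F j (F i w).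
Hypothesis v_neq0 : v != 0.
Hypothesis Ev : forall i, E i v = 0.
Hypothesis Hv : forall i, H i v = (i == p)%:Z%:~R *: v.

(** A relation and not a function, since different sequences of lowering operators could a priori
    lead to different vectors over the same element. *)
Inductive lowered : M -> L -> Prop :=
| lowered_top : lowered (top M) v
| lowered_step x w i : lowered x w -> wt x i = 1 -> lowered (refl i x) (F i w).

Lemma commEF i j w : i != j -> E i (F j w) = F j (E i w).
Proof. by move=> ij; apply/eqP; rewrite -subr_eq0 EF (negbTE ij). Qed.

Lemma EFii i w : E i (F i w) = F i (E i w) + H i w.
Proof. by have := EF i i w; rewrite eqxx => <-; rewrite addrC subrK. Qed.

Lemma singular_eq0 i m (y : L) : E i y = 0 -> H i y = (- m.+1%:Z)%:~R *: y -> y = 0.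
Proof.
move=> Ey Hy; apply: (@sl2_singular_eq0 _ _ char0 (E i) (F i) (H i) m y) => //.
- by move=> w; rewrite EFii addrC addKr.
- by move=> w; rewrite HF (cartan_diag SL).
Qed.

(** The vector [F i w] is singular of weight -2. *)
Lemma weight0_F i w : E i w = 0 -> H i w = 0 -> F i w = 0.
Proof.
move=> Ew Hw; have F0 := raw_linear0 (@linF i); apply: (@singular_eq0 i 1).
  by rewrite EFii Ew F0 Hw addr0.
by rewrite HF Hw F0 (cartan_diag SL) sub0r mulrNz scaleNr.
Qed.

(* The hypothesis that weights take the values -1, 0, 1 on coroots leaves, at each
   vector of the chain, only the sl2-strings of length 1 and 2. *)
Lemma lowered_weight x w : lowered x w ->
  [/\ w != 0, forall i, H i w = (wt x i)%:~R *: w,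
      forall i, wt x i != -1 -> E i w = 0,
      forall i, wt x i != 1 -> F i w = 0 &
      forall i, wt x i = -1 -> lowered (refl i x) (E i w) /\ F i (E i w) = w]
  /\ forall w', lowered x w' -> w' = w.
Proof.
elim/depth_ind: x w => x IH w xw.
have F0 i : F i 0 = 0 by exact: raw_linear0 (@linF i).
have props: [/\ w != 0, forall i, H i w = (wt x i)%:~R *: w,
      forall i, wt x i != -1 -> E i w = 0,
      forall i, wt x i != 1 -> F i w = 0 &
      forall i, wt x i = -1 -> lowered (refl i x) (E i w) /\ F i (E i w) = w].
  case: x w / xw IH => [|x w i xw xi] IH.
    split=> [//|i|i _|i|i]; rewrite ?wt_top //.
      case: (eqVneq i p) => // ip _; apply: weight0_F; first exact: Ev.
      by rewrite Hv (negbTE ip) scale0r.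
  have dlt y : depth y <= depth x -> depth y < depth (refl i x).
    by rewrite depth_refl xi; lia.
  have [[w0 Hw Ew Fw lw] uw] := IH x (dlt x (lexx _)) w xw.
  have wtx j : wt (refl i x) j = wt x j - a j i by rewrite wt_refl xi mulr1.
  have EFw : E i (F i w) = w.
    by rewrite EFii Ew ?xi // F0 add0r Hw xi scale1r.
  have HFw j : H j (F i w) = (wt (refl i x) j)%:~R *: F i w.
    by rewrite HF Hw (raw_linearZ _ _ (@linF i)) -scalerBl -intrB wtx.
  have EFj j : wt (refl i x) j != -1 -> E j (F i w) = 0.
    case: (eqVneq j i) => [->|ji]; first by rewrite wtx xi (cartan_diag SL).
    move=> xj; rewrite commEF //; have [xj1|xj1] := eqVneq (wt x j) (-1); last first.
      by rewrite Ew.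
    have [aji|aji] := cartan_offdiag SL ji; first by rewrite wtx xj1 aji in xj.
    (* Here [a j i = -1]. The vector [E j w] sits at [refl j x], where node [i] has weight 0, so
       [F i] kills it. *)
    have [lj _] := lw j xj1.
    have [|[_ _ _ Fj _] _] := IH (refl j x) _ _ lj.
      by apply: dlt; rewrite depth_refl xj1; lia.
    by apply: Fj; rewrite wt_refl (cartan_sym SL i j) aji xi xj1.
  split=> //.
  - by apply: contra w0 => /eqP Fw0; rewrite -EFw Fw0 (raw_linear0 (@linE i)).
  - move=> j xj; have [ji|ji] := eqVneq j i.
      (* The vector [F i (F i w)] is singular of weight -3. *)
      subst j; apply: (@singular_eq0 i 2).
        rewrite EFii EFw HFw wtx xi (cartan_diag SL).
        by rewrite (_ : 1 - 2 = -1 :> int) // mulrN1z scaleN1r addrN.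
      rewrite HF HFw wtx xi (cartan_diag SL) (raw_linearZ _ _ (@linF i)).
      by rewrite -scalerBl -intrB.
    have [xj1|xj1] := eqVneq (wt (refl i x) j) (-1); last first.
      have xj0 : wt (refl i x) j = 0 by have := wt_range (refl i x) j; lia.
      by apply: weight0_F; [exact: EFj | rewrite HFw xj0 scale0r].
    (* With [a j i = -1] the weight of [x] at [j] would be -2, outside the allowed range. *)
    have aji : a j i = 0.
      have := wt_range x j; have := cartan_offdiag SL ji; move: xj1; rewrite wtx.
      by lia.
    by rewrite FF // Fw ?F0 //; move: xj1; rewrite wtx aji; lia.
  - move=> j xj1; have [ji|ji] := eqVneq j i; first by subst j; rewrite EFw reflK.
    have aji : a j i = 0.
      have := wt_range x j; have := cartan_offdiag SL ji; move: xj1; rewrite wtx.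
      by lia.
    have xj : wt x j = -1 by move: xj1; rewrite wtx aji subr0.
    have [lj FEj] := lw j xj.
    rewrite commEF // reflC //; split; last by rewrite FF // FEj.
    apply: lowered_step => //.
    by rewrite wt_refl (cartan_sym SL i j) aji mul0r subr0.
(* Uniqueness: undo the last step of [w']. Raising [w] at that node gives a lowered vector of
   smaller depth, identified by induction, and [F i] leads back. No step ends at the top, because a
   step by [i] ends with weight -1 at [i]. *)
split=> // w' xw'; have [_ _ _ _ lw] := props.
case: x w' / xw' xw IH props lw => [|x w' i xw' xi] xw IH props lw.
  move: (xw); move E1: (top M) => y yw; case: y w / yw E1 xw IH props lw => //.
  move=> y w i yw yi ytop; have := wt_top M i; rewrite ytop wt_reflC yi.
  by case: (i == p).
have [|lE <-] := lw i; first by rewrite wt_reflC xi.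
rewrite reflK in lE; congr (F i _).
have [|_ uw] := IH x _ _ xw'; first by rewrite depth_refl xi; lia.
by rewrite (uw _ lE).
Qed.

Lemma lowered_exists x : exists w, lowered x w.
Proof.
elim/depth_ind: x => x IH.
case: (pickP (fun i => wt x i == -1)) => [i /eqP xi|dom]; last first.
  rewrite (@dominant_top _ _ _ _ x); first by exists v; exact: lowered_top.
  by move=> i; have := dom i; case: eqP.
have [|w xw] := IH (refl i x); first by rewrite depth_refl xi; lia.
exists (F i w); rewrite -[x](reflK i); apply: lowered_step => //.
by rewrite wt_reflC xi.
Qed.

Lemma weight_basis : exists b : M -> L,
  [/\ b (top M) = v, forall x, b x != 0, forall x i, H i (b x) = (wt x i)%:~R *: b x,
      forall x i, E i (b x) = if wt x i == -1 then b (refl i x) else 0 &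
      forall x i, F i (b x) = if wt x i == 1 then b (refl i x) else 0].
Proof.
have [b lb] := fin_all_exists lowered_exists; exists b.
split=> [|x|x i|x i|x i].
- by have [_ ub] := lowered_weight (lb (top M)); rewrite (ub _ lowered_top).
all: have [[b0 Hb Eb Fb EFb] ub] := lowered_weight (lb x).
- exact: b0.
- exact: Hb.
- case: eqP => [xi|/eqP xi]; last exact: Eb.
  have [lE _] := EFb i xi.
  by have [_ uw] := lowered_weight (lb (refl i x)); rewrite (uw _ lE).
- case: eqP => [xi|/eqP xi]; last exact: Fb.
  have [_ uw] := lowered_weight (lb (refl i x)).
  by rewrite (uw _ (lowered_step (lb x) xi)).
Qed.

End Operators.
End Model.

(* Condition [prec_step B A] points down from [A]: higher antichains are higher weights. *)
Definition antichain_model n (a : 'I_n -> 'I_n -> int) (p : 'I_n)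
    (M : minuscule_model a p) (P : finposet) : Prop :=
  exists phi : {set fp_T P} -> M,
  [/\ forall A, antichain A -> cf (phi A) p = #|A|%:Z,
      forall A B, antichain A -> antichain B -> phi A = phi B -> A = B,
      forall x, exists2 A, antichain A & phi A = x,
      forall A i, antichain A -> i != p -> wt (phi A) i = 1 ->
        exists B, [/\ antichain B, phi B = refl i (phi A) & prec_step B A] &
      forall A B i, antichain A -> antichain B -> prec_step A B -> i != p ->
        cf (phi B) i <= cf (phi A) i].

Lemma antichain_sub (P : finposet) (A B : {set fp_T P}) :
  B \subset A -> antichain A -> antichain B.
Proof.
move=> /subsetP BA /andP[/forallP A1 /forallP A2]; apply/andP; split.
  by apply/forallP => x; apply/implyP => /BA; exact: (implyP (A1 x)).
apply/forallP => x; apply/implyP => /BA xA; apply/forallP => y; apply/implyP => /BA.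
by apply/implyP; have /implyP/(_ xA)/forallP := A2 x; apply.
Qed.

(** Subsets of a largest antichain are antichains; this makes every summand nonzero. *)
Lemma antichain_card (P : finposet) (i : nat) :
  (i <= width P)%N -> exists2 A : {set fp_T P}, antichain A & #|A| = i.
Proof.
move=> ile; have [A0 aA0] : {A0 : {set fp_T P} | antichain A0 & width P = #|A0|}.
  apply: eq_bigmax_cond; apply/card_gt0P; exists set0.
  by rewrite unfold_in; apply/andP; split; apply/forallP => x; rewrite inE.
move=> sA0; pose B := [set x in take i (enum A0)].
exists B.
  apply: antichain_sub aA0; apply/subsetP => x; rewrite inE => /mem_take.
  by rewrite mem_enum.
rewrite cardsE; have /card_uniqP -> : uniq (take i (enum A0)) by rewrite take_uniq ?enum_uniq.
by rewrite size_takel // -cardE -sA0.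
Qed.

(** * The order of Levi weights and exchanges in antichains *)

Section WeightOrder.
Variables (n : nat) (a : 'I_n -> 'I_n -> int) (p : 'I_n).
Hypothesis SL : simply_laced a.
Variable M : minuscule_model a p.
Implicit Types (x y : M) (i j : 'I_n).

Definition levi_le x y : Prop := exists c : 'I_n -> nat,
  forall i, i != p -> wt y i - wt x i = \sum_(j | j != p) (c j)%:Z * a i j.

Lemma levi_le_refl x : levi_le x x.
Proof. by exists (fun=> 0%N) => i _; rewrite subrr big1 // => j _; rewrite mul0r. Qed.

Lemma levi_le_trans y x z : levi_le x y -> levi_le y z -> levi_le x z.
Proof.
move=> [c xy] [d yz]; exists (fun j => (c j + d j)%N) => i ip.
rewrite -(subrKA (wt y i)) addrC (xy i ip) (yz i ip) -big_split /=.
by apply: eq_bigr => j _; rewrite PoszD mulrDl.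
Qed.

(** By [wt_cf], [wt y - wt x] has the coordinates [cf x - cf y] in the simple roots, and on a level
    the one at [p] vanishes. *)
Lemma cf_levi_le x y : cf x p = cf y p ->
  (forall i, i != p -> cf y i <= cf x i) -> levi_le x y.
Proof.
move=> xyp xy; exists (fun j => `|cf x j - cf y j|%N) => i ip.
rewrite !wt_cf opprB addrC subrKA -sumrB (bigD1 p) //= xyp subrr.
rewrite add0r; apply: eq_bigr => j jp; have := xy j jp => cj.
by rewrite -mulrBr mulrC gez0_abs // subr_ge0.
Qed.

(* Pairing with the vector of [cartan_pos] shows that a nonzero nonnegative combination
   of simple roots is positive on some simple coroot of its support. *)
Lemma levi_pos_coroot (c : 'I_n -> nat) j : j != p -> (0 < c j)%N ->
  exists i, [/\ i != p, (0 < c i)%N & 0 < \sum_(j | j != p) (c j)%:Z * a i j].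
Proof.
move=> jp cj; have [u [u0 upos]] := cartan_pos SL.
have cneg i l : i != l -> (c l)%:Z * a i l <= 0.
  by move=> il; have [->|->] := cartan_offdiag SL il; lia.
case: (pickP (fun i => (i != p) && (0 < \sum_(j | j != p) (c j)%:Z * a i j))).
  move=> i /andP[ip sp]; exists i; split=> //; rewrite lt0n.
  apply/negP => /eqP ci; move: sp; rewrite ltNge => /negP; apply.
  apply: sumr_le0 => l _; have [->|il] := eqVneq l i; first by rewrite ci mul0r.
  by apply: cneg; rewrite eq_sym.
move=> neg; exfalso.
(* After exchanging the sums, [c l] is multiplied by the pairing of [u] with column [l] without its
   row [p]; the omitted term [u p * a p l] is at most 0, so the factor stays positive. *)
have: 0 < \sum_(i | i != p) u i * \sum_(l | l != p) (c l)%:Z * a i l.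
  under eq_bigr => i _ do rewrite mulr_sumr.
  rewrite exchange_big /=.
  have E l : l != p -> \sum_(i | i != p) u i * ((c l)%:Z * a i l) =
      (c l)%:Z * (\sum_i u i * a i l - u p * a p l).
    move=> lp; rewrite [\sum_i u i * a i l](bigD1 p) //= [X in X - _]addrC addrK mulr_sumr.
    by apply: eq_bigr => i _; rewrite mulrCA.
  have pos l : l != p -> 0 < \sum_i u i * a i l - u p * a p l.
    move=> lp; have := upos l; have pl : p != l by rewrite eq_sym.
    have : u p * a p l <= 0.
      by have := u0 p; have [->|->] := cartan_offdiag SL pl; lia.
    by move: (\sum_i _) => s; lia.
  rewrite (bigD1 j) //= ltr_wpDr //.
    apply: sumr_ge0 => l /andP[lp _]; rewrite E //.
    by apply: mulr_ge0 => //; exact/ltW/pos.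
  by rewrite E //; apply: mulr_gt0; [lia | exact: pos].
rewrite ltNge => /negP; apply; apply: sumr_le0 => i ip.
have := neg i; rewrite ip /= => /negbT; rewrite -leNgt => s0.
exact: mulr_ge0_le0.
Qed.

(** Induction on the number of simple roots in [wt y - wt x]: this difference is positive on some
    simple coroot of its support, and there one of the two ends can be moved towards the other. *)
Lemma levi_le_steps (R : M -> M -> Prop) :
    (forall x, R x x) -> (forall x y z, R x y -> R y z -> R x z) ->
    (forall x i, i != p -> wt x i = -1 -> R x (refl i x)) ->
  forall x y, cf x p = cf y p -> levi_le x y -> R x y.
Proof.
move=> Rxx Rtr Rstep x y xyp [c]; have [m] := ubnP (\sum_(j | j != p) c j)%N.
elim: m c x y xyp => // m IH c x y xyp; rewrite ltnS => cm xy.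
case: (pickP (fun j => (j != p) && (0 < c j)%N)) => [j /andP[jp cj]|c0]; last first.
  suff -> : x = y by [].
  apply: (level_wt_inj xyp) => i ip; apply/esym/eqP.
  rewrite -subr_eq0 xy // big1 // => j jp.
  by have := c0 j; rewrite jp lt0n /= => /negbFE/eqP->; rewrite mul0r.
have [i [ip ci spos]] := levi_pos_coroot jp cj.
pose c' l := (c l - (l == i))%N.
have sc' : (\sum_(l | l != p) c' l < m)%N.
  move: cm; rewrite (bigD1 i) //= [X in _ -> (X < _)%N](bigD1 i) //= /c' eqxx.
  rewrite (@eq_bigr _ _ _ _ _ _ (fun l => (c l - (l == i))%N) c); first by lia.
  by move=> l /andP[_ /negbTE->]; rewrite subn0.
have ac' l : \sum_(j0 | j0 != p) (c' j0)%:Z * a l j0 =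
    \sum_(j0 | j0 != p) (c j0)%:Z * a l j0 - a l i.
  rewrite (bigD1 i) //= [X in _ = X - _](bigD1 i) //= /c' eqxx.
  rewrite (@eq_bigr _ _ _ _ _ _ (fun j0 => (c j0 - (j0 == i))%:Z * a l j0)
    (fun j0 => (c j0)%:Z * a l j0)) => [|j0 /andP[_ /negbTE->]]; last by rewrite subn0.
  move: (\sum_(_ | _) _) => s; rewrite -subzn // mulrBl mul1r; ring.
have := xy i ip; have := wt_range x i; have := wt_range y i.
have ip' : (i == p) = false by exact: negbTE.
(* Either [x] can be raised at [i], or [wt x i >= 0], which forces [wt y i = 1], and [y] can be
   lowered. Both moves use up one unit of [c i]. *)
have [xi|xi] := eqVneq (wt x i) (-1).
  move=> _ _ _; apply: Rtr (Rstep x i ip xi) _; apply: (IH c') => //.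
    by rewrite cf_refl ip' mul0r addr0.
  move=> l lp; rewrite ac' wt_refl xi -(xy l lp); ring.
move=> yi1 xi1 E; have yi : wt y i = 1 by move: spos; rewrite -E; lia.
apply: (Rtr _ (refl i y)); last first.
  rewrite -{2}[y](reflK i); apply: Rstep; rewrite // (wt_reflC SL) yi //.
apply: (IH c') => //; first by rewrite cf_refl ip' mul0r addr0.
move=> l lp; rewrite ac' wt_refl yi -(xy l lp); ring.
Qed.

(** An exchange does not increase any coordinate off [p], hence raises the Levi weight; conversely
    the steps of [levi_le_steps] are lowering moves read backwards, which are exchanges. *)
Lemma antichain_model_le (P : finposet) : antichain_model M P ->
  exists2 phi : {set fp_T P} -> M,
    [/\ forall A, antichain A -> cf (phi A) p = #|A|%:Z,
        forall A B, antichain A -> antichain B -> phi A = phi B -> A = B &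
        forall x, exists2 A, antichain A & phi A = x] &
    forall m A B, A \in Aset P m -> B \in Aset P m ->
      le_i m A B <-> levi_le (phi A) (phi B).
Proof.
case=> phi [plev pinj psurj pdown pcf]; exists phi => // m A B Am Bm.
split=> [/connectP[s]|].
  elim: s A Am => [|C s IH] A Am /=; first by move=> _ ->; exact: levi_le_refl.
  case/andP => /and3P[_ Cm AC] sp lastB.
  apply: levi_le_trans (IH C Cm sp lastB); move: Am Cm.
  rewrite !inE => /andP[aA /eqP sA] /andP[aC /eqP sC].
  apply: cf_levi_le => [|i ip]; first by rewrite !plev // sA sC.
  exact: pcf.
move: Am Bm; rewrite !inE => /andP[aA /eqP sA] /andP[aB /eqP sB] AB.
pose R x y := forall A B, antichain A -> antichain B -> #|A| = m -> #|B| = m ->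
  phi A = x -> phi B = y -> le_i m A B.
(* Keeping track of the level in [R'] ensures, for transitivity, that the intermediate element comes
   from an antichain of size [m]. *)
pose R' x y := cf x p = m%:Z -> cf y p = m%:Z /\ R x y.
have Rxx x : R' x x.
  move=> xm; split=> // C D aC aD _ _ pC pD.
  by rewrite (pinj C D) ?pC ?pD //; exact: connect0.
suff: R' (phi A) (phi B).
  by case; rewrite ?plev ?sA // => _; apply.
apply: levi_le_steps AB => [//|x y z xy yz xm||]; last by rewrite !plev // sA sB.
  have [ym Rxy] := xy xm; have [zm Ryz] := yz ym; split=> // C D aC aD sC sD pC pD.
  have [C' aC' pC'] := psurj y.
  have sC' : #|C'| = m by move: (plev C' aC'); rewrite pC' ym => -[].
  by apply: (@connect_trans _ _ C'); [apply: Rxy | apply: Ryz].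
move=> x i ip xi xm; split; first by rewrite cf_refl (negbTE ip) mul0r addr0.
move=> C D aC aD sC sD pC pD.
have [|D' [aD' pD' DD']] := pdown D i aD ip; first by rewrite pD (wt_reflC SL) xi.
have E : D' = C by apply: pinj; rewrite // pD' pD reflK pC.
by apply: connect1; rewrite !inE aC aD sC sD !eqxx -E DD'.
Qed.

End WeightOrder.

(** * The decomposition of the module, given a model *)

Section Decomposition.
Variables (K : fieldType) (t : sltype) (n : nat) (p : 'I_n).
Hypothesis char0 : forall m : int, m%:~R = 0 :> K -> m = 0.
Hypothesis SL : simply_laced (@cartan t n).
Variables (M : minuscule_model (@cartan t n) p) (P : finposet).
Hypothesis MP : antichain_model M P.
Variables (g : vectType K) (br : g -> g -> g) (e f h : 'I_n -> g).
Variables (L : vectType K) (act : g -> L -> L) (k : {vspace g}).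
Hypothesis serre : serre_generators t br e f h.
Hypothesis modL : lie_module br act.
Hypothesis hwL : highest_weight_fund act e h p.+1.
Hypothesis genk : lie_generated br
    (fun x => exists2 i : 'I_n, i.+1 != p.+1 & (x = e i \/ x = f i \/ x = h i)) k.

Let linact x c u w : act x (c *: u + w) = c *: act x u + act x w.
Proof. by case: modL. Qed.

Let char0_inj : injective (fun m : int => m%:~R : K).
Proof. exact: intr_inj0. Qed.

Let act0l w : act 0 w = 0.
Proof.
by case: modL => actl _ _; have := actl (-1) 0 0 w; rewrite scaler0 addr0 scaleN1r addNr.
Qed.

Let actZl c x w : act (c *: x) w = c *: act x w.
Proof. by case: modL => actl _ _; rewrite -[c *: x]addr0 actl act0l addr0. Qed.

(** The span of the vectors of [weight_basis] is stable under the Serre generators and nonzero, so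
    it is the whole irreducible module. *)
Lemma module_weight_basis : exists b : M -> L,
  [/\ forall x, b x != 0, forall x i, act (h i) (b x) = (wt x i)%:~R *: b x,
      forall x i, act (e i) (b x) = if wt x i == -1 then b (refl i x) else 0,
      forall x i, act (f i) (b x) = if wt x i == 1 then b (refl i x) else 0 &
      (\sum_x <[b x]>)%VS = fullv].
Proof.
have [[_ _ simpL] [v v0 hv]] := hwL.
have [[_ ef _ hf] [_ ff genL]] := serre; have [_ _ actbr] := modL.
have [] := @weight_basis n _ p SL M K L (fun i => act (e i)) (fun i => act (f i))
  (fun i => act (h i)) v char0 _ _ _ _ _ _ v0; try by move=> *; apply: linact.
- move=> i j w; rewrite -actbr ef; case: eqP => // _; exact: act0l.
- move=> i j w; have := actbr (h i) (f j) w; rewrite hf -scaleNr actZl => E.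
  by rewrite -scaleNr E addrC subrK.
(* When [a i j = 0] the Serre exponent is 1, so the relation says that [f i] and [f j] commute. *)
- move=> i j w ij aij; apply/eqP; rewrite -subr_eq0 -actbr.
  by have := ff i j ij; rewrite aij subr0 /= => ->; rewrite act0l.
- by move=> i; case: (hv i).
- move=> i; case: (hv i) => _ ->; rewrite eqSS val_eqE.
  by case: (i == p).
move=> b [btop b0 Hb Eb Fb]; exists b; split=> //.
set W := (\sum_x <[b x]>)%VS.
have bW x : b x \in W by apply: (subvP (sumv_sup x _ (subvv _))) => //; exact: memv_line.
have stable y : (forall x, act y (b x) \in W) -> forall w, w \in W -> act y w \in W.
  move=> yb w /memv_sumP[u uW ->]; rewrite (raw_linear_sum _ _ _ (linact y)).
  apply: rpred_sum => x _; have /vlineP[c ->] := uW x isT.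
  by rewrite (raw_linearZ _ _ (linact y)) rpredZ.
have subW : submodule act fullv W.
  apply: (lie_generated_submodule modL genL) => y w [i [->|[->|->]]];
    apply: stable => x; rewrite ?Eb ?Fb ?Hb ?rpredZ //.
  - by case: ifP; rewrite ?mem0v.
  - by case: ifP; rewrite ?mem0v.
case: (simpL W subW (subvf _)) => // W0.
by have := bW (top M); rewrite W0 memv0 btop (negbTE v0).
Qed.

Lemma is_weight_levi (b : M -> L) (W : {vspace L}) (m : int) (mu : {ffun 'I_n -> K}) :
    (forall x, b x != 0) -> (forall x i, act (h i) (b x) = (wt x i)%:~R *: b x) ->
    (W = \sum_(x : M | cf x p == m) <[b x]>)%VS ->
  is_weight act h [set j : 'I_n | j.+1 != p.+1] W mu <->
  exists2 x : M, cf x p = m & mu = [ffun i => if i != p then (wt x i)%:~R else 0].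
Proof.
move=> b0 Hb WE; have inS j : (j \in [set j : 'I_n | j.+1 != p.+1]) = (j != p).
  by rewrite inE eqSS.
split; last first.
  case=> x xm ->; split=> [i|]; first by rewrite inS ffunE => /negbTE->.
  exists (b x); split=> //.
    rewrite WE; apply: (subvP (sumv_sup x _ (subvv _))); rewrite ?xm //.
    exact: memv_line.
  by move=> i; rewrite inS ffunE => ->.
case=> mu0 [w [wW w0 Hw]].
move: wW; rewrite WE => /memv_sumP[u uW wE].
have [x xm ux] : exists2 x, cf x p = m & u x != 0.
  case: (pickP (fun x => (cf x p == m) && (u x != 0))) => [x /andP[/eqP xm ux]|no].
    by exists x.
  case/eqP: w0; rewrite wE big1 // => x xm; apply/eqP.
  by have := no x; rewrite xm => /negbFE.
exists x => //; apply/ffunP => i; rewrite ffunE; case: ifPn => [ip|/negPn ip]; last first.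
  by apply: mu0; rewrite inS negbK.
have: act (h i) w - mu i *: w = 0 by rewrite Hw ?subrr ?inS.
rewrite wE (raw_linear_sum _ _ _ (linact (h i))) scaler_sumr -sumrB => S0.
have Hu y j : cf y p == m -> act (h j) (u y) = (wt y j)%:~R *: u y.
  move=> ym; have /vlineP[c ->] := uW y ym.
  by rewrite (raw_linearZ _ _ (linact (h j))) Hb !scalerA mulrC.
(* The components of the zero vector [act (h i) w - mu i *: w] have pairwise distinct Levi weights,
   so each of them vanishes. *)
have: ((wt x i)%:~R - mu i) *: u x \in 0%VS.
  apply: (@eigen_components _ _ M 'I_n (fun j => j != p) (fun j => act (h j))
    (fun x j => (wt x j)%:~R) [set y | cf y p == m]
    (fun y => ((wt y i)%:~R - mu i) *: u y)).
  - by move=> j; exact: linact.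
  - by move=> j y _; rewrite memv0 => /eqP->; rewrite (raw_linear0 (linact _)) mem0v.
  - move=> y z; rewrite !inE => /eqP ym /eqP zm yz.
    apply: NNPP => no; case/eqP: yz; apply: level_wt_inj; first by rewrite ym.
    move=> j jp; apply: NNPP => /eqP yz; apply: no; exists j => //.
    by apply: contra yz => /eqP/char0_inj->.
  - move=> y j; rewrite inE => ym _.
    by rewrite (raw_linearZ _ _ (linact (h j))) Hu // !scalerA mulrC.
  - rewrite memv0 -[X in _ == X]S0; apply/eqP; apply: eq_big => [y|y].
      by rewrite inE.
    by rewrite inE => ym; rewrite Hu // scalerBl.
  by rewrite inE xm.
by rewrite memv0 scaler_eq0 (negbTE ux) orbF subr_eq0 => /eqP->.
Qed.

Lemma weight_le_levi (x y : M) :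
  weight_le t [set j : 'I_n | j.+1 != p.+1]
    [ffun i => if i != p then (wt x i)%:~R else 0 : K]
    [ffun i => if i != p then (wt y i)%:~R else 0 : K] <-> levi_le x y.
Proof.
have inS j : (j \in [set j : 'I_n | j.+1 != p.+1]) = (j != p) by rewrite inE eqSS.
have sumE (c : 'I_n -> nat) i :
    \sum_(j in [set j : 'I_n | j.+1 != p.+1]) (c j)%:R * (cartan t i j)%:~R =
    (\sum_(j | j != p) (c j)%:Z * cartan t i j)%:~R :> K.
  rewrite rmorph_sum; apply: eq_big => [j|j _]; first by rewrite inS.
  by rewrite /= rmorphM.
split=> -[c xy]; exists c => i.
  move=> ip; have := xy i; rewrite inS ip sumE !ffunE ip => /(_ isT).
  by rewrite -intrB => /char0_inj.
by rewrite inS sumE !ffunE => ip; rewrite ip -intrB xy.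
Qed.

(** The summand [V i] is spanned by the basis vectors of level [i]. *)
Lemma minuscule_decomposition :
  exists V : 'I_(width P).+1 -> {vspace L},
    [/\ directv (\sum_(i < (width P).+1) V i)%VS,
        (\sum_(i < (width P).+1) V i)%VS = fullv &
        forall i : 'I_(width P).+1,
          simple_submodule act k (V i) /\
          weights_iso_antichains t act h [set j : 'I_n | j.+1 != p.+1] (V i) P i].
Proof.
have [b [b0 Hb Eb Fb full]] := module_weight_basis.
have [phi [plev pinj psurj] ple] := antichain_model_le SL MP.
pose V (i : nat) : {vspace L} := (\sum_(x : M | cf x p == i%:Z) <[b x]>)%VS.
have bV (x : M) (i : nat) : cf x p = i%:Z -> b x \in V i.
  move=> xi; apply: (subvP (sumv_sup x _ (subvv _))); rewrite ?xi //.
  exact: memv_line.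
have sepL (i : nat) : {in [set x : M | cf x p == i%:Z] &, forall x y, x != y ->
    exists2 j, j != p & (wt x j)%:~R != (wt y j)%:~R :> K}.
  move=> y z; rewrite !inE => /eqP ym /eqP zm yz.
  apply: NNPP => no; case/eqP: yz; apply: level_wt_inj; first by rewrite ym.
  move=> j jp; apply: NNPP => /eqP yz; apply: no; exists j => //.
  by apply: contra yz => /eqP/char0_inj->.
have lev_width (x : M) : exists i : 'I_(width P).+1, cf x p = i%:Z.
  have [A aA <-] := psurj x; rewrite plev //.
  have lt : (#|A| < (width P).+1)%N by rewrite ltnS; exact: leq_bigmax_cond.
  by exists (Ordinal lt).
exists (fun i => V i); split.
(* All components of all summands are gathered into one sum over [M]; its terms have distinct
   weights by [wt_inj], so a zero sum has zero terms. *)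
- apply/directv_sum_independent => us usV sum0 i _.
  have us_sum (j : 'I_(width P).+1) : exists u : M -> L,
      (forall x : M, cf x p == j%:Z -> u x \in <[b x]>%VS) /\
      us j = \sum_(x : M | cf x p == j%:Z) u x.
    by have /memv_sumP[u uV uE] := usV j isT; exists u.
  have [u uP] := fin_all_exists us_sum.
  have [lv lvP] := fin_all_exists lev_width.
  have lvE (x : M) (j : 'I_(width P).+1) : (cf x p == j%:Z) = (lv x == j).
    by rewrite lvP eqz_nat val_eqE.
  suff u0 x : u (lv x) x = 0.
    by have [_ ->] := uP i; apply: big1 => x; rewrite lvE => /eqP <-.
  apply/eqP; rewrite -memv0.
  apply: (@eigen_components _ _ M 'I_n (fun=> True) (fun j => act (h j))
    (fun x j => (wt x j)%:~R) setT (fun x => u (lv x) x)) => //.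
  - by move=> j v _; rewrite memv0 => /eqP->; rewrite (raw_linear0 (linact _)) mem0v.
  - move=> y z _ _ yz; apply: NNPP => no; case/eqP: yz; apply: wt_inj => j.
    apply: NNPP => /eqP yz; apply: no; exists j => //.
    by apply: contra yz => /eqP/char0_inj->.
  - move=> y j _ _; have [/(_ y)] := uP (lv y); rewrite lvE eqxx => /(_ isT).
    case/vlineP => c -> _.
    by rewrite (raw_linearZ _ _ (linact (h j))) Hb !scalerA mulrC.
  rewrite memv0 -[X in _ == X]sum0 (partition_big lv predT) //=.
  apply/eqP/eq_bigr => j _; have [_ ->] := uP j.
  apply: eq_big => [y|y]; first by rewrite inE lvE.
  by rewrite inE /= => /eqP->.
- apply/eqP; rewrite eqEsubv subvf /= -full; apply/subv_sumP => x _.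
  have [i xi] := lev_width x; apply: (sumv_sup i) => //.
  by rewrite -memvE; apply: bV.
move=> i; split; last first.
  exists (fun A => [ffun j => if j != p then (wt (phi A) j)%:~R else 0]).
  have lev A : A \in Aset P i -> antichain A /\ cf (phi A) p = i%:Z.
    by rewrite inE => /andP[aA /eqP sA]; rewrite plev // sA.
  split.
  - by move=> A /lev[_ Ai]; apply/(is_weight_levi _ b0 Hb erefl); exists (phi A).
  - move=> mu /(is_weight_levi _ b0 Hb erefl)[x xi ->].
    have [A aA Ax] := psurj x; exists A; rewrite ?Ax //.
    by rewrite inE aA -eqz_nat -plev // Ax xi /=.
  - move=> A B /lev[aA Ai] /lev[aB Bi] /ffunP AB.
    apply: pinj => //; apply: level_wt_inj; first by rewrite Ai.
    by move=> j jp; have := AB j; rewrite !ffunE jp => /char0_inj.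
  move=> A B Ai Bi; apply: (iff_trans (ple _ _ _ Ai Bi)).
  exact: iff_sym (weight_le_levi _ _).
have subV : submodule act k (V i).
  apply: (lie_generated_submodule modL genk) => y w [j jp' yj]; have jp : j != p by rewrite -val_eqE -eqSS.
  move=> /memv_sumP[u uV ->]; rewrite (raw_linear_sum _ _ _ (linact y)).
  apply: rpred_sum => x xi; have /vlineP[c ->] := uV x xi.
  rewrite (raw_linearZ _ _ (linact y)) rpredZ //.
  have rV : b (refl j x) \in V i.
    by apply: bV; rewrite cf_refl (negbTE jp) mul0r addr0 (eqP xi).
  case: yj => [->|[->|->]]; rewrite ?Eb ?Fb ?Hb ?rpredZ //.
  - by case: ifP; rewrite ?mem0v.
  - by case: ifP; rewrite ?mem0v.
  - exact/bV/eqP.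
split=> //.
  have [A aA sA] := @antichain_card P i (ltn_ord i).
  apply/eqP => V0; have := bV (phi A) i; rewrite plev // sA V0 memv0.
  by rewrite (negbTE (b0 _)) => /(_ erefl).
move=> W subW WV; have [->|W0] := eqVneq W 0%VS; [by left | right].
apply/eqP; rewrite eqEsubv WV /=.
have kE j : j != p -> e j \in k /\ f j \in k /\ h j \in k.
  by case: genk => gk _ _ jp; split; [|split]; apply: gk; exists j; rewrite ?eqSS; auto.
(* A nonzero submodule contains a basis vector: it is stable under the [h j] with [j != p], hence
   contains every component of each of its vectors. *)
have [x xi xW] : exists2 x : M, cf x p = i%:Z & b x \in W.
  have := memv_pick W; move: W0; rewrite -vpick0.
  move: (vpick W) => w w0 wW; have /memv_sumP[u uV wE] := subvP WV _ wW.
  have [x xi ux] : exists2 x : M, cf x p = i%:Z & u x != 0.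
    case: (pickP (fun x => (cf x p == i%:Z) && (u x != 0))) => [x /andP[/eqP xm ux]|no].
      by exists x.
    case/eqP: w0; rewrite wE big1 // => x xm; apply/eqP.
    by have := no x; rewrite xm => /negbFE.
  exists x => //.
  suff: u x \in W.
    have /vlineP[c uE] := uV x (introT eqP xi).
    rewrite uE; move/(memvZ c^-1); rewrite scalerA mulVf ?scale1r //.
    by apply: contra ux => /eqP c0; rewrite uE c0 scale0r.
  apply: (@eigen_components _ _ M 'I_n (fun j => j != p) (fun j => act (h j))
    (fun x j => (wt x j)%:~R) [set y | cf y p == i%:Z] u) => //.
  - by move=> j v /kE[_ [_ hk]] vW; apply: subW.
  - move=> y j; rewrite inE => yi _; have /vlineP[c ->] := uV y yi.
    by rewrite (raw_linearZ _ _ (linact (h j))) Hb !scalerA mulrC.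
  - by under eq_bigl => y do rewrite inE; rewrite -wE.
  - by rewrite inE xi.
apply/subv_sumP => y /eqP yi; rewrite -memvE.
(* Membership in [W] passes along the edges of the level in both directions, upwards by [e j] and
   downwards by [f j]. *)
apply: (@level_connected _ _ _ M (fun x => b x \in W) x); rewrite ?xi ?yi //.
move=> z j jp zi zj; have [ek [fk _]] := kE j jp; split=> zW.
  have <- : act (f j) (b (refl j z)) = b z.
    by rewrite Fb (wt_reflC SL) zj /= reflK.
  exact: subW.
have <- : act (e j) (b z) = b (refl j z) by rewrite Eb zj.
exact: subW.
Qed.

End Decomposition.

(** * Poset isomorphisms and transport of the matching *)

(** All conditions are relative to [fp_elem], because the carrier type may be larger than the
    poset. *)
Definition poset_iso (P Q : finposet) (g : fp_T P -> fp_T Q) : Prop :=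
  [/\ forall x, fp_elem x -> fp_elem (g x),
      {in @fp_elem P &, injective g},
      forall y, fp_elem y -> exists2 x, fp_elem x & g x = y &
      forall x y, fp_elem x -> fp_elem y -> fp_le (g x) (g y) = fp_le x y].

Lemma poset_iso_comp (P Q R : finposet) (g : fp_T P -> fp_T Q) (g' : fp_T Q -> fp_T R) :
  poset_iso g -> poset_iso g' -> poset_iso (g' \o g).
Proof.
case=> [g1 g2 g3 g4] [h1 h2 h3 h4]; split=> /=.
- by move=> x /g1/h1.
- by move=> x y Px Py /h2 E; apply: g2 => //; apply: E; exact: g1.
- by move=> z /h3[y /g3[x Px <-] <-]; exists x.
- by move=> x y Px Py; rewrite h4 ?g4 ?g1.
Qed.

Lemma is_idealP (P : finposet) (X : {set fp_T P}) :
  reflect ((forall x, x \in X -> fp_elem x) /\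
           (forall x y, fp_elem x -> y \in X -> fp_le x y -> x \in X)) (is_ideal X).
Proof.
apply: (iffP andP) => -[X1 X2]; split.
- by move=> x; move/forallP: X1 => /(_ x)/implyP.
- move=> x y Px Xy xy; move/forallP: X2 => /(_ x)/forallP/(_ y)/implyP.
  by rewrite Px Xy xy; apply.
- by apply/forallP => x; apply/implyP; exact: X1.
apply/forallP => x; apply/forallP => y; apply/implyP => /andP[/andP[Px Xy]].
exact: X2.
Qed.

Lemma antichainP (P : finposet) (A : {set fp_T P}) :
  reflect ((forall x, x \in A -> fp_elem x) /\
           (forall x y, x \in A -> y \in A -> fp_le x y -> x = y)) (antichain A).
Proof.
apply: (iffP andP) => -[A1 A2]; split.
- by move=> x; move/forallP: A1 => /(_ x)/implyP.
- move=> x y Ax Ay xy; move/forallP: A2 => /(_ x)/implyP/(_ Ax)/forallP/(_ y).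
  by rewrite Ay xy implybF => /negPn/eqP.
- by apply/forallP => x; apply/implyP; exact: A1.
apply/forallP => x; apply/implyP => Ax; apply/forallP => y; apply/implyP => Ay.
by apply/implyP; apply: contra => xy; apply/eqP/A2.
Qed.

Lemma prec_stepP (P : finposet) (A B : {set fp_T P}) :
  reflect (exists a b, [/\ A :\: B = [set a], B :\: A = [set b], fp_le a b & a != b])
    (prec_step A B).
Proof.
apply: (iffP existsP) => [[a /existsP[b /and4P[/eqP ? /eqP ? ? ?]]]|[a [b [-> -> ? ?]]]].
  by exists a, b.
by exists a; apply/existsP; exists b; rewrite !eqxx; apply/and4P.
Qed.

Section Transport.
Variables (P Q : finposet) (g : fp_T P -> fp_T Q).
Hypothesis isog : poset_iso g.

Lemma iso_preimset (Y : {set fp_T Q}) : (forall y, y \in Y -> fp_elem y) ->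
  g @: [set x | fp_elem x & g x \in Y] = Y.
Proof.
case: isog => g1 g2 g3 g4 YQ; apply/setP => y; apply/imsetP/idP => [[x]|Yy].
  by rewrite inE => /andP[_ gY] ->.
have [x Px xy] := g3 y (YQ y Yy); exists x; rewrite // inE xy Yy andbT.
exact: Px.
Qed.

Lemma iso_imset_mem (X : {set fp_T P}) x : (forall z, z \in X -> fp_elem z) ->
  fp_elem x -> (g x \in g @: X) = (x \in X).
Proof.
case: isog => g1 g2 g3 g4 XP Px; apply/imsetP/idP => [[z Xz E]|Xx]; last by exists x.
by rewrite (g2 x z Px (XP z Xz) E).
Qed.

Lemma Jp_iso : @poset_iso (Jp P) (Jp Q) (fun X => g @: X).
Proof.
case: (isog) => g1 g2 g3 g4; split=> /=.
- move=> X /is_idealP[X1 X2]; apply/is_idealP; split.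
    by move=> _ /imsetP[x Xx ->]; apply/g1/X1.
  move=> y _ Py /imsetP[x Xx ->]; have [z Pz <-] := g3 y Py.
  rewrite (g4 z x Pz (X1 x Xx)) => zx; apply: imset_f; exact: X2 Pz Xx zx.
- move=> X Y /is_idealP[X1 _] /is_idealP[Y1 _] XY; apply/setP => x.
  apply/idP/idP => xX.
    by rewrite -iso_imset_mem ?X1 // -XY imset_f.
  by rewrite -iso_imset_mem ?Y1 // XY imset_f.
- move=> Y /is_idealP[Y1 Y2]; exists [set x | fp_elem x & g x \in Y].
    apply/is_idealP; split=> [x|x y Px]; rewrite !inE; first by case/andP.
    case/andP => Py gy xy; rewrite Px; apply: (Y2 _ (g y)) => //; first exact: g1.
    by rewrite g4.
  exact: iso_preimset.
move=> X Y /is_idealP[X1 _] /is_idealP[Y1 _]; apply/subsetP/subsetP => XY.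
  by move=> x Xx; rewrite -iso_imset_mem ?X1 //; apply/XY/imset_f.
by move=> _ /imsetP[x Xx ->]; apply/imset_f/XY.
Qed.

Lemma iso_antichain (A : {set fp_T P}) : antichain A -> antichain (g @: A).
Proof.
case: (isog) => g1 g2 g3 g4 /antichainP[A1 A2]; apply/antichainP; split.
  by move=> _ /imsetP[x Ax ->]; apply/g1/A1.
move=> _ _ /imsetP[x Ax ->] /imsetP[y Ay ->]; rewrite g4 ?A1 // => xy.
by rewrite (A2 x y).
Qed.

Lemma iso_antichain_ex (B : {set fp_T Q}) :
  antichain B -> exists2 A : {set fp_T P}, antichain A & g @: A = B.
Proof.
case: (isog) => g1 g2 g3 g4 /antichainP[B1 B2].
exists [set x | fp_elem x & g x \in B]; last exact: iso_preimset.
apply/antichainP; split=> [x|x y]; rewrite !inE; first by case/andP.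
by case/andP => Px Bx /andP[Py By]; rewrite -g4 // => /B2 E; apply: g2; rewrite // E.
Qed.

Lemma iso_prec_step (A B : {set fp_T P}) : antichain A -> antichain B ->
  prec_step (g @: A) (g @: B) = prec_step A B.
Proof.
case: (isog) => g1 g2 g3 g4 /antichainP[A1 _] /antichainP[B1 _].
have gD (X Y : {set fp_T P}) : (forall x, x \in X -> fp_elem x) ->
    (forall x, x \in Y -> fp_elem x) -> g @: X :\: g @: Y = g @: (X :\: Y).
  move=> X1 Y1; apply/setP => y; rewrite inE; apply/andP/imsetP => [[yY /imsetP[x Xx yx]]|].
    exists x => //; rewrite inE Xx andbT; apply: contra yY => Yx.
    by rewrite yx imset_f.
  by case=> x; rewrite inE => /andP[Yx Xx] ->; rewrite iso_imset_mem ?X1 // imset_f.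
have g1S (X : {set fp_T P}) y : (forall x, x \in X -> fp_elem x) ->
    g @: X = [set y] -> exists2 x, X = [set x] & g x = y.
  move=> X1 Xy; have : #|X| == 1%N.
    rewrite -(card_in_imset (f := g)) ?Xy ?cards1 // => u v /X1 Pu /X1 Pv.
    exact: g2.
  case/cards1P => x Xx; exists x => //; apply/set1P; rewrite -Xy Xx imset_f //.
  by rewrite inE.
apply/prec_stepP/prec_stepP => -[a [b [AB BA ab nab]]].
  have [||a' AB' aa'] := g1S (A :\: B) a; rewrite -?gD //.
    by move=> x; rewrite inE => /andP[_ /A1].
  have [||b' BA' bb'] := g1S (B :\: A) b; rewrite -?gD //.
    by move=> x; rewrite inE => /andP[_ /B1].
  have /setDP[Aa _] : a' \in A :\: B by rewrite AB' inE.
  have /setDP[Bb _] : b' \in B :\: A by rewrite BA' inE.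
  exists a', b'; split=> //; first by rewrite -(g4 _ _ (A1 _ Aa) (B1 _ Bb)) aa' bb'.
  by apply: contra nab => /eqP E; rewrite -aa' -bb' E.
have /setDP[Aa _] : a \in A :\: B by rewrite AB inE.
have /setDP[Bb _] : b \in B :\: A by rewrite BA inE.
exists (g a), (g b); rewrite !gD // AB BA !imset_set1; split=> //.
  by rewrite (g4 _ _ (A1 _ Aa) (B1 _ Bb)).
by apply: contra nab => /eqP/g2-> //; [apply: A1 | apply: B1].
Qed.

(** Allows the matching to be built on a convenient copy of the minuscule poset. *)
Lemma antichain_model_iso n (a : 'I_n -> 'I_n -> int) (p : 'I_n)
    (M : minuscule_model a p) : antichain_model M Q -> antichain_model M P.
Proof.
case: (isog) => g1 g2 g3 g4 [phi [plev pinj psurj pdown pcf]].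
exists (fun A : {set fp_T P} => phi (g @: A)); split.
- move=> A aA; rewrite plev ?iso_antichain //; congr (Posz _).
  case/antichainP: aA => A1 _.
  by apply: card_in_imset => x y /A1 Px /A1 Py; exact: g2.
- move=> A B aA aB /pinj E; have {}E : g @: A = g @: B by apply: E; exact: iso_antichain.
  case/antichainP: aA => A1 _; case/antichainP: aB => B1 _; apply/setP => x.
  apply/idP/idP => xA.
    by rewrite -iso_imset_mem ?A1 // -E imset_f.
  by rewrite -iso_imset_mem ?B1 // E imset_f.
- by move=> x; have [B /iso_antichain_ex[A aA <-] <-] := psurj x; exists A.
- move=> A i aA ip Ai; have [|B' [aB pB BA]] := pdown (g @: A) i _ ip Ai.
    exact: iso_antichain.
  have [B aB' BB'] := iso_antichain_ex aB; exists B; rewrite -BB' in pB BA.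
  by rewrite -iso_prec_step.
move=> A B i aA aB AB ip; apply: pcf; rewrite ?iso_prec_step //; exact: iso_antichain.
Qed.

End Transport.

Lemma Jpow_iso (m : nat) (P Q : finposet) (g : fp_T P -> fp_T Q) :
  poset_iso g -> exists g' : fp_T (Jpow m P) -> fp_T (Jpow m Q), poset_iso g'.
Proof.
elim: m => [|m IH] isog; first by exists g.
by have [g' /Jp_iso isog'] := IH isog; eexists; exact: isog'.
Qed.

(** * Antichains of pairs as families of nested arcs *)

Definition low (m z : nat) : bool := (z < m)%N.

(** In type A, as many elements are removed from the first [m] coordinates as are added outside
    them; in type D, the parity of the number of sign changes is fixed, which selects one half-spin
    module. *)
Definition balanced (N : nat) (split : bool) (m : nat) (U : {set 'I_N}) : bool :=
  if split then \sum_(z in U) (if low m z then 1 else -1 : int) == 0 else ~~ odd #|U|.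

Lemma card_sum (T : finType) (U : {set T}) : #|U|%:Z = \sum_(z in U) 1.
Proof. by rewrite sumr_const -mulr_natr mul1r natz. Qed.

(** A pair is an arc joining two positions; two arcs are incomparable exactly when one lies strictly
    inside the other. *)
Definition pair_poset (N : nat) (split : bool) (m : nat) : finposet :=
  @FinPoset ('I_N * 'I_N)%type
    (fun x => (x.1 < x.2)%N && (split ==> (low m x.1 && ~~ low m x.2)))
    (fun x y => ((x.1 <= y.1) && (x.2 <= y.2))%N).

Section PairAntichains.
Variables (N : nat) (split : bool) (m : nat).
Notation Q := (pair_poset N split m).
Implicit Types (A B : {set fp_T Q}) (x y : 'I_N * 'I_N).

Definition support (A : {set 'I_N * 'I_N}) : {set 'I_N} := [set x.1 | x in A] :|: [set x.2 | x in A].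

Lemma supportP A z : reflect (exists2 x, x \in A & z = x.1 \/ z = x.2) (z \in support A).
Proof.
rewrite inE; apply: (iffP orP) => [[]/imsetP[x xA ->]|[x xA [->|->]]].
- by exists x => //; left.
- by exists x => //; right.
- by left; apply/imsetP; exists x.
- by right; apply/imsetP; exists x.
Qed.

Lemma pair_lt A x : antichain A -> x \in A -> (x.1 < x.2)%N.
Proof. by case/antichainP => A1 _ /A1/andP[]. Qed.

Lemma pair_split A x : antichain A -> split -> x \in A -> low m x.1 /\ ~~ low m x.2.
Proof. by case/antichainP => A1 _ sp /A1/andP[_]; rewrite sp => /andP[]. Qed.

Lemma nested A x y : antichain A -> x \in A -> y \in A -> (x.1 < y.1)%N = (y.2 < x.2)%N.
Proof.
move=> /antichainP[_ A2] Ax Ay; apply/idP/idP => xy; rewrite ltnNge.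
  apply/negP => yx; have E : x = y by apply: A2; rewrite //= (ltnW xy).
  by rewrite E ltnn in xy.
apply/negP => yx; have E : y = x by apply: A2; rewrite //= yx (ltnW xy).
by rewrite E ltnn in xy.
Qed.

Lemma fst_inj A : antichain A -> {in A &, injective (fun x => x.1)}.
Proof.
move=> aA x y Ax Ay xy; case/antichainP: (aA) => _ A2.
case: (leqP x.2 y.2) => xy2; first by apply: A2; rewrite //= xy leqnn.
by apply/esym/A2; rewrite //= xy leqnn ltnW.
Qed.

Lemma snd_inj A : antichain A -> {in A &, injective (fun x => x.2)}.
Proof.
move=> aA x y Ax Ay xy; case/antichainP: (aA) => _ A2.
case: (leqP x.1 y.1) => xy2; first by apply: A2; rewrite //= xy leqnn andbT.
by apply/esym/A2; rewrite //= xy leqnn ltnW.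
Qed.

(** Of two nested arcs the inner one lies within both, so every left end precedes every right
    end. *)
Lemma fst_lt_snd A x y : antichain A -> x \in A -> y \in A -> (x.1 < y.2)%N.
Proof.
move=> aA Ax Ay; have := nested aA Ax Ay; have := nested aA Ay Ax.
have := pair_lt aA Ax; have := pair_lt aA Ay; lia.
Qed.

Lemma sum_support A (F : 'I_N -> int) : antichain A ->
  \sum_(z in support A) F z = \sum_(x in A) (F x.1 + F x.2).
Proof.
move=> aA; rewrite big_split /= -(big_imset F (fst_inj aA)) -(big_imset F (snd_inj aA)).
rewrite -bigU /=; first by apply: eq_bigl => z; rewrite !inE.
rewrite -setI_eq0; apply/eqP/setP => z; rewrite !inE; apply/negP => /andP[].
case/imsetP => x Ax -> /imsetP[y Ay xy].
by have := fst_lt_snd aA Ax Ay; rewrite xy ltnn.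
Qed.

Lemma card_support A : antichain A -> #|support A| = (#|A|.*2)%N.
Proof.
move=> aA; have := sum_support (fun=> 1) aA; rewrite -card_sum sumr_const.
by rewrite -mulr_natr natz; lia.
Qed.

Lemma support_balanced A : antichain A -> balanced split m (support A).
Proof.
move=> aA; rewrite /balanced; case: ifP => sp; last by rewrite card_support ?odd_double.
rewrite sum_support // big1 // => x Ax.
by have [-> /negbTE->] := pair_split aA sp Ax; rewrite addrN.
Qed.

Definition rank_below (U : {set 'I_N}) (z : 'I_N) := #|[set u in U | (u < z)%N]|.
Definition rank_above (U : {set 'I_N}) (z : 'I_N) := #|[set u in U | (z < u)%N]|.

Lemma rank_below_lt (U : {set 'I_N}) (z z' : 'I_N) :
  z \in U -> (z < z')%N -> (rank_below U z < rank_below U z')%N.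
Proof.
move=> zU lt; apply: proper_card; rewrite properE; apply/andP; split.
  by apply/subsetP => u; rewrite !inE => /andP[-> /ltn_trans]; apply.
by apply/subsetPn; exists z; rewrite !inE ?zU // ltnn andbF.
Qed.

Lemma rank_above_lt (U : {set 'I_N}) (z z' : 'I_N) :
  z' \in U -> (z < z')%N -> (rank_above U z' < rank_above U z)%N.
Proof.
move=> zU lt; apply: proper_card; rewrite properE; apply/andP; split.
  by apply/subsetP => u; rewrite !inE => /andP[->]; exact: ltn_trans.
by apply/subsetPn; exists z'; rewrite !inE ?zU // ltnn andbF.
Qed.

(** Both ranks count the arcs that enclose [x]. *)
Lemma support_rank A x : antichain A -> x \in A ->
  rank_below (support A) x.1 = rank_above (support A) x.2.
Proof.
move=> aA Ax; rewrite /rank_below /rank_above; pose A' := [set y in A | (y.1 < x.1)%N].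
have sA' y : y \in A' -> y \in A by rewrite inE => /andP[].
have -> : [set z in support A | (z < x.1)%N] = [set y.1 | y in A'].
  apply/setP => z; rewrite inE; apply/andP/imsetP => [[/supportP[y Ay zy] zx]|].
    case: zy zx => -> zx; first by exists y => //; rewrite inE Ay.
    by have := fst_lt_snd aA Ax Ay; rewrite ltnNge ltnW.
  case=> y; rewrite inE => /andP[Ay yx] ->; split=> //.
  by apply/supportP; exists y => //; left.
have -> : [set z in support A | (x.2 < z)%N] = [set y.2 | y in A'].
  apply/setP => z; rewrite inE; apply/andP/imsetP => [[/supportP[y Ay zy] zx]|].
    case: zy zx => -> zx; last by exists y => //; rewrite inE Ay (nested aA Ay Ax).
    by have := fst_lt_snd aA Ay Ax; rewrite ltnNge ltnW.
  case=> y; rewrite inE => /andP[Ay yx] ->; split; last by rewrite -(nested aA Ay Ax).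
  by apply/supportP; exists y => //; right.
rewrite !card_in_imset // => y z /sA' Ay /sA' Az; [exact: (snd_inj aA)|exact: (fst_inj aA)].
Qed.

(** By [support_rank] an arc joins an end point to the one of equal rank from the other side, so the
    arcs can be read off the support. *)
Lemma support_inj A B : antichain A -> antichain B -> support A = support B -> A = B.
Proof.
suff sub A' B' : antichain A' -> antichain B' -> support A' = support B' -> A' \subset B'.
  by move=> aA aB AB; apply/eqP; rewrite eqEsubset !sub.
move=> aA aB AB; apply/subsetP => x Ax; set U := support B'.
have memU y : y \in B' -> y.1 \in U /\ y.2 \in U.
  by move=> By; split; apply/supportP; exists y; auto.
have x1 : x.1 \in U by rewrite /U -AB; apply/supportP; exists x => //; left.
have x2 : x.2 \in U by rewrite /U -AB; apply/supportP; exists x => //; right.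
have rA := support_rank aA Ax; rewrite AB -/U in rA.
have ltx := pair_lt aA Ax.
have /supportP[y By xy] := x1; have rB := support_rank aB By; rewrite -/U in rB.
have lty := pair_lt aB By; have [y1 y2] := memU y By.
(* If [x.1] were the right end of [y], the ranks of the four end points would form a strict
   cycle. *)
case: xy => xy; last first.
  have := rank_below_lt y1 lty; have := rank_above_lt x2 ltx.
  by rewrite rB -rA xy => /ltn_trans lt /lt; rewrite ltnn.
have ge (u v : 'I_N) : v \in U -> rank_above U u = rank_above U v -> (v <= u)%N.
  move=> vU uv; rewrite leqNgt; apply/negP => lt.
  by have := rank_above_lt vU lt; rewrite uv ltnn.
suff -> : x = y by [].
have xy2 : x.2 = y.2.
  by apply/val_inj/eqP; rewrite eqn_leq !ge //= -rA -rB xy.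
by rewrite [x]surjective_pairing [y]surjective_pairing xy xy2.
Qed.

End PairAntichains.

(** * The model of type A and of the half-spin modules *)

(* A weight is encoded by a subset [U] of the coordinates, namely those whose sign is
   changed with respect to [omega_p]: in type D the weight is [1/2 (sum +-eps_z)] and [U]
   is the set of minus signs; in type A with [split_at = p] the exterior power basis vector
   [T] is encoded by [U], the symmetric difference of [T] and the first [p] coordinates,
   the later ones being read backwards. The node [p] toggles the two elements
   [pos p < pos' p], every other node [i] exchanges the consecutive elements [pos i] and
   [pos' i]. *)
Section PairModel.
Variables (n : nat) (a : 'I_n -> 'I_n -> int) (p : 'I_n) (N : nat).
Variables (pos pos' : 'I_n -> 'I_N) (split : bool) (m : nat).

Definition pos_sign (i : 'I_n) : int := if i == p then 1 else -1.

(** The simple root of node [i] in coordinates whose signs are chosen so that [U] counts negatively: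
    a difference of two coordinates, but a sum at [p]. *)
Definition root (i : 'I_n) (z : 'I_N) : int :=
  (z == pos i)%:Z + pos_sign i * (z == pos' i)%:Z.

Hypothesis lt_pos : forall i, (pos i < pos' i)%N.
Hypothesis pos'S : forall i, i != p -> pos' i = (pos i).+1 :> nat.
Hypothesis low_pos : forall i, split -> i != p -> low m (pos i) = low m (pos' i).
Hypothesis pos_p_split : split -> (pos p).+1 = m.
Hypothesis pos_p_nsplit : ~~ split -> (pos p).+2 = N.
Hypothesis pos'_p : (pos' p).+1 = N.
Hypothesis root_cartan : forall i j, a j i = root j (pos i) + pos_sign i * root j (pos' i).
Hypothesis pos_onto : forall z : 'I_N, (z.+1 < N)%N -> split ==> (z.+1 != m) ->
  exists2 i, i != p & pos i = z.
Hypothesis pos_inj : forall i j, i != p -> j != p -> pos i = pos j -> i = j.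

Implicit Types (U : {set 'I_N}) (F : 'I_N -> int).

Definition pair_wt U i : int := (i == p)%:Z - \sum_(z in U) root i z.

Definition pair_refl i U : {set 'I_N} :=
  [set z | if z == pos i then (pos' i \in U) (+) (i == p)
           else if z == pos' i then (pos i \in U) (+) (i == p) else z \in U].

Definition below (i : 'I_n) (z : 'I_N) : int :=
  ((split ==> (low m z == low m (pos i))) && (z <= pos i)%N)%:Z.

(** The coefficients that express the indicator of [U] through the vectors [root i]. In type D a
    second node shares the position of [p]; the two coefficients add up to the number of elements of
    [U] up to [pos p], and the one at [p] is half of [#|U|], whence the correction. *)
Definition pair_cf U i : int :=
  if i == p then (#|U|./2)%:Z else
  \sum_(z in U) below i z - (~~ split && (pos i == pos p))%:Z * (#|U|./2)%:Z.

Lemma pos_neq i : (pos' i == pos i) = false.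
Proof. by rewrite -val_eqE; have := lt_pos i; case: ltngtP. Qed.

Lemma sum_mem U F : \sum_(z in U) F z = \sum_z (z \in U)%:Z * F z.
Proof.
rewrite big_mkcond /=; apply: eq_bigr => z _.
by case: (z \in U); rewrite ?mul1r ?mul0r.
Qed.

Lemma sum_delta F x : \sum_z (z == x)%:Z * F z = F x.
Proof.
rewrite (bigD1 x) //= eqxx mul1r big1 ?addr0 // => z /negbTE->.
by rewrite mul0r.
Qed.

Lemma pair_wtE U i :
  pair_wt U i = (i == p)%:Z - (pos i \in U)%:Z - pos_sign i * (pos' i \in U)%:Z.
Proof.
rewrite /pair_wt sum_mem /root; under eq_bigr => z _ do rewrite mulrDr mulrCA.
rewrite big_split /= -mulr_sumr.
under eq_bigr => z _ do rewrite mulrC.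
rewrite sum_delta; under eq_bigr => z _ do rewrite mulrC.
by rewrite sum_delta opprD addrA.
Qed.

Lemma mem_pair_refl U i z :
  (z \in pair_refl i U)%:Z = (z \in U)%:Z + pair_wt U i * root i z.
Proof.
rewrite inE pair_wtE /root /pos_sign; have [->|zx] := eqVneq z (pos i).
  rewrite [pos i == _]eq_sym pos_neq.
  by case: (_ \in _); case: (_ \in _); case: (i == p).
have [->|zy] := eqVneq z (pos' i); last by rewrite !(mulr0, addr0).
by case: (_ \in _); case: (_ \in _); case: (i == p).
Qed.

Lemma sum_pair_refl U i F : \sum_(z in pair_refl i U) F z =
  \sum_(z in U) F z + pair_wt U i * (F (pos i) + pos_sign i * F (pos' i)).
Proof.
rewrite !sum_mem; under eq_bigr => z _ do rewrite mem_pair_refl mulrDl.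
rewrite big_split /=; congr (_ + _).
under eq_bigr => z _ do rewrite -mulrA.
rewrite -mulr_sumr; congr (_ * _).
rewrite /root; under eq_bigr => z _ do rewrite mulrDl -mulrA.
by rewrite big_split /= -mulr_sumr !sum_delta.
Qed.

Lemma card_pair_refl U i :
  #|pair_refl i U|%:Z = #|U|%:Z + pair_wt U i * (i == p)%:Z *+ 2.
Proof. by rewrite !card_sum sum_pair_refl /pos_sign; case: (i == p) => /=; ring. Qed.

Lemma pair_wt_refl U i j :
  pair_wt (pair_refl i U) j = pair_wt U j - a j i * pair_wt U i.
Proof. rewrite /pair_wt sum_pair_refl root_cartan -/(pair_wt U i); ring. Qed.

Lemma pair_wt_range U i : -1 <= pair_wt U i <= 1.
Proof.
rewrite pair_wtE /pos_sign.
by case: (_ \in _); case: (_ \in _); case: (i == p).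
Qed.

Lemma pair_reflK i : involutive (pair_refl i).
Proof.
move=> U; apply/setP => z; rewrite !inE !eqxx pos_neq -!addbA addbb !addbF.
by case: eqVneq => [->|_] //; case: eqVneq => [->|_].
Qed.

Lemma balanced_refl i U : balanced split m U -> balanced split m (pair_refl i U).
Proof.
rewrite /balanced; case: ifP => [sp /eqP U0|sp oU].
  rewrite sum_pair_refl U0 add0r mulf_eq0; apply/orP; right; rewrite /pos_sign.
  have [->|ip] := eqVneq i p; last by rewrite low_pos //; case: (low m _).
  by rewrite /low -(pos_p_split sp) ltnSn ltnS leqNgt lt_pos.
have := card_pair_refl U i; move: oU.
move: (pair_wt U i * _) => c; lia.
Qed.

Lemma balanced0 : balanced split m (set0 : {set 'I_N}).
Proof. by rewrite /balanced big_set0 cards0 eqxx; case: split. Qed.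

Lemma sum_low U : \sum_(z in U) (if low m z then 1 else -1 : int) =
  #|[set z in U | low m z]|%:Z - #|[set z in U | ~~ low m z]|%:Z.
Proof.
rewrite !card_sum -sumrN !sum_mem -big_split /=; apply: eq_bigr => z _.
by rewrite !inE; case: (z \in U); case: (low m z).
Qed.

Lemma card_low U : (#|[set z in U | low m z]| + #|[set z in U | ~~ low m z]|)%N = #|U|.
Proof.
rewrite -(cardsID [set z : 'I_N | low m z] U); congr (_ + _)%N; apply: eq_card => z.
  by rewrite !inE.
by rewrite !inE andbC.
Qed.

Lemma balanced_card U : balanced split m U -> (#|U|./2).*2 = #|U|.
Proof.
rewrite /balanced; case: ifP => _; last by lia.
by rewrite sum_low -(card_low U); lia.
Qed.

Lemma balanced_low U : split -> balanced split m U ->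
  #|[set z in U | low m z]| = #|U|./2 /\ #|[set z in U | ~~ low m z]| = #|U|./2.
Proof.
by rewrite /balanced => ->; rewrite sum_low -(card_low U); lia.
Qed.

Lemma pair_cf_refl U i j : balanced split m U ->
  pair_cf (pair_refl i U) j = pair_cf U j + (i == j)%:Z * pair_wt U i.
Proof.
move=> bU; have bU' := balanced_refl i bU.
have := balanced_card bU; have := balanced_card bU'; have := card_pair_refl U i.
rewrite /pair_cf; have [->|jp] := eqVneq j p.
  by case: (i == p) => /=; lia.
rewrite sum_pair_refl => cU cU2 cU1.
set B := \sum_(z in U) _.
(* Up to the type D correction, the functions [below j] are dual to the simple roots. *)
have key : below j (pos i) + pos_sign i * below j (pos' i) =
    (i == j)%:Z + (~~ split && (pos j == pos p))%:Z * (i == p)%:Z.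
  rewrite /below /pos_sign.
  have := low_pos (i := i); have := low_pos (i := j); have := lt_pos i; have := lt_pos j.
  rewrite jp => jj ii lj; have [ip|ip] := eqVneq i p.
    subst i => _; rewrite [p == j]eq_sym (negbTE jp) /= -val_eqE /=.
    have := pos'S jp; have := pos_p_split; have := pos_p_nsplit; have := pos'_p.
    have := ltn_ord (pos' j); move: lj; rewrite /low; case: split => /=.
      move=> /(_ isT isT) ? ? ? _ /(_ isT) ?.
      by lia.
    by move=> _ ? ? /(_ isT) ? _; lia.
  have [ij|ij] := eqVneq i j.
    subst i => _; have := pos'S jp; move: lj; case: split => /=; rewrite ?eqxx /=.
      by lia.
    by lia.
  have nij : (pos i == pos j :> nat) = false.
    by apply/negbTE; apply: contra ij => /eqP/val_inj/pos_inj-> //.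
  have pi := pos'S ip; move: lj nij; rewrite /low; case: split => /=.
    by move=> /(_ isT isT) ? ? /(_ isT isT) ?; lia.
  by move=> _ ? _; lia.
rewrite key; have -> : (#|pair_refl i U|./2)%:Z = (#|U|./2)%:Z + pair_wt U i * (i == p)%:Z.
  by move: (pair_wt U i * _) cU => c; lia.
ring.
Qed.

Definition pair_carrier := {U : {set 'I_N} | balanced split m U}.

Definition pair_act i (U : pair_carrier) : pair_carrier :=
  exist _ (pair_refl i (sval U)) (balanced_refl i (svalP U)).

Definition pair_top : pair_carrier := exist _ set0 balanced0.

Definition up_closed U : Prop := forall z z' : 'I_N,
  z \in U -> (z <= z')%N -> split ==> (low m z == low m z') -> z' \in U.

(** A node [i != p] has weight -1 exactly when [pos i] is in [U] and [pos' i] is not, so dominance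
    pushes membership on to the next position of the block. *)
Lemma levi_dominant_up_closed U : (forall i, i != p -> pair_wt U i != -1) -> up_closed U.
Proof.
move=> dom z z'; have [k] := ubnP (z' - z)%N; elim: k z => // k IH z lek zU zz' lowz.
have [E|/eqP E] := eqVneq z z'; first by rewrite -E.
have lt : (z < z')%N by rewrite ltn_neqAle zz' andbT; apply/eqP => /val_inj.
have zN : (z.+1 < N)%N := leq_ltn_trans lt (ltn_ord z').
have [|i ip iz] := pos_onto zN; first by move: lowz; rewrite /low; case: split => /=; lia.
have := dom i ip; rewrite pair_wtE iz zU /pos_sign (negbTE ip).
case: (boolP (pos' i \in U)) => // iU _.
have i1 := pos'S ip; rewrite iz in i1.
apply: (IH (pos' i)) => //; rewrite ?i1; [lia | lia |].
by move: lowz; rewrite -iz; case: (boolP split) => //= sp /eqP<-; rewrite -(pos'S ip) (low_pos sp ip).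
Qed.

(** Within one block the up-closed sets form a chain, so the cardinality determines them. *)
Lemma up_closed_eq (B : pred nat) U V : (forall z z', B z -> B z' -> split ==> (low m z == low m z')) ->
    up_closed U -> up_closed V -> #|[set z in U | B z]| = #|[set z in V | B z]| ->
  forall z : 'I_N, B z -> (z \in U) = (z \in V).
Proof.
move=> Blow upU upV cUV.
suff {U V upU upV cUV} sub U V : up_closed U -> up_closed V ->
    #|[set z in U | B z]| = #|[set z in V | B z]| ->
    forall z : 'I_N, B z -> z \in U -> z \in V.
  by move=> z Bz; apply/idP/idP; apply: sub.
move=> upU upV cUV z Bz zU; apply: contraPT cUV => zV; apply/eqP.
rewrite neq_ltn; apply/orP; right; apply: proper_card; rewrite properE.
apply/andP; split.
  apply/subsetP => y; rewrite !inE => /andP[yV By]; rewrite By andbT.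
  apply: (upU z) => //; last exact: Blow.
  rewrite leqNgt; apply: contra zV => yz; apply: (upV y) => //; first exact: ltnW.
  exact: Blow.
by apply/subsetPn; exists z; rewrite !inE ?zU ?Bz // (negbTE zV).
Qed.

Lemma pair_level_uniq U V : balanced split m U -> balanced split m V -> pair_cf U p = pair_cf V p ->
    (forall i, i != p -> pair_wt U i != -1) -> (forall i, i != p -> pair_wt V i != -1) ->
  U = V.
Proof.
move=> bU bV; rewrite /pair_cf eqxx => -[cUV].
move=> /levi_dominant_up_closed upU /levi_dominant_up_closed upV.
apply/setP => z; case: (boolP split) => sp.
  have [lU hU] := balanced_low sp bU; have [lV hV] := balanced_low sp bV.
  have [lz|hz] := boolP (low m z).
    apply: (@up_closed_eq (low m)) => //; last by rewrite lU lV.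
    by move=> x y -> ->; rewrite implybT.
  apply: (@up_closed_eq (fun z => ~~ low m z)) => //; last by rewrite hU hV.
  by move=> x y /negbTE-> /negbTE->; rewrite implybT.
have E U' : [set z in U' | predT (z : nat)] = U' by apply/setP => y; rewrite inE andbT.
apply: (@up_closed_eq predT) => //; first by rewrite (negbTE sp).
by rewrite !E -(balanced_card bU) -(balanced_card bV) cUV.
Qed.

(** A nonempty balanced up-closed set contains [pos p] and [pos' p], which end the two blocks or are
    the last two positions; the weight at [p] is then -1. *)
Lemma pair_dominant U : balanced split m U -> (forall i, pair_wt U i != -1) -> U = set0.
Proof.
move=> bU dom; have up := levi_dominant_up_closed (fun i _ => dom i).
apply/eqP; apply: contraT => U0; case/negP: (dom p).
have cU := balanced_card bU; have U1 : (0 < #|U|)%N by rewrite card_gt0.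
suff [pU p'U] : pos p \in U /\ pos' p \in U by rewrite pair_wtE /pos_sign eqxx pU p'U.
case: (boolP split) => sp.
  have [lU hU] := balanced_low sp bU; split.
    have : (0 < #|[set z in U | low m z]|)%N by lia.
    case/card_gt0P => z; rewrite inE /low -(pos_p_split sp) ltnS => /andP[zU zp].
    by apply: (up z) => //; rewrite sp /low -(pos_p_split sp) !ltnS zp leqnn.
  have : (0 < #|[set z in U | ~~ low m z]|)%N by lia.
  case/card_gt0P => z; rewrite inE => /andP[zU zl]; apply: (up z) => //.
    by rewrite -ltnS pos'_p.
  rewrite sp (negbTE zl) /low -(pos_p_split sp) ltnS leqNgt.
  by rewrite lt_pos.
have [z zU] : exists z, z \in U by apply/set0Pn.
have pU : pos' p \in U.
  by apply: (up z) => //; rewrite ?(negbTE sp) // -ltnS pos'_p.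
split=> //; have : (0 < #|U :\ pos' p|)%N.
  by rewrite lt0n; apply/eqP => D0; move: cU; rewrite (cardsD1 (pos' p)) pU D0.
case/card_gt0P => y; rewrite !inE => /andP[yp yU]; apply: (up y) => //.
  by have := pos_p_nsplit sp; have := pos'_p; have := ltn_ord y; move: yp;
    rewrite -val_eqE /=; lia.
by rewrite (negbTE sp).
Qed.

Definition pair_model : minuscule_model a p.
Proof.
refine (@MinusculeModel n a p pair_carrier (fun U : pair_carrier => pair_wt (sval U))
  (fun U : pair_carrier => pair_cf (sval U)) pair_act pair_top _ _ _ _ _ _ _ _).
- by move=> U i; exact: pair_wt_range.
- by move=> U i j; exact: pair_wt_refl.
- by move=> U i j; apply: pair_cf_refl; exact: valP.
- by move=> i U; apply: val_inj; exact: pair_reflK.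
- by move=> i; rewrite /pair_wt big_set0 subr0.
- by move=> i; rewrite /pair_cf big_set0 cards0 mulr0; case: ifP.
- by move=> U dom; apply: val_inj; apply: pair_dominant; rewrite ?(valP U).
- by move=> U V cUV dU dV; apply: val_inj; apply: pair_level_uniq; rewrite ?(valP _).
Defined.


Lemma pair_cf_support (A : {set fp_T (pair_poset N split m)}) i : antichain A -> pair_cf (support A) i =
  if i == p then #|A|%:Z else
  \sum_(x in A) (below i x.1 + below i x.2) -
    (~~ split && (pos i == pos p))%:Z * #|A|%:Z.
Proof. by move=> aA; rewrite /pair_cf card_support // doubleK sum_support. Qed.

(* In the split case only one coordinate of the pair counts for [below i]. *)
Lemma below_antimono i (x y : 'I_N * 'I_N) : i != p ->
    (x : fp_T (pair_poset N split m)) \in @fp_elem _ ->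
    (y : fp_T (pair_poset N split m)) \in @fp_elem _ ->
    (x.1 <= y.1)%N -> (x.2 <= y.2)%N ->
  below i y.1 + below i y.2 <= below i x.1 + below i x.2.
Proof.
move=> ip /andP[_ xs] /andP[_ ys] x1 x2; move: xs ys; rewrite /below.
case: split => /= [/andP[-> /negbTE->] /andP[-> /negbTE->]|_ _]; last by lia.
by case: (low m (pos i)) => /=; lia.
Qed.

Section Down.
Variables (A : {set fp_T (pair_poset N split m)}) (i : 'I_n).
Hypothesis aA : antichain A.
Hypothesis ip : i != p.
Hypothesis upU : pos' i \in support A.
Hypothesis downU : pos i \notin support A.

Let sg (z : 'I_N) := if z == pos' i then pos i else z.
Let sg2 (x : 'I_N * 'I_N) : fp_T (pair_poset N split m) := (sg x.1, sg x.2).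

Let suppA x : x \in A -> x.1 \in support A /\ x.2 \in support A.
Proof. by move=> Ax; split; apply/supportP; exists x; auto. Qed.

Let sg_le u v : u \in support A -> v \in support A -> (sg u <= sg v)%N = (u <= v)%N.
Proof.
rewrite /sg => uA vA; have i1 := pos'S ip.
have nz z : z \in support A -> (z == pos i :> nat) = false.
  by move=> zA; apply/negbTE; apply: contra downU => /eqP/val_inj <-.
have ny z : z != pos' i -> (z == pos' i :> nat) = false by move/negbTE; rewrite -val_eqE.
have := nz u uA; have := nz v vA.
by case: (eqVneq u (pos' i)) => [->|/ny uy]; case: (eqVneq v (pos' i)) => [->|/ny vy]; rewrite ?leqnn //; lia.
Qed.

Let sg_lt u v : u \in support A -> v \in support A -> (sg u < sg v)%N = (u < v)%N.
Proof. by move=> uA vA; rewrite !ltnNge sg_le. Qed.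

Let sg_low z : split -> low m (sg z) = low m z.
Proof. by move=> sp; rewrite /sg; case: eqP => // ->; exact: low_pos. Qed.

(** The end point at [pos' i] slides to the free neighbouring position [pos i]. The relative order
    of the end points, hence the nesting, is unchanged, and the one arc that moves becomes
    smaller. *)
Lemma pair_down : exists B : {set fp_T (pair_poset N split m)}, [/\ antichain B, support B = pair_refl i (support A)
  & prec_step B A].
Proof.
have sgpos z : sg z != pos' i.
  by rewrite /sg; case: (eqVneq z (pos' i)) => // _; rewrite eq_sym pos_neq.
have aB : antichain (sg2 @: A).
  apply/antichainP; split=> [_ /imsetP[x Ax ->]|_ _ /imsetP[x Ax ->] /imsetP[y Ay ->]] /=.
    have [x1 x2] := suppA Ax; rewrite sg_lt // (pair_lt aA Ax) /=.
    by apply/implyP => sp; rewrite !sg_low //; have [-> ->] := pair_split aA sp Ax.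
  have [x1 x2] := suppA Ax; have [y1 y2] := suppA Ay.
  rewrite !sg_le // => xy; case/antichainP: aA => _ A2.
  by rewrite (A2 x y).
exists (sg2 @: A); split=> //.
  apply/setP => z.
  have -> : (z \in pair_refl i (support A)) =
      (z == pos i) || (z != pos' i) && (z \in support A).
    rewrite [LHS]inE (negbTE ip) !addbF upU (negbTE downU).
    by case: (z == pos i); case: (z == pos' i).
  apply/supportP/idP => [[_ /imsetP[x Ax ->]] /=|].
    have [x1 x2] := suppA Ax; rewrite /sg.
    by case=> ->; case: (eqVneq _ (pos' i)) => [_|->]; rewrite ?eqxx // ?x1 ?x2 orbT.
  have [->|zi /= /andP[zi']] := eqVneq z (pos i).
    move=> _; have /supportP[x Ax xi] := upU; exists (sg2 x); first exact: imset_f.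
    by rewrite /sg2 /sg /=; case: xi => <-; rewrite eqxx; auto.
  case/supportP => x Ax xz; exists (sg2 x); first exact: imset_f.
  by rewrite /sg2 /sg /=; case: xz => <-; rewrite (negbTE zi'); auto.
have /supportP[x0 Ax0 xi0] := upU.
have sgA x : x \in A -> x != x0 -> sg2 x = x.
  move=> Ax nx; rewrite /sg2 /sg; case: eqVneq => [x1|x1].
    case: xi0 => xi; first by case/eqP: nx; apply: (fst_inj aA) => //; rewrite x1.
    by have := fst_lt_snd aA Ax Ax0; rewrite x1 -xi ltnn.
  case: eqVneq => [x2|x2]; last by rewrite -surjective_pairing.
  case: xi0 => xi; last by case/eqP: nx; apply: (snd_inj aA) => //; rewrite x2.
  by have := fst_lt_snd aA Ax0 Ax; rewrite x2 -xi ltnn.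
have sgx0 : sg2 x0 \notin A.
  apply: contra downU => /suppA[s1 s2]; move: s1 s2; rewrite /sg2 /sg /=.
  by case: xi0 => <-; rewrite eqxx.
have x0B : x0 \notin sg2 @: A.
  apply/imsetP => -[x _ xE]; case: xi0 => xi; have := sgpos x.1; have := sgpos x.2;
    by rewrite xi xE /= ?eqxx.
apply/prec_stepP; exists (sg2 x0), x0; split.
- apply/setP => y; rewrite !inE; apply/andP/eqP => [[yA /imsetP[x Ax yx]]|->].
    have [xx|nx] := eqVneq x x0; first by rewrite yx xx.
    by move: yA; rewrite yx sgA // Ax.
  by split=> //; exact: imset_f.
- apply/setP => y; rewrite !inE; apply/andP/eqP => [[yB Ay]|->//].
  apply/eqP; apply: contraR yB => ny; rewrite -(sgA y) //; exact: imset_f.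
- rewrite /= /sg; have := lt_pos i.
  by case: eqP => [->|_]; case: eqP => [->|_]; rewrite ?leqnn // => /ltnW->; rewrite ?andbT.
by apply: contra sgx0 => /eqP->.
Qed.

End Down.

Lemma rank_below_above U z : z \in U ->
  (rank_below U z + rank_above U z).+1 = #|U|.
Proof.
move=> zU; rewrite (cardsD1 z U) zU add1n; congr _.+1.
rewrite -(cardsID [set u : 'I_N | (u < z)%N] (U :\ z)); congr (_ + _)%N;
  apply: eq_card => u; rewrite !inE -val_eqE /=; case: (u \in U); rewrite ?andbF ?andbT //=;
  by case: ltngtP.
Qed.

Lemma rank_above_onto U r : (r < #|U|)%N -> exists2 z, z \in U & rank_above U z = r.
Proof.
move=> rU; have lt z : z \in U -> (rank_above U z < #|U|)%N.
  by move=> zU; rewrite -(rank_below_above zU) ltnS leq_addl.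
pose R z : 'I_#|U|.-1.+1 := inord (rank_above U z).
have Rinj : {in U &, injective R}.
  move=> x y xU yU /(congr1 val); rewrite /= !inordK ?(ltn_predK rU) ?lt // => xy.
  apply/val_inj/eqP; rewrite eqn_leq; apply/andP; split; rewrite leqNgt; apply/negP => xy'.
    by have := rank_above_lt xU xy'; rewrite xy ltnn.
  by have := rank_above_lt yU xy'; rewrite xy ltnn.
have : R @: U = setT.
  apply/eqP; rewrite eqEcard subsetT card_in_imset // cardsT card_ord.
  by rewrite /= (ltn_predK rU).
move/setP/(_ (inord r)); rewrite inE => /imsetP[z zU /(congr1 val)].
rewrite /= !inordK ?(ltn_predK rU) ?lt // => rz.
by exists z.
Qed.

(** Join each element to the one of equal rank from the other side. *)
Lemma support_onto U : balanced split m U ->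
  exists2 A : {set fp_T (pair_poset N split m)}, antichain A & support A = U.
Proof.
move=> bU; have cU := balanced_card bU.
pose A : {set fp_T (pair_poset N split m)} := [set x : 'I_N * 'I_N |
  [&& x.1 \in U, x.2 \in U, (x.1 < x.2)%N & rank_below U x.1 == rank_above U x.2]].
have memA x : x \in A -> [/\ x.1 \in U, x.2 \in U, (x.1 < x.2)%N &
    rank_below U x.1 = rank_above U x.2].
  by rewrite inE => /and4P[? ? ? /eqP ?].
(* The low elements of a balanced set are its smaller half, so every arc starts low and ends
   high. *)
have lowU : split -> forall z, z \in U -> low m z = (rank_below U z < #|U|./2)%N.
  move=> sp z zU; have [lU hU] := balanced_low sp bU; have rU := rank_below_above zU.
  have [lz|hz] := boolP (low m z).
    apply/esym; rewrite -lU; apply: proper_card; rewrite properE; apply/andP; split.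
      by apply/subsetP => u; rewrite !inE => /andP[-> /ltn_trans]; apply.
    by apply/subsetPn; exists z; rewrite !inE ?zU // ltnn andbF.
  apply/esym/negbTE; rewrite -leqNgt -lU; apply: subset_leq_card.
  apply/subsetP => u; rewrite !inE => /andP[-> /=] /leq_trans; apply.
  by move: hz; rewrite -leqNgt.
exists A.
  apply/antichainP; split.
    move=> x /memA[x1 x2 lt r]; apply/andP; split=> //; apply/implyP => sp.
    rewrite !lowU // r; have := rank_below_above x1; have := rank_below_above x2.
    have := rank_below_lt x1 lt; rewrite r; lia.
  move=> x y /memA[x1 x2 _ rx] /memA[y1 y2 _ ry] /andP[/= le1 le2].
  have E1 : x.1 = y.1 :> nat.
    apply/eqP; rewrite eqn_leq le1 leqNgt; apply/negP => lt.
    have := rank_below_lt x1 lt; rewrite rx ry ltnNge => /negP; apply.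
    move: le2; rewrite leq_eqVlt => /orP[/eqP/val_inj->//|lt2].
    by apply: ltnW; exact: rank_above_lt.
  have E2 : x.2 = y.2 :> nat.
    apply/eqP; rewrite eqn_leq le2 leqNgt; apply/negP => lt.
    by have := rank_above_lt y2 lt; rewrite -rx -ry (val_inj E1) ltnn.
  by rewrite [x]surjective_pairing [y]surjective_pairing (val_inj E1) (val_inj E2).
apply/setP => z; apply/supportP/idP => [[x /memA[x1 x2 _ _] [->|->]] //|zU].
have rz := rank_below_above zU.
have [|y yU ry] := @rank_above_onto U (rank_below U z).
  by rewrite -rz ltnS leq_addr.
have ry' := rank_below_above yU.
have [lt|lt|E] := ltngtP z y.
- by exists (z, y); [rewrite inE /= zU yU lt ry eqxx | left].
- by exists (y, z); [rewrite inE /= zU yU lt /=; apply/eqP; lia | right].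
have {}E : z = y by exact: val_inj.
(* An element joined to itself would make [#|U|] odd. *)
by subst y; lia.
Qed.

Theorem pair_antichain_model : antichain_model pair_model (pair_poset N split m).
Proof.
pose phi (A : {set fp_T (pair_poset N split m)}) : pair_model :=
  insubd pair_top (support A).
have phiE A : antichain A -> sval (phi A) = support A.
  by move=> aA; rewrite /phi val_insubd support_balanced.
exists phi; split.
- by move=> A aA; rewrite /cf /= phiE // pair_cf_support // eqxx.
- by move=> A B aA aB /(congr1 sval); rewrite !phiE //; exact: support_inj.
- move=> x; have [A aA Ax] := support_onto (svalP x); exists A => //.
  by apply: val_inj; rewrite /= phiE.
- move=> A i aA ip; rewrite /wt /= phiE // pair_wtE (negbTE ip) /pos_sign (negbTE ip).
  move=> Ai; have [pU p'U] : pos i \notin support A /\ pos' i \in support A.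
    by move: Ai; case: (pos i \in _); case: (pos' i \in _).
  have [B [aB sB BA]] := pair_down aA ip p'U pU.
  by exists B; split=> //; apply: val_inj; rewrite /= !phiE // sB.
move=> A B i aA aB /prec_stepP[x [y [AB BA xy nxy]]] ip.
rewrite /cf /= !phiE // !pair_cf_support // (negbTE ip).
have Ax : x \in A :\: B by rewrite AB inE.
have By : y \in B :\: A by rewrite BA inE.
have EA : A = x |: (A :&: B) by rewrite -AB setUC setID.
have EB : B = y |: (A :&: B) by rewrite -BA [A :&: B]setIC setUC setID.
have xI : x \notin A :&: B by move: Ax; rewrite !inE => /andP[/negbTE-> _]; rewrite andbF.
have yI : y \notin A :&: B by move: By; rewrite !inE => /andP[/negbTE-> _].
have -> : #|B| = #|A| by rewrite [in LHS]EB [in RHS]EA !cardsU1 xI yI.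
rewrite lerD2r [in X in X <= _]EB [in X in _ <= X]EA !big_setU1 //= lerD2r.
case/antichainP: aA => A1 _; case/antichainP: aB => B1 _.
case/andP: xy => xy1 xy2; apply: below_antimono => //.
- by apply: A1; case/setDP: Ax.
- by apply: B1; case/setDP: By.
Qed.

End PairModel.

(** * The model of the vector representation of type D *)

(* The weights of the vector representation of type D_n, [n = k + 2], are numbered
   [eps_0, .., eps_(n-1), - eps_(n-1), .., - eps_0]. *)
Section VectorModel.
Variable k : nat.
Notation n := k.+2.
Notation X := 'I_(k.*2.+4).

(** The weight numbered [2k + 3 - z] is [- eps_z]. *)
Definition coord (x z : nat) : int := (x == z)%:Z - (x + z == k.*2.+3)%:Z.

Definition vec_root (i z : nat) : int :=
  if (i <= k)%N then (z == i)%:Z - (z == i.+1)%:Z else (z == k)%:Z + (z == k.+1)%:Z.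

Definition vec_wt (x i : nat) : int :=
  if (i <= k)%N then coord x i - coord x i.+1 else coord x k + coord x k.+1.

(** The middle weights, numbered [k + 1] and [k + 2], are reached through different ends of the
    fork, so they contribute to different ones of the last two coordinates. *)
Definition vec_cf (x i : nat) : int :=
  if (i < k)%N then (i < x)%:Z + (k.*2.+2 < x + i)%:Z
  else if i == k then (x == k.+1)%:Z + (k.+2 < x)%:Z else (k.+2 <= x)%:Z.

Definition vec_refl (i x : nat) : nat :=
  if (i <= k)%N then
    if x == i then i.+1 else if x == i.+1 then i else
    if (x + i == k.*2.+2)%N then x.+1 else if (x + i == k.*2.+3)%N then x.-1 else x
  else
    if (x == k) || (x == k.+1) then x.+2 else
    if (x == k.+2) || (x == k.+3) then x.-2 else x.

Lemma vec_refl_lt i x : (x < k.*2.+4)%N -> (vec_refl i x < k.*2.+4)%N.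
Proof. by rewrite /vec_refl; repeat case: ifP => ?; lia. Qed.

Lemma vec_reflK i x : (x < k.*2.+4)%N -> vec_refl i (vec_refl i x) = x.
Proof.
move=> nx; rewrite {2}/vec_refl; repeat case: ifP => ?; rewrite /vec_refl;
  repeat case: ifP => ?; lia.
Qed.

Variant vec_spec (i x : nat) : nat -> int -> Prop :=
| VecUp1 of (i <= k)%N & x = i : vec_spec i x i.+1 1
| VecDown1 of (i <= k)%N & x = i.+1 : vec_spec i x i (-1)
| VecUp2 of (i <= k)%N & (x + i = k.*2.+2)%N : vec_spec i x x.+1 1
| VecDown2 of (i <= k)%N & (x + i = k.*2.+3)%N : vec_spec i x x.-1 (-1)
| VecUp3 of (k < i)%N & (k <= x <= k.+1)%N : vec_spec i x x.+2 1
| VecDown3 of (k < i)%N & (k.+2 <= x <= k.+3)%N : vec_spec i x x.-2 (-1)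
| VecFix1 of (i <= k)%N & x != i & x != i.+1 & (x + i != k.*2.+2)%N
    & (x + i != k.*2.+3)%N : vec_spec i x x 0
| VecFix2 of (k < i)%N & (x < k)%N || (k.+3 < x)%N : vec_spec i x x 0.

Lemma vecP i x : vec_spec i x (vec_refl i x) (vec_wt x i).
Proof.
rewrite /vec_refl /vec_wt /coord; case: leqP => ik.
  case: eqVneq => [->|x1].
    rewrite (_ : _ - _ = 1 :> int); [exact: VecUp1 | lia].
  case: eqVneq => [->|x2].
    rewrite (_ : _ - _ = -1 :> int); [exact: VecDown1 | lia].
  case: eqVneq => [x3|x3].
    rewrite (_ : _ - _ = 1 :> int); [exact: VecUp2 | lia].
  case: eqVneq => [x4|x4].
    rewrite (_ : _ - _ = -1 :> int); [exact: VecDown2 | lia].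
  rewrite (_ : _ - _ = 0 :> int); [exact: VecFix1 | lia].
case: ifP => [x1|x1].
  rewrite (_ : _ + _ = 1 :> int); [apply: VecUp3 => //; lia | lia].
case: ifP => [x2|x2].
  rewrite (_ : _ + _ = -1 :> int); [apply: VecDown3 => //; lia | lia].
rewrite (_ : _ + _ = 0 :> int); [apply: VecFix2 => //; lia | lia].
Qed.

Lemma coord_refl i x z : (i < n)%N -> (z < n)%N -> (x < k.*2.+4)%N ->
  coord (vec_refl i x) z = coord x z - vec_wt x i * vec_root i z.
Proof.
rewrite /coord /vec_root => ni nz nx; case: vecP => [ik|ik|ik|ik|ik|ik|ik|ik].
all: rewrite ?(ik, leqNgt i k) /=; lia.
Qed.

Lemma vec_root_cartan (i j : 'I_n) : (2 <= k)%N ->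
  (if (j <= k)%N then vec_root i j - vec_root i j.+1 else vec_root i k + vec_root i k.+1)
  = cartan TD j i.
Proof.
rewrite /cartan /dyn_adj /chain_edge -val_eqE /= /vec_root.
have := ltn_ord i; have := ltn_ord j.
move: (nat_of_ord i) (nat_of_ord j) => u v; repeat case: ifP => ?; lia.
Qed.

Lemma vec_wt_refl (x : nat) (i j : 'I_n) : (2 <= k)%N -> (x < k.*2.+4)%N ->
  vec_wt (vec_refl i x) j = vec_wt x j - cartan TD j i * vec_wt x i.
Proof.
move=> k2 nx; rewrite -vec_root_cartan // [vec_wt _ j]/vec_wt [vec_wt x j]/vec_wt.
by case: ifP => jk; rewrite !coord_refl //; try lia; ring.
Qed.

Lemma vec_cf_refl x i j : (i < n)%N -> (j < n)%N -> (x < k.*2.+4)%N ->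
  vec_cf (vec_refl i x) j = vec_cf x j + (i == j)%:Z * vec_wt x i.
Proof.
rewrite /vec_cf => ni nj nx; case: (ltngtP j k) => jk; case: vecP => *; lia.
Qed.

Lemma vec_wt_range x i : -1 <= vec_wt x i <= 1.
Proof. by case: vecP. Qed.

Definition vec_act (i : 'I_n) (x : X) : X := Ordinal (vec_refl_lt i (ltn_ord x)).

(** A node other than 0 can be chosen unless [x] is 1 or [2k + 3]: these and 0 are therefore the
    Levi-dominant weights, one in each of the three levels. *)
Lemma vec_lower x : (0 < x < k.*2.+4)%N -> exists i : 'I_n,
  vec_wt x i = -1 /\ (i = 0 :> nat -> x = 1 \/ x = k.*2.+3).
Proof.
move=> lx; have W i : (x == i.+1) && (i <= k)%N || (x + i == k.*2.+3)%N && (i <= k)%N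
    || (x == k.+2) && (k < i)%N -> vec_wt x i = -1.
  by case: vecP => //; lia.
have [x1|x1] := leqP x k.+1.
  have ni : (x.-1 < n)%N by lia.
  by exists (Ordinal ni); split=> /=; [apply: W; lia | lia].
have [x2|x2] := eqVneq x k.+2.
  by exists ord_max; split=> /=; [apply: W; lia | lia].
have ni : (k.*2.+3 - x < n)%N by lia.
by exists (Ordinal ni); split=> /=; [apply: W; lia | lia].
Qed.

Lemma vec_dominant_top (x : X) : (forall i : 'I_n, vec_wt x i != -1) -> x = ord0.
Proof.
move=> dom; apply/val_inj/eqP; rewrite /= -leqn0 leqNgt; apply/negP => x0.
have [|i [xi _]] := @vec_lower x; first by rewrite x0 ltn_ord.
by have := dom i; rewrite xi.
Qed.

Lemma vec_level_uniq (x y : X) : (2 <= k)%N -> vec_cf x 0 = vec_cf y 0 ->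
  (forall i : 'I_n, i != ord0 -> vec_wt x i != -1) ->
  (forall i : 'I_n, i != ord0 -> vec_wt y i != -1) -> x = y.
Proof.
move=> k2 cxy dx dy.
have ext (z : X) : (forall i : 'I_n, i != ord0 -> vec_wt z i != -1) ->
    [|| z == 0 :> nat, z == 1 :> nat | z == k.*2.+3 :> nat].
  move=> dom; case: (posnP z) => //= z0; have [|i [zi i0]] := @vec_lower z.
    by rewrite z0 ltn_ord.
  have [E|ni] := eqVneq i ord0; last by have := dom i ni; rewrite zi.
  by have [|->|->] := i0; rewrite ?E ?eqxx ?orbT.
apply: val_inj; move: cxy (ext x dx) (ext y dy); rewrite /= /vec_cf.
by move: (nat_of_ord x) (nat_of_ord y) => u v; rewrite (ltnW k2) /=; lia.
Qed.

Lemma vec_wt0 i : (2 <= k)%N -> (i < n)%N -> vec_wt 0 i = (i == 0)%:Z.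
Proof. by rewrite /vec_wt /coord => k2 ni; case: leqP => ik; lia. Qed.

Lemma vec_cf0 i : (i < n)%N -> vec_cf 0 i = 0.
Proof. by rewrite /vec_cf => ni; case: (ltngtP i k) => ik; lia. Qed.

Definition vector_model : (2 <= k)%N -> minuscule_model (@cartan TD n) ord0.
Proof.
move=> k2; refine (@MinusculeModel n _ ord0 X (fun x i => vec_wt x i)
  (fun x i => vec_cf x i) vec_act ord0 _ _ _ _ _ _ _ _).
- by move=> x i; exact: vec_wt_range.
- by move=> x i j; exact: vec_wt_refl.
- by move=> x i j; rewrite vec_cf_refl ?ltn_ord.
- by move=> i x; apply: val_inj; exact: vec_reflK.
- move=> i; have -> : (i == ord0) = (i == 0%N :> nat) by rewrite -val_eqE.
  exact: vec_wt0.
- by move=> i; exact: vec_cf0.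
- exact: vec_dominant_top.
- by move=> x y; exact: vec_level_uniq.
Defined.

(** A chain whose two middle elements are made incomparable. *)
Definition double_tail : finposet := @FinPoset 'I_(k.*2.+2) predT
  (fun x y => ((x <= y) && ~~ ((x == k :> nat) && (y == k.+1 :> nat)))%N).

Implicit Types (A B : {set fp_T double_tail}).

Let mid : 'I_(k.*2.+2) := inord k.
Let mid' : 'I_(k.*2.+2) := inord k.+1.

Let midE : mid = k :> nat. Proof. by rewrite inordK; lia. Qed.
Let midE' : mid' = k.+1 :> nat. Proof. by rewrite inordK; lia. Qed.

Variant tail_antichain : {set 'I_(k.*2.+2)} -> Prop :=
| TailEmpty : tail_antichain set0
| TailPoint y : tail_antichain [set y]
| TailPair : tail_antichain [set mid; mid'].

Lemma tail_antichainP A : antichain A <-> tail_antichain A.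
Proof.
split=> [/antichainP[_ A2]|[|y|]]; last first.
- apply/antichainP; split=> // x y; rewrite !inE => /orP[]/eqP-> /orP[]/eqP-> //=.
    by rewrite midE midE' !eqxx andbF.
  by rewrite midE midE' ltnn.
- by apply/antichainP; split=> // x z; rewrite !inE => /eqP-> /eqP->.
- by apply/antichainP; split=> // x; rewrite inE.
have pair x y : x \in A -> y \in A -> x != y -> (x < y)%N -> x = mid /\ y = mid'.
  move=> Ax Ay nxy lt; have := A2 x y Ax Ay; rewrite /= (ltnW lt) /=.
  case: andP => [[/eqP xk /eqP yk] _|_ /(_ isT) E]; last by rewrite E eqxx in nxy.
  by split; apply: val_inj; rewrite /= ?midE ?midE'.
have pair' x y : x \in A -> y \in A -> x != y ->
    (x == mid) && (y == mid') || (x == mid') && (y == mid).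
  move=> Ax Ay nxy; have [lt|lt|/val_inj E] := ltngtP x y.
  - by have [-> ->] := pair x y Ax Ay nxy lt; rewrite !eqxx.
  - by rewrite eq_sym in nxy; have [-> ->] := pair y x Ay Ax nxy lt; rewrite !eqxx orbT.
  by rewrite E eqxx in nxy.
have [->|[x Ax]] := set_0Vmem A; first exact: TailEmpty.
have [E|] := eqVneq A [set x]; first by rewrite E; exact: TailPoint.
move=> nA; have [y Ay nyx] : exists2 y, y \in A & x != y.
  case: (pickP (fun y => (y \in A) && (x != y))) => [y /andP[Ay yx]|no].
    by exists y.
  case/eqP: nA; apply/setP => y; rewrite inE; apply/idP/eqP => [Ay|->//].
  by have := no y; rewrite Ay => /negbFE/eqP.
suff -> : A = [set mid; mid'] by exact: TailPair.
have := pair' x y Ax Ay nyx => xy; apply/setP => z; rewrite !inE; apply/idP/idP.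
  move=> Az; have [->|xz] := eqVneq z x.
    by case/orP: xy => /andP[-> _]; rewrite ?orbT.
  by case/orP: (pair' z x Az Ax xz) => /andP[-> _]; rewrite ?orbT.
by case/orP=> /eqP->; case/orP: xy => /andP[/eqP xE /eqP yE]; rewrite -?xE -?yE.
Qed.

Lemma tail_pair_card : #|[set mid; mid']| = 2.
Proof.
rewrite cards2 (_ : mid != mid') //.
by apply/eqP => /(congr1 val) /=; rewrite midE midE'; lia.
Qed.

(** On a singleton the sum merely extracts the element; larger elements go to higher weights, that
    is to smaller numbers. *)
Definition tail_weight (A : {set 'I_(k.*2.+2)}) : X :=
  if A == set0 then ord0 else
  if #|A| == 2 then ord_max else inord (k.*2.+2 - \sum_(y in A) y)%N.

Lemma tail_weight0 : tail_weight set0 = ord0.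
Proof. by rewrite /tail_weight eqxx. Qed.

Lemma tail_weight1 (y : 'I_(k.*2.+2)) : tail_weight [set y] = (k.*2.+2 - y)%N :> nat.
Proof.
rewrite /tail_weight cards1 big_set1 -cards_eq0 cards1 /= inordK //; lia.
Qed.

Lemma tail_weight2 : tail_weight [set mid; mid'] = ord_max.
Proof. by rewrite /tail_weight -cards_eq0 tail_pair_card. Qed.

Lemma tail_prec (A B : {set fp_T double_tail}) : antichain A -> antichain B ->
  prec_step A B <-> exists y z : 'I_(k.*2.+2), [/\ A = [set y], B = [set z],
    (y < z)%N & ~~ ((y == k :> nat) && (z == k.+1 :> nat))].
Proof.
move=> /tail_antichainP aA /tail_antichainP aB; split; last first.
  case=> y [z [-> -> lt nyz]]; apply/prec_stepP; exists y, z.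
  have nyz' : y != z by apply: contraL lt => /eqP->; rewrite ltnn.
  split=> //=; last by rewrite (ltnW lt).
    by apply/setP => w; rewrite !inE; case: (eqVneq w y) => [->|]; rewrite ?andbF ?andbT.
  apply/setP => w; rewrite !inE; case: (eqVneq w z) => [->|]; rewrite ?andbF ?andbT //.
  by rewrite eq_sym.
case/prec_stepP => a [b [AB BA /andP[ab nab] nab']].
have cAB : #|A| = #|B|.
  by rewrite -(cardsID B A) -(cardsID A B) AB BA !cards1 setIC.
have Aa : a \in A :\: B by rewrite AB inE.
have Bb : b \in B :\: A by rewrite BA inE.
move: Aa Bb; rewrite !inE => /andP[aB' aA'] /andP[bA bB].
case: A / aA cAB {AB BA} aA' aB' bA => [|y|]; case: B / aB bB => [|z|] //=;
  rewrite ?inE ?cards0 ?cards1 ?tail_pair_card //.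
- move=> /eqP bz _ /eqP ay _ _; exists y, z; split=> //; last by rewrite -ay -bz.
  by rewrite -ay -bz ltn_neqAle ab andbT; move: nab'; rewrite -val_eqE.
- by move=> bB _ _ _ /negP.
Qed.

Theorem vector_antichain_model (k2 : (2 <= k)%N) :
  antichain_model (vector_model k2) double_tail.
Proof.
exists tail_weight; split.
- move=> A /tail_antichainP[|y|]; rewrite /cf /= /vec_cf (ltnW k2) /=.
  + by rewrite tail_weight0 cards0.
  + by rewrite tail_weight1 cards1; have := ltn_ord y; lia.
  by rewrite tail_weight2 tail_pair_card /=; lia.
- move=> A B /tail_antichainP[|y|] /tail_antichainP[|z|] // /(congr1 val) /=;
    rewrite ?tail_weight0 ?tail_weight1 ?tail_weight2 /=.
  + by have := ltn_ord z; lia.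
  + by [].
  + by have := ltn_ord y; lia.
  + by move=> E; congr [set _]; apply: val_inj => /=; have := ltn_ord y;
      have := ltn_ord z; lia.
  + by have := ltn_ord y; lia.
  + by [].
  by have := ltn_ord z; lia.
- move=> x; have lx := ltn_ord x.
  have [x0|x0] := eqVneq (x : nat) 0%N.
    exists set0; first exact/tail_antichainP/TailEmpty.
    by apply: val_inj; rewrite tail_weight0.
  have [x1|x1] := eqVneq (x : nat) k.*2.+3.
    exists [set mid; mid']; first exact/tail_antichainP/TailPair.
    by apply: val_inj; rewrite tail_weight2.
  exists [set inord (k.*2.+2 - x)]; first exact/tail_antichainP/TailPoint.
  by apply: val_inj; rewrite /= tail_weight1 inordK; lia.
- move=> A i aA; have -> : (i == ord0) = (i == 0%N :> nat) by rewrite -val_eqE.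
  have ni := ltn_ord i; rewrite /wt /= => i0 Ai.
  case/tail_antichainP: (aA) Ai => [|y|].
  + by rewrite tail_weight0 /= vec_wt0 // (negbTE i0).
  + move=> Ai; have ly := ltn_ord y.
    (* As the node is not 0, the lowered weight stays in the middle level, and a single step never
       joins the two incomparable middle weights. *)
    have [lt1 lt2 lt3] : [/\ (0 < vec_refl i (tail_weight [set y]))%N,
        (vec_refl i (tail_weight [set y]) < k.*2.+3)%N &
        (k.*2.+2 - y < vec_refl i (tail_weight [set y]))%N &&
        ~~ ((vec_refl i (tail_weight [set y]) == k.+2) && (y == k.+1 :> nat))].
      by move: Ai; rewrite tail_weight1; case: vecP => // *; split; lia.
    exists [set inord (k.*2.+2 - vec_refl i (tail_weight [set y]))].
    have aB (z : 'I_(k.*2.+2)) : antichain ([set z] : {set fp_T double_tail}).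
      exact/tail_antichainP/TailPoint.
    split; first exact: aB.
      by apply: val_inj; rewrite /= tail_weight1 inordK //=; lia.
    apply/(tail_prec (aB _) (aB _)); exists (inord (k.*2.+2 - vec_refl i (tail_weight [set y]))), y.
    by split=> //; rewrite inordK; lia.
  by rewrite tail_weight2 /=; case: vecP => //; lia.
move=> A B i aA aB /(tail_prec aA aB)[y [z [-> -> lt nyz]]] _.
rewrite /cf /= !tail_weight1 /vec_cf.
by have := ltn_ord y; have := ltn_ord z; case: (ltngtP i k) => ik; lia.
Qed.

End VectorModel.

(** * The minuscule posets as posets of the models *)

Lemma chainprod_pair_iso (m q : nat) :
  @poset_iso (chainprod m q) (pair_poset (m + q) true m)
    (fun x => (lshift q x.1, rshift m x.2)).
Proof.
split=> /=.
- by move=> [x y] _; rewrite /= /low /=; have := ltn_ord x; lia.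
- by move=> [x y] [x' y'] _ _ [] /val_inj-> /addnI/val_inj->.
- move=> [x y] /andP[/= _ /andP[]]; rewrite /low => xm ym.
  have yq : (y - m < q)%N by have := ltn_ord y; lia.
  exists (Ordinal xm, Ordinal yq) => //; congr (_, _); apply: val_inj => //=; lia.
by move=> [x y] [x' y'] _ _ /=; rewrite leq_add2l.
Qed.

Lemma card_ord_lt (k m : nat) : (m <= k)%N -> #|[set y : 'I_k | (y < m)%N]| = m.
Proof.
move=> mk; rewrite -sum1_card; under eq_bigl => y do rewrite inE.
by rewrite -(big_ord_widen k (fun=> 1%N) mk) sum1_card card_ord.
Qed.

Lemma initial_segment (k : nat) (S : {set 'I_k}) :
  (forall x y : 'I_k, y \in S -> (x <= y)%N -> x \in S) ->
  forall x, (x \in S) = (x < #|S|)%N.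
Proof.
move=> Sdown x; apply/idP/idP => [xS|].
  rewrite -[X in (X <= _)%N](@card_ord_lt k x.+1 (ltn_ord x)); apply: subset_leq_card.
  by apply/subsetP => y; rewrite inE ltnS; exact: Sdown.
apply: contraLR => xS; rewrite -leqNgt -[X in (_ <= X)%N](@card_ord_lt k x (ltnW (ltn_ord x))).
apply: subset_leq_card; apply/subsetP => y yS; rewrite inE ltnNge.
by apply: contra xS; exact: Sdown.
Qed.

(** An ideal of [[k] x [2]] is given by two column heights [c1 <= c0]; passing to [c0 + 1] makes the
    inequality strict. *)
Lemma Jp_chainprod2_pair_iso (k : nat) :
  @poset_iso (Jp (chainprod k 2)) (pair_poset k.+2 false 0)
    (fun X => (inord #|[set x : 'I_k | (x, inord 1 : 'I_2) \in X]|,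
               inord #|[set x : 'I_k | (x, ord0 : 'I_2) \in X]|.+1)).
Proof.
pose col (X : {set 'I_k * 'I_2}) (y : 'I_2) := [set x : 'I_k | (x, y) \in X].
have colk X y : (#|col X y| <= k)%N by rewrite -[X in (_ <= X)%N]card_ord max_card.
have colS X y : (#|col X y| < k.+2)%N by rewrite ltnS (leqW (colk X y)).
have colSS X y : (#|col X y|.+1 < k.+2)%N by rewrite !ltnS colk.
have y01 (y : 'I_2) : y = ord0 \/ y = inord 1.
  case: y => -[|[|//]] y; [left | right]; apply: val_inj => //=.
  by rewrite inordK.
have le01 : (ord0 <= (inord 1 : 'I_2))%N by [].
have memX (X : {set 'I_k * 'I_2}) : is_ideal (X : {set fp_T (chainprod k 2)}) ->
    forall x y, ((x, y) \in X) = (x < #|col X y|)%N.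
  case/is_idealP => _ X2 x y; rewrite -initial_segment ?inE // => z w.
  by rewrite !inE => wX zw; apply: X2 wX _ => //=; rewrite zw leqnn.
have col10 (X : {set 'I_k * 'I_2}) : is_ideal (X : {set fp_T (chainprod k 2)}) ->
    (#|col X (inord 1)| <= #|col X ord0|)%N.
  case/is_idealP => _ X2; apply: subset_leq_card; apply/subsetP => x; rewrite !inE => xX.
  by apply: X2 xX _ => //=; rewrite leqnn.
have le_col (X Y : {set 'I_k * 'I_2}) : is_ideal (X : {set fp_T (chainprod k 2)}) ->
    is_ideal (Y : {set fp_T (chainprod k 2)}) -> (X \subset Y) =
    (#|col X (inord 1)| <= #|col Y (inord 1)|)%N && (#|col X ord0| <= #|col Y ord0|)%N.
  move=> iX iY; apply/subsetP/andP => [XY|[l1 l0] [x y]].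
    by split; apply: subset_leq_card; apply/subsetP => x; rewrite !inE; exact: XY.
  rewrite !memX // => /leq_trans; apply.
  by case: (y01 y) => ->.
split.
- move=> X iX; rewrite /= andbT !inordK; first by rewrite ltnS; exact: col10.
    exact: (colSS X ord0).
  exact: (colS X (inord 1)).
- move=> X Y iX iY [/(congr1 val) E1 /(congr1 val) E0]; move: E1 E0.
  have bX := colS X (inord 1); have bY := colS Y (inord 1).
  have bX' := colSS X ord0; have bY' := colSS Y ord0.
  rewrite /= !inordK // => E1 [E0].
  by apply/eqP; rewrite eqEsubset !le_col // /col E1 E0 !leqnn.
- move=> [b a] /andP[/= ba _]; have la := ltn_ord a.
  pose X := [set z : 'I_k * 'I_2 | (z.1 < if z.2 == ord0 then a.-1 else b)%N].
  have n10 : ((inord 1 : 'I_2) == ord0) = false by rewrite -val_eqE /= inordK.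
  exists X.
    apply/is_idealP; split=> // -[x y] [x' y'] _; rewrite !inE /= => lt /andP[xx yy].
    apply: leq_ltn_trans xx (leq_trans lt _).
    case: (y01 y) yy => ->; case: (y01 y') => ->; rewrite ?n10 ?eqxx ?inordK //=; lia.
  have cX y : #|[set x : 'I_k | (x, y) \in X]| = if y == ord0 then a.-1 else b.
    rewrite -[RHS](@card_ord_lt k); last by case: ifP => _; lia.
    by apply: eq_card => x; rewrite !inE.
  rewrite !cX n10 eqxx; congr (_, _); apply: val_inj; rewrite /= inordK //; lia.
move=> X Y iX iY /=; rewrite le_col //.
have bX := colS X (inord 1); have bY := colS Y (inord 1).
have bX' := colSS X ord0; have bY' := colSS Y ord0.
by rewrite !inordK.
Qed.

Lemma chainprod22_iso : exists g : fp_T (chainprod 2 2) -> fp_T (double_tail 1), poset_iso g.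
Proof.
exists (fun x : 'I_2 * 'I_2 => inord (x.1.*2 + x.2) : 'I_4).
have lt (x : 'I_2 * 'I_2) : (x.1.*2 + x.2 < 4)%N.
  by have := ltn_ord x.1; have := ltn_ord x.2; lia.
split=> //=.
- move=> [x y] [x' y'] _ _ /(congr1 val); have /= l1 := lt (x, y).
  have /= l2 := lt (x', y'); rewrite /= !inordK //.
  have := ltn_ord x; have := ltn_ord y; have := ltn_ord x'; have := ltn_ord y' => ? ? ? ? E.
  by congr (_, _); apply: val_inj => /=; lia.
- move=> z _; have lz := ltn_ord z; exists (inord z./2, inord (odd z)) => //=.
  by apply: val_inj; rewrite /= !inordK //; lia.
move=> [x y] [x' y'] _ _ /=; have /= l1 := lt (x, y); have /= l2 := lt (x', y').
rewrite !inordK //.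
have := ltn_ord x; have := ltn_ord y; have := ltn_ord x'; have := ltn_ord y' => /=; lia.
Qed.

Section DoubleTail.
Variable k : nat.

(** Ideals are numbered by inclusion: initial segments of size up to [k + 1], then the other ideal
    of size [k + 1], which omits [k], then the longer initial segments, of size [m - 1]. *)
Definition tail_mem (m y : nat) : bool :=
  if (m <= k.+1)%N then (y < m)%N else
  if m == k.+2 then (y < k)%N || (y == k.+1) else (y < m.-1)%N.

Definition tail_ideal (m : 'I_(k.+1.*2.+2)) : {set 'I_(k.*2.+2)} :=
  [set y : 'I_(k.*2.+2) | tail_mem m y].

Lemma tail_ideal_sub (m m' : 'I_(k.+1.*2.+2)) : (tail_ideal m \subset tail_ideal m') =
  (m <= m')%N && ~~ ((m == k.+1 :> nat) && (m' == k.+2 :> nat)).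
Proof.
have lm := ltn_ord m; have lm' := ltn_ord m'.
apply/subsetP/idP => [sub|le y]; last first.
  rewrite !inE /tail_mem; move: le; repeat case: ifP => ?; lia.
have {}sub y : (y < k.*2.+2)%N -> tail_mem m y -> tail_mem m' y.
  by move=> ly; have := sub (Ordinal ly); rewrite !inE.
(* These four elements suffice to test the inclusion. *)
have := sub k; have := sub k.+1; have := sub m'; have := sub (m - 2)%N.
rewrite /tail_mem; repeat case: ifP => ?; lia.
Qed.

Lemma tail_ideal_inj : injective tail_ideal.
Proof.
move=> m m' E; have := tail_ideal_sub m m'; have := tail_ideal_sub m' m.
by rewrite E subxx => *; apply: val_inj => /=; lia.
Qed.

Lemma tail_ideal_onto (X : {set fp_T (double_tail k)}) :
  is_ideal X -> exists m, tail_ideal m = X.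
Proof.
case/is_idealP => _ X2.
have lek : (k < k.*2.+2)%N by lia.
have lek' : (k.+1 < k.*2.+2)%N by lia.
pose c : 'I_(k.*2.+2) := Ordinal lek; pose c' : 'I_(k.*2.+2) := Ordinal lek'.
(* The only ideal that is not an initial segment contains [k + 1] without [k]. *)
case: (boolP ((c' \in X) && (c \notin X))) => [/andP[c'X cX]|ncX].
  have lm : (k.+2 < k.+1.*2.+2)%N by lia.
  exists (Ordinal lm); apply/setP => y; rewrite inE /tail_mem /= ltnn eqxx.
  have [lt|lt|E] := ltngtP y k.
  - by apply/esym/(X2 _ c') => //=; lia.
  - have [E|ne] := eqVneq (y : nat) k.+1.
      by rewrite -c'X /=; congr (_ \in X); apply: val_inj.
    by apply/esym/negbTE; apply: contra cX => yX; apply: X2 yX _ => //=; lia.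
  rewrite (_ : y = c); last exact: val_inj.
  by rewrite (negbTE cX) /=; lia.
have Xlt := @initial_segment _ X; have {}Xlt x : (x \in X) = (x < #|X|)%N.
  apply: Xlt => {}x y yX xy.
  have [/andP[/eqP xk /eqP yk]|nxy] := boolP ((x == k :> nat) && (y == k.+1 :> nat)).
    have Ex : x = c by exact: val_inj.
    have Ey : y = c' by exact: val_inj.
    by move: ncX; rewrite -Ey yX /= Ex negbK.
  by apply: X2 yX _; rewrite //= xy.
have sX : (#|X| <= k.*2.+2)%N by rewrite -[X in (_ <= X)%N]card_ord max_card.
have lm : ((if #|X| <= k.+1 then #|X| else #|X|.+1) < k.+1.*2.+2)%N by case: ifP; lia.
exists (Ordinal lm); apply/setP => y; rewrite inE Xlt /tail_mem /=.
move: sX; move: #|X| => s sX.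
by case: (leqP s k.+1) => sk /=; repeat case: ifP => ?; lia.
Qed.

Lemma tail_ideal_ideal m : is_ideal (tail_ideal m : {set fp_T (double_tail k)}).
Proof.
apply/is_idealP; split=> // x y _; rewrite !inE /= /tail_mem => ym xy; move: ym.
by have := ltn_ord m; repeat case: ifP => ?; lia.
Qed.

Lemma Jp_double_tail_iso :
  exists g : fp_T (Jp (double_tail k)) -> fp_T (double_tail k.+1), poset_iso g.
Proof.
pose g (X : {set 'I_(k.*2.+2)}) : 'I_(k.+1.*2.+2) :=
  odflt ord0 [pick m | tail_ideal m == X].
have gK m : g (tail_ideal m) = m.
  rewrite /g; case: pickP => [m' /eqP/tail_ideal_inj //|/(_ m)].
  by rewrite eqxx.
exists g; split=> //=.
- by move=> _ _ /tail_ideal_onto[m <-] /tail_ideal_onto[m' <-]; rewrite !gK => ->.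
- by move=> m _; exists (tail_ideal m); [exact: tail_ideal_ideal | exact: gK].
by move=> _ _ /tail_ideal_onto[m <-] /tail_ideal_onto[m' <-]; rewrite !gK tail_ideal_sub.
Qed.

End DoubleTail.

Lemma Jpow_double_tail_iso (k : nat) :
  exists g : fp_T (Jpow k (chainprod 2 2)) -> fp_T (double_tail k.+1), poset_iso g.
Proof.
elim: k => [|k [g isog]]; first exact: chainprod22_iso.
have [g' isog'] := Jp_double_tail_iso k.+1.
by exists (g' \o (fun X : {set _} => g @: X)); apply: poset_iso_comp (Jp_iso isog) isog'.
Qed.

(** * Computable posets, ideals and antichains *)

(* In the exceptional cases everything is finite and is checked by computation; finite sets
   do not compute, so a subset of 'I_m is coded by the increasing list of its elements. *)
Fixpoint sublists (keep skip : nat -> seq nat -> bool) (s : seq nat) : seq (seq nat) :=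
  if s is x :: s' then
    let r := sublists keep skip s' in
    [seq t <- r | skip x t] ++ [seq x :: t | t <- [seq t <- r | keep x t]]
  else [:: [::]].

(** Completeness of the enumeration; that each listed code is genuine is checked by computation. *)
Lemma mem_sublists (keep skip : nat -> seq nat -> bool) (s : seq nat) (P : pred nat) :
    (forall x s', subseq (x :: s') s -> P x -> keep x [seq y <- s' | P y]) ->
    (forall x s', subseq (x :: s') s -> ~~ P x -> skip x [seq y <- s' | P y]) ->
  [seq y <- s | P y] \in sublists keep skip s.
Proof.
elim: s => [|x s IH] Pk Ps //=.
have {}IH : [seq y <- s | P y] \in sublists keep skip s.
  by apply: IH => y s' sub; [apply: Pk | apply: Ps];
    exact: subseq_trans sub (subseq_cons _ _).
rewrite mem_cat; case: (boolP (P x)) => Px; apply/orP; [right | left].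
  by apply: map_f; rewrite mem_filter IH Pk.
by rewrite mem_filter IH Ps.
Qed.

Section Codes.
Variable m : nat.
Implicit Types (A : {set 'I_m}) (t : seq nat).

Definition code A : seq nat := [seq y <- iota 0 m | y \in [seq val x | x in A]].
Definition decode t : {set 'I_m} := [set x : 'I_m | val x \in t].

Lemma mem_image_val A (x : 'I_m) : (val x \in [seq val z | z in A]) = (x \in A).
Proof. by rewrite mem_map ?mem_enum //; exact: val_inj. Qed.

Lemma mem_code A (x : 'I_m) : (val x \in code A) = (x \in A).
Proof.
by rewrite mem_filter mem_image_val mem_iota ltn_ord !andbT.
Qed.

Lemma codeK A : decode (code A) = A.
Proof. by apply/setP => x; rewrite inE mem_code. Qed.

Lemma code_lt A y : y \in code A -> exists2 x : 'I_m, x \in A & y = val x.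
Proof. by rewrite mem_filter => /andP[/imageP[x Ax ->] _]; exists x. Qed.

Lemma decodeK t : [seq y <- iota 0 m | y \in t] = t -> code (decode t) = t.
Proof.
move=> {2}<-; apply: eq_in_filter => y; rewrite mem_iota add0n => /= ym.
by rewrite -[y]/(val (Ordinal ym)) mem_image_val inE.
Qed.

Lemma codeD A B : [seq y <- code A | y \notin code B] = code (A :\: B).
Proof.
rewrite /code -filter_predI; apply: eq_in_filter => y; rewrite mem_iota add0n => /= ym.
by rewrite -[y]/(val (Ordinal ym)) mem_code !mem_image_val inE.
Qed.

Lemma size_code A : size (code A) = #|A|.
Proof.
have uA : uniq [seq val x | x in A] by rewrite map_inj_uniq ?enum_uniq //; exact: val_inj.
rewrite cardE -(size_map val); apply: perm_size; apply: uniq_perm => //.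
  by rewrite filter_uniq ?iota_uniq.
move=> y; rewrite mem_filter; case: (boolP (y \in _)) => //= /imageP[x _ ->].
by rewrite mem_iota ltn_ord.
Qed.

Lemma code_singleton A y : code A = [:: y] -> exists2 x : 'I_m, A = [set x] & y = val x.
Proof.
move=> Ay; have [|x Ax yx] := @code_lt A y; first by rewrite Ay inE.
exists x => //; rewrite -(codeK A) Ay yx; apply/setP => z.
by rewrite !inE val_eqE.
Qed.

Lemma code1 (x : 'I_m) : code [set x] = [:: val x].
Proof.
case E: (code [set x]) (size_code [set x]) => [|y [|? ?]]; rewrite cards1 // => _.
by have [z /setP/(_ x) + ->] := code_singleton E; rewrite !inE eqxx => /esym/eqP->.
Qed.

End Codes.

Definition tab_poset (m : nat) (le : rel nat) : finposet :=
  @FinPoset 'I_m predT (fun x y => le x y).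

Definition ideal_codes (m : nat) (le : rel nat) : seq (seq nat) :=
  sublists (fun _ _ => true) (fun x t => ~~ has (le x) t) (iota 0 m).

Definition incl_le (ids : seq (seq nat)) : rel nat :=
  fun i j => all (fun y => y \in nth [::] ids j) (nth [::] ids i).

Definition check_ideals (m : nat) (le : rel nat) (ids : seq (seq nat)) : bool :=
  [&& ideal_codes m le == ids, uniq ids,
   all (fun t => [seq y <- iota 0 m | y \in t] == t) ids &
   all (fun t => all (fun y => all (fun x => le x y ==> (x \in t)) (iota 0 m)) t) ids].

Lemma Jp_tab_iso (m m' : nat) (le : rel nat) (ids : seq (seq nat)) :
    check_ideals m le ids -> size ids = m'.+1 ->
  exists g : fp_T (Jp (tab_poset m le)) -> fp_T (tab_poset m'.+1 (incl_le ids)),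
    poset_iso g.
Proof.
case/and4P => /eqP idsE uids /allP norm /allP closed sids.
pose g (X : {set 'I_m}) : 'I_m'.+1 := inord (index (code X) ids).
have codeX (X : {set fp_T (tab_poset m le)}) : is_ideal X -> code X \in ids.
  case/is_idealP => _ X2; rewrite -idsE; apply: mem_sublists => // x s' sub.
  move=> nXx; apply/hasPn => y; rewrite mem_filter => /andP[/imageP[z Xz ->] _].
  have xm : (x < m)%N.
    by have := mem_subseq sub (mem_head x s'); rewrite mem_iota.
  apply: contra nXx => xz; apply/imageP; exists (Ordinal xm) => //.
  exact: (X2 (Ordinal xm) z isT Xz xz).
have gK (X : {set fp_T (tab_poset m le)}) : is_ideal X -> nth [::] ids (g X) = code X.
  move=> /codeX cX; rewrite /g inordK ?nth_index //.
  by rewrite -sids index_mem.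
have decode_ideal (i : 'I_m'.+1) :
    is_ideal (decode m (nth [::] ids i) : {set fp_T (tab_poset m le)}).
  apply/is_idealP; split=> // x y _; rewrite !inE => yi xy.
  have idi : nth [::] ids i \in ids by rewrite mem_nth // sids.
  have /allP/(_ _ yi)/allP/(_ (val x)) := closed _ idi.
  by rewrite mem_iota ltn_ord => /(_ isT)/implyP; apply.
have codeI (i : 'I_m'.+1) : code (decode m (nth [::] ids i)) = nth [::] ids i.
  by apply/decodeK/eqP/norm/mem_nth; rewrite sids.
exists g; split=> //=.
- move=> X Y iX iY XY; rewrite -(codeK X) -(codeK Y) -(gK X iX) -(gK Y iY).
  by rewrite XY.
- move=> i _; exists (decode m (nth [::] ids i)); first exact: decode_ideal.
  by apply: val_inj; rewrite /g codeI index_uniq ?sids // inord_val.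
move=> X Y iX iY; rewrite /incl_le (gK X iX) (gK Y iY).
apply/allP/subsetP => [XY x Xx|XY y /code_lt[x Xx ->]].
  by rewrite -mem_code; apply: XY; rewrite mem_code.
by rewrite mem_code; exact: XY.
Qed.

Definition antichain_codes (m : nat) (le : rel nat) : seq (seq nat) :=
  sublists (fun x t => ~~ has (fun y => le x y || le y x) t) (fun _ _ => true) (iota 0 m).

Definition prec_code (le : rel nat) (t u : seq nat) : bool :=
  if [seq y <- t | y \notin u] is [:: a] then
    if [seq y <- u | y \notin t] is [:: b] then le a b && (a != b) else false
  else false.

Definition cartan_nat (t : sltype) (n i j : nat) : int :=
  if i == j then 2 else if dyn_adj t n i.+1 j.+1 then -1 else 0.

Section Table.
Variables (t : sltype) (n p m M : nat) (le : rel nat).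
Variables (cfs acs : seq (seq nat)).

Definition tcf (x i : nat) : nat := nth 0%N (nth [::] cfs x) i.

Definition twt (x i : nat) : int :=
  (i == p)%:Z - foldr (fun j c => cartan_nat t n i j * (tcf x j)%:Z + c) 0 (iota 0 n).

(** The reflected row is looked up in the table; a missing row gives [size cfs], which is out of
    range for the tables used. *)
Definition trefl (i x : nat) : nat :=
  let c := [seq if j == i then absz ((tcf x j)%:Z + twt x j) else tcf x j | j <- iota 0 n] in
  index c cfs.

(** The axioms of [minuscule_model] in computable form, with row 0 as the top. *)
Definition check_model : bool :=
  let I := iota 0 n in let X := iota 0 M.+1 in
  [&& all (fun x => all (fun i => [&& -1 <= twt x i <= 1, (trefl i x < M.+1)%N,
        trefl i (trefl i x) == x,
        all (fun j => twt (trefl i x) j == twt x j - cartan_nat t n j i * twt x i) I &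
        all (fun j => (tcf (trefl i x) j)%:Z == (tcf x j)%:Z + (i == j)%:Z * twt x i) I])
        I) X,
      all (fun i => (twt 0 i == (i == p)%:Z) && (tcf 0 i == 0%N)) I,
      all (fun x => (x == 0%N) || has (fun i => twt x i == -1) I) X &
      all (fun x => all (fun y => [|| x == y, tcf x p != tcf y p,
        has (fun i => (i != p) && (twt x i == -1)) I |
        has (fun i => (i != p) && (twt y i == -1)) I]) X) X].

Definition check_antichains : bool :=
  [&& antichain_codes m le == acs, uniq acs, size acs == M.+1,
      all (fun u => [seq y <- iota 0 m | y \in u] == u) acs &
      all (fun u => all (fun x => all (fun y => le x y ==> (x == y)) u) u) acs].

Definition check_order : bool :=
  let I := iota 0 n in let X := iota 0 M.+1 in
  let ac x := nth [::] acs x in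
  [&& all (fun x => tcf x p == size (ac x)) X,
      all (fun x => all (fun i => (i != p) && (twt x i == 1) ==>
        prec_code le (ac (trefl i x)) (ac x)) I) X &
      all (fun x => all (fun y => prec_code le (ac x) (ac y) ==>
        all (fun i => (i != p) ==> (tcf y i <= tcf x i)%N) I) X) X].

Hypothesis ok_model : check_model.
Hypothesis pn : (p < n)%N.
Let p0 : 'I_n := Ordinal pn.

Let in_iota k (x : 'I_k) : val x \in iota 0 k.
Proof. by rewrite mem_iota ltn_ord. Qed.

Let model_refl (x : 'I_M.+1) (i : 'I_n) :
  [/\ -1 <= twt x i <= 1, (trefl i x < M.+1)%N, trefl i (trefl i x) = x,
      forall j : 'I_n, twt (trefl i x) j = twt x j - cartan_nat t n j i * twt x i &
      forall j : 'I_n, (tcf (trefl i x) j)%:Z = (tcf x j)%:Z + (i == j :> nat)%:Z * twt x i].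
Proof.
case/and4P: ok_model => /allP/(_ _ (in_iota x))/allP/(_ _ (in_iota i)) + _ _ _.
case/and5P => ? ? /eqP ? /allP H1 /allP H2; split=> // j.
  exact: eqP (H1 _ (in_iota j)).
exact: eqP (H2 _ (in_iota j)).
Qed.

Definition table_act (i : 'I_n) (x : 'I_M.+1) : 'I_M.+1 := inord (trefl i x).

Let table_actE i x : table_act i x = trefl i x :> nat.
Proof. by rewrite inordK //; case: (model_refl x i). Qed.

Let cartanE (i j : 'I_n) : cartan_nat t n i j = cartan t i j.
Proof. by []. Qed.

Definition table_model : minuscule_model (@cartan t n) p0.
Proof.
refine (@MinusculeModel n _ p0 'I_M.+1 (fun x i => twt x i) (fun x i => (tcf x i)%:Z)
  table_act ord0 _ _ _ _ _ _ _ _).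
- by move=> x i; case: (model_refl x i).
- by move=> x i j; rewrite table_actE -cartanE; case: (model_refl x i).
- by move=> x i j; rewrite table_actE; case: (model_refl x i) => _ _ _ _ ->.
- by move=> i x; apply: val_inj; rewrite /= !table_actE; case: (model_refl x i).
- move=> i; case/and4P: ok_model => _ /allP/(_ _ (in_iota i))/andP[/eqP E _] _ _.
  exact: E.
- move=> i; case/and4P: ok_model => _ /allP/(_ _ (in_iota i))/andP[_ /eqP E] _ _.
  by congr Posz; exact: E.
- move=> x dom; case/and4P: ok_model => _ _ /allP/(_ _ (in_iota x)) + _.
  case/orP => [/eqP x0|/hasP[i]]; first exact: val_inj.
  rewrite mem_iota add0n => /= ni wi.
  by have := dom (Ordinal ni); rewrite wi.
move=> x y [cxy] dx dy; case/and4P: ok_model => _ _ _.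
move=> /allP/(_ _ (in_iota x))/allP/(_ _ (in_iota y)).
rewrite cxy eqxx /= => /or3P[/eqP|/hasP[i]|/hasP[i]]; first exact: val_inj.
  rewrite mem_iota add0n => /= ni /andP[ip wi].
  by have := dx (Ordinal ni) ip; rewrite wi.
rewrite mem_iota add0n => /= ni /andP[ip wi].
by have := dy (Ordinal ni) ip; rewrite wi.
Defined.

Hypothesis ok_ac : check_antichains.
Hypothesis ok_order : check_order.

Let Q := tab_poset m le.

(** Antichain number [x] of [acs] is matched with row [x] of [cfs]. *)
Theorem table_antichain_model : antichain_model table_model Q.
Proof.
have [/eqP acsE uacs /eqP sacs /allP norm0 /allP anti0] := and5P ok_ac.
have norm u : u \in acs -> [seq y <- iota 0 m | y \in u] = u by move/norm0/eqP.
have anti u : u \in acs -> {in u &, forall x y, le x y -> x = y}.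
  move=> /anti0/allP H x y xu yu xy.
  by have /allP/(_ y yu) := H x xu; rewrite xy => /eqP.
have lev (x : 'I_M.+1) : tcf x p = size (nth [::] acs x).
  by case/and3P: ok_order => /allP/(_ _ (in_iota x))/eqP.
have down (x : 'I_M.+1) (i : 'I_n) : i != p0 -> twt x i = 1 ->
    prec_code le (nth [::] acs (trefl i x)) (nth [::] acs x).
  move=> ip xi; case/and3P: ok_order => _.
  move=> /allP/(_ _ (in_iota x))/allP/(_ _ (in_iota i)) + _.
  by rewrite /= xi eqxx andbT => /implyP; apply.
have mono (x y : 'I_M.+1) (i : 'I_n) : i != p0 ->
    prec_code le (nth [::] acs x) (nth [::] acs y) -> (tcf y i <= tcf x i)%N.
  move=> ip xy; case/and3P: ok_order => _ _.
  move=> /allP/(_ _ (in_iota x))/allP/(_ _ (in_iota y)).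
  by rewrite xy => /allP/(_ _ (in_iota i))/implyP; apply.
have code_ac (A : {set fp_T Q}) : antichain A -> code A \in acs.
  case/antichainP => _ A2; rewrite -acsE; apply: mem_sublists => // x s' sub.
  case/imageP => u Au xu; apply/hasPn => y; rewrite mem_filter => /andP[/imageP[w Aw yw] ys].
  rewrite xu yw; have uw : u != w.
    have := subseq_uniq sub (iota_uniq 0 m); rewrite /= => /andP[xs' _].
    by apply: contraNneq xs' => uw; rewrite xu uw -yw.
  by apply/norP; split; apply: contra uw => /A2 E; rewrite E ?eqxx.
have decode_ac u : u \in acs -> antichain (decode m u : {set fp_T Q}).
  move=> ua; apply/antichainP; split=> // x y; rewrite !inE => xu yu xy.
  by apply: val_inj; exact: anti ua _ _ xu yu xy.
have prec_codeP (A B : {set fp_T Q}) : prec_code le (code A) (code B) = prec_step A B.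
  rewrite /prec_code !codeD; apply/idP/prec_stepP => [|[a [b [-> -> ab nab]]]]; last first.
    by rewrite !code1 val_eqE nab andbT.
  case E1: (code (A :\: B)) => [|a' [|? ?]] //; case E2: (code (B :\: A)) => [|b' [|? ?]] //.
  have [a Aa ->] := code_singleton E1; have [b Bb ->] := code_singleton E2.
  by rewrite val_eqE => /andP[ab nab]; exists a, b.
pose phi (A : {set fp_T Q}) : table_model := inord (index (code A) acs) : 'I_M.+1.
have phiK A : antichain A -> nth [::] acs (phi A : 'I_M.+1) = code A.
  by move=> /code_ac cA; rewrite /phi inordK ?nth_index // -sacs index_mem.
have phi_inj A B : antichain A -> antichain B -> phi A = phi B -> A = B.
  by move=> aA aB AB; rewrite -(codeK A) -(codeK B) -!phiK // AB.
have ac_mem (x : 'I_M.+1) : nth [::] acs x \in acs by rewrite mem_nth // sacs.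
have phi_decode (x : 'I_M.+1) : phi (decode m (nth [::] acs x)) = x.
  by apply: val_inj; rewrite /phi decodeK ?norm // index_uniq ?sacs // inord_val.
exists phi; split=> //.
- by move=> A aA; rewrite /cf /= lev phiK // size_code.
- by move=> x; exists (decode m (nth [::] acs (x : 'I_M.+1))); [exact: decode_ac | exact: phi_decode].
- move=> A i aA ip /(down _ _ ip); rewrite phiK // -table_actE => AB.
  exists (decode m (nth [::] acs (refl i (phi A) : 'I_M.+1))).
  split; [exact: decode_ac | exact: phi_decode |].
  by rewrite -prec_codeP decodeK ?norm.
move=> A B i aA aB AB ip; rewrite /cf /= lez_nat; apply: mono => //.
by rewrite !phiK // prec_codeP.
Qed.

End Table.

(** * Tables for E6 and E7 *)

Definition grid_le : rel nat := fun i j => ((i %/ 3 <= j %/ 3) && (i %% 3 <= j %% 3))%N.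

Lemma grid_iso : exists g : fp_T (chainprod 2 3) -> fp_T (tab_poset 6 grid_le), poset_iso g.
Proof.
exists (fun x : 'I_2 * 'I_3 => inord (x.1 * 3 + x.2) : 'I_6).
have lt (x : 'I_2 * 'I_3) : (x.1 * 3 + x.2 < 6)%N.
  by have := ltn_ord x.1; have := ltn_ord x.2; lia.
have dm (x : 'I_2 * 'I_3) : ((x.1 * 3 + x.2) %/ 3 = x.1 /\ (x.1 * 3 + x.2) %% 3 = x.2)%N.
  by rewrite divnMDl // divn_small // addn0 modnMDl modn_small.
split=> //=.
- move=> x y _ _ /(congr1 val); rewrite /= !inordK // => E.
  rewrite [x]surjective_pairing [y]surjective_pairing.
  have [x1 x2] := dm x; have [y1 y2] := dm y.
  congr (_, _); apply: val_inj => /=; first by rewrite -[LHS]x1 E.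
  by rewrite -[LHS]x2 E.
- move=> z _; have z1 : (z %/ 3 < 2)%N by rewrite ltn_divLR.
  have z2 : (z %% 3 < 3)%N by rewrite ltn_mod.
  exists (Ordinal z1, Ordinal z2) => //; apply: val_inj.
  by rewrite /= inordK -?divn_eq.
move=> x y _ _; rewrite /grid_le !inordK //.
by have [-> ->] := dm x; have [-> ->] := dm y.
Qed.

Definition ideals1 := Eval vm_compute in ideal_codes 6 grid_le.
Definition ideals2 := Eval vm_compute in ideal_codes 10 (incl_le ideals1).
Definition ideals3 := Eval vm_compute in ideal_codes 16 (incl_le ideals2).

Lemma Jp_iso_step (P : finposet) (m m' : nat) (le : rel nat) (ids : seq (seq nat)) :
    (exists g : fp_T P -> fp_T (tab_poset m le), poset_iso g) ->
    check_ideals m le ids -> size ids = m'.+1 ->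
  exists g : fp_T (Jp P) -> fp_T (tab_poset m'.+1 (incl_le ids)), poset_iso g.
Proof.
case=> g /Jp_iso isog ck sz; have [g' isog'] := Jp_tab_iso ck sz.
by eexists; exact: poset_iso_comp isog isog'.
Qed.

Lemma Jpow2_grid_iso : exists g : fp_T (Jpow 2 (chainprod 2 3)) ->
  fp_T (tab_poset 16 (incl_le ideals2)), poset_iso g.
Proof.
apply: (@Jp_iso_step (Jp (chainprod 2 3)) 10 15 (incl_le ideals1));
  [|by vm_compute|by vm_compute].
apply: (@Jp_iso_step (chainprod 2 3) 6 9 grid_le); [|by vm_compute|by vm_compute].
exact: grid_iso.
Qed.

Lemma Jpow3_grid_iso : exists g : fp_T (Jpow 3 (chainprod 2 3)) ->
  fp_T (tab_poset 27 (incl_le ideals3)), poset_iso g.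
Proof.
apply: (@Jp_iso_step (Jpow 2 (chainprod 2 3)) 16 26 (incl_le ideals2));
  [|by vm_compute|by vm_compute].
exact: Jpow2_grid_iso.
Qed.

Definition antichains_E6 := Eval vm_compute in antichain_codes 16 (incl_le ideals2).
Definition antichains_E7 := Eval vm_compute in antichain_codes 27 (incl_le ideals3).

(* Row [x] lists the coordinates of [omega_1 - mu], where [mu] is the weight matching the
   antichain [x]; the matching was found by a computer search. *)
Definition cf_E6 : seq (seq nat) :=
  [:: [:: 0; 0; 0; 0; 0; 0]; [:: 1; 0; 0; 0; 0; 0]; [:: 1; 1; 0; 0; 0; 0]; [:: 1; 1; 1; 0; 0; 0];
   [:: 1; 1; 1; 1; 0; 0]; [:: 1; 1; 1; 1; 1; 0]; [:: 1; 1; 1; 0; 0; 1]; [:: 2; 2; 2; 1; 0; 1];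
   [:: 2; 2; 2; 1; 1; 1]; [:: 1; 1; 1; 1; 0; 1]; [:: 2; 2; 2; 2; 1; 1]; [:: 1; 1; 1; 1; 1; 1];
   [:: 1; 1; 2; 1; 0; 1]; [:: 2; 2; 3; 2; 1; 1]; [:: 2; 2; 3; 2; 1; 2]; [:: 1; 1; 2; 1; 1; 1];
   [:: 1; 1; 2; 2; 1; 1]; [:: 1; 2; 2; 1; 0; 1]; [:: 2; 3; 3; 2; 1; 1]; [:: 2; 3; 3; 2; 1; 2];
   [:: 2; 3; 4; 2; 1; 2]; [:: 2; 3; 4; 3; 1; 2]; [:: 1; 2; 2; 1; 1; 1]; [:: 2; 3; 4; 3; 2; 2];
   [:: 1; 2; 2; 2; 1; 1]; [:: 1; 2; 3; 2; 1; 1]; [:: 1; 2; 3; 2; 1; 2]].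

(** The table for the other minuscule node, by the diagram automorphism of E6, which reverses the
    chain and fixes the sixth node. *)
Definition cf_E6' : seq (seq nat) :=
  [seq [seq nth 0%N r (if i == 5 then 5 else 4 - i)%N | i <- iota 0 6] | r <- cf_E6].

Definition cf_E7 : seq (seq nat) :=
  [:: [:: 0; 0; 0; 0; 0; 0; 0]; [:: 0; 0; 0; 0; 0; 1; 0]; [:: 0; 0; 0; 0; 1; 1; 0]; [:: 0; 0; 0; 1; 1; 1; 0];
   [:: 0; 0; 1; 1; 1; 1; 0]; [:: 0; 1; 1; 1; 1; 1; 0]; [:: 1; 1; 1; 1; 1; 1; 0]; [:: 0; 0; 1; 1; 1; 1; 1];
   [:: 0; 1; 2; 2; 2; 2; 1]; [:: 1; 1; 2; 2; 2; 2; 1]; [:: 0; 1; 1; 1; 1; 1; 1]; [:: 1; 2; 2; 2; 2; 2; 1];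
   [:: 1; 1; 1; 1; 1; 1; 1]; [:: 0; 1; 2; 1; 1; 1; 1]; [:: 1; 2; 3; 2; 2; 2; 1]; [:: 1; 2; 3; 2; 2; 2; 2];
   [:: 1; 1; 2; 1; 1; 1; 1]; [:: 1; 2; 2; 1; 1; 1; 1]; [:: 0; 1; 2; 2; 1; 1; 1]; [:: 1; 2; 3; 3; 2; 2; 1];
   [:: 1; 2; 3; 3; 2; 2; 2]; [:: 1; 2; 4; 3; 2; 2; 2]; [:: 1; 3; 4; 3; 2; 2; 2]; [:: 1; 1; 2; 2; 1; 1; 1];
   [:: 2; 3; 4; 3; 2; 2; 2]; [:: 1; 2; 2; 2; 1; 1; 1]; [:: 1; 2; 3; 2; 1; 1; 1]; [:: 1; 2; 3; 2; 1; 1; 2];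
   [:: 0; 1; 2; 2; 2; 1; 1]; [:: 1; 2; 3; 3; 3; 2; 1]; [:: 1; 2; 3; 3; 3; 2; 2]; [:: 1; 2; 4; 3; 3; 2; 2];
   [:: 1; 3; 4; 3; 3; 2; 2]; [:: 1; 2; 4; 4; 3; 2; 2]; [:: 2; 4; 6; 5; 4; 3; 3]; [:: 1; 3; 4; 4; 3; 2; 2];
   [:: 1; 3; 5; 4; 3; 2; 2]; [:: 1; 3; 5; 4; 3; 2; 3]; [:: 1; 1; 2; 2; 2; 1; 1]; [:: 2; 3; 4; 3; 3; 2; 2];
   [:: 2; 3; 4; 4; 3; 2; 2]; [:: 2; 3; 5; 4; 3; 2; 2]; [:: 2; 3; 5; 4; 3; 2; 3]; [:: 1; 2; 2; 2; 2; 1; 1];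
   [:: 2; 4; 5; 4; 3; 2; 2]; [:: 2; 4; 5; 4; 3; 2; 3]; [:: 1; 2; 3; 2; 2; 1; 1]; [:: 2; 4; 6; 4; 3; 2; 3];
   [:: 1; 2; 3; 2; 2; 1; 2]; [:: 1; 2; 3; 3; 2; 1; 1]; [:: 2; 4; 6; 5; 3; 2; 3]; [:: 2; 4; 6; 5; 4; 2; 3];
   [:: 1; 2; 3; 3; 2; 1; 2]; [:: 1; 2; 4; 3; 2; 1; 2]; [:: 1; 3; 4; 3; 2; 1; 2]; [:: 2; 3; 4; 3; 2; 1; 2]].

Lemma antichains_E6_ok : check_antichains 16 26 (incl_le ideals2) antichains_E6.
Proof. by vm_compute. Qed.

Lemma antichains_E7_ok : check_antichains 27 55 (incl_le ideals3) antichains_E7.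
Proof. by vm_compute. Qed.

Lemma model_E6_ok : check_model TE6 6 0 26 cf_E6.
Proof. by vm_compute. Qed.

Lemma model_E6'_ok : check_model TE6 6 4 26 cf_E6'.
Proof. by vm_compute. Qed.

Lemma model_E7_ok : check_model TE7 7 5 55 cf_E7.
Proof. by vm_compute. Qed.

Lemma order_E6_ok : check_order TE6 6 0 26 (incl_le ideals2) cf_E6 antichains_E6.
Proof. by vm_compute. Qed.

Lemma order_E6'_ok : check_order TE6 6 4 26 (incl_le ideals2) cf_E6' antichains_E6.
Proof. by vm_compute. Qed.

Lemma order_E7_ok : check_order TE7 7 5 55 (incl_le ideals3) cf_E7 antichains_E7.
Proof. by vm_compute. Qed.

(** * Positivity of the Cartan matrices *)

Lemma dyn_adj_sym t n i j : dyn_adj t n i j = dyn_adj t n j i.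
Proof. by case: t; rewrite /= /chain_edge; lia. Qed.

(** Column [j] pairs with [u] to [2 * u j] minus the sum of [u] over the neighbours of [j], and
    [nb j] lists at least these neighbours. *)
Lemma simply_laced_cartan t n (u : nat -> nat) (nb : nat -> seq nat) :
    (forall i j : 'I_n, i != j -> dyn_adj t n i.+1 j.+1 -> (i : nat) \in nb j) ->
    (forall j : 'I_n, (\sum_(l <- nb j) u l < 2 * u j)%N) ->
  simply_laced (@cartan t n).
Proof.
move=> nbP uP; split.
- by move=> i; rewrite /cartan eqxx.
- by move=> i j; rewrite /cartan => /negbTE->; case: ifP; [right | left].
- by move=> i j; rewrite /cartan eq_sym dyn_adj_sym.
exists (fun i => (u i)%:Z); split=> // j.
have nb_le : (\sum_(i : 'I_n | (i != j) && dyn_adj t n i.+1 j.+1) u i <= \sum_(l <- nb j) u l)%N.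
  apply: (@leq_trans (\sum_(l <- nb j) \sum_(i : 'I_n) (i == l :> nat) * u i)%N).
    rewrite exchange_big /= big_mkcond /=; apply: leq_sum => i _.
    case: ifP => // /andP[ij adj]; have := nbP i j ij adj => inb.
    by rewrite (big_rem _ inb) /= eqxx mul1n leq_addr.
  apply: leq_sum => l _; have [ln|ln] := ltnP l n.
    rewrite (bigD1 (Ordinal ln)) //= eqxx mul1n big1 ?addn0 // => i.
    by rewrite -val_eqE /= => /negbTE->; rewrite mul0n.
  rewrite big1 // => i _; case: eqP => // il.
  by have := ltn_ord i; rewrite il ltnNge ln.
have -> : \sum_(i : 'I_n) (u i)%:Z * cartan t i j = (2 * u j)%:Z -
    (\sum_(i : 'I_n | (i != j) && dyn_adj t n i.+1 j.+1) u i)%:Z.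
  rewrite (bigD1 j) //= {1}/cartan eqxx; congr (_ + _); first by lia.
  rewrite (big_morph Posz PoszD (erefl _)) -sumrN [RHS]big_mkcondr /=.
  apply: eq_bigr => i ij; rewrite /cartan (negbTE ij).
  by case: ifP => _; lia.
by have := uP j; lia.
Qed.

Lemma simply_laced_A n : simply_laced (@cartan TA n).
Proof.
(* The coefficients of [2 rho], the sum of the positive roots, which pairs to 2 with every simple
   coroot. *)
apply: (@simply_laced_cartan TA n (fun k => k.+1 * (n - k))%N
  (fun j => (if j is j'.+1 then [:: j'] else [::]) ++ [:: j.+1])).
  move=> i j _; rewrite /= /chain_edge; case: (nat_of_ord j) => [|j'];
    rewrite /= !inE; lia.
move=> j; have := ltn_ord j; move: (nat_of_ord j) => {}j jn.
rewrite big_cat big_seq1 /=.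
have [d ->] : exists d, n = (j + d.+1)%N by exists (n - j.+1)%N; lia.
case: j {jn} => [|j'] /=; rewrite ?big_nil ?big_seq1.
  by rewrite !add0n subn0 subSS subn0; nia.
have -> : (j'.+1 + d.+1 - j' = d.+2)%N by lia.
have -> : (j'.+1 + d.+1 - j'.+2 = d)%N by lia.
have -> : (j'.+1 + d.+1 - j'.+1 = d.+1)%N by lia.
nia.
Qed.

Lemma simply_laced_D n : (4 <= n)%N -> simply_laced (@cartan TD n).
Proof.
(* The coefficients of [4 rho], doubled to avoid a half at the two fork ends. *)
move=> n4; apply: (@simply_laced_cartan TD n
  (fun k => if (k.+2 < n)%N then 2 * (k.+1 * (2 * n - k.+2)) else n * n.-1)%N
  (fun j => if (j.+2 < n)%N then (if j is j'.+1 then [:: j'] else [::]) ++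
     (if j.+3 == n then [:: n - 2; n.-1]%N else [:: j.+1]) else [:: n - 3]%N)).
  move=> i j; rewrite -val_eqE /= /chain_edge; have := ltn_ord i; have := ltn_ord j.
  case: (nat_of_ord j) => [|j']; repeat case: ifP => ?; rewrite /= ?inE; lia.
move=> j; have := ltn_ord j; move: (nat_of_ord j) => {}j.
have [k ->] : exists k, n = k.+4 by exists (n - 4)%N; lia.
move=> jk.
case: (ltnP j.+2 k.+4) => jk1; last first.
  rewrite big_seq1; have -> : (k.+4 - 3 = k.+1)%N by lia.
  by rewrite ltnSn; nia.
rewrite big_cat /= !eqSS; have -> : (k.+4 - 2 = k.+2)%N by lia.
case: eqVneq => [->|jk2] /=.
  by rewrite !big_cons !big_nil; repeat case: ifP => ?; try lia; nia.
have [d dE] : exists d, k = (j + d)%N by exists (k - j)%N; lia.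
rewrite big_seq1 dE; case: j {jk jk1 jk2 dE} => [|j] /=; rewrite ?big_nil ?big_seq1.
  by repeat case: ifP => ?; lia.
have -> : (2 * (j.+1 + d).+4 - j.+2 = j + 2 * d + 8)%N by lia.
have -> : (2 * (j.+1 + d).+4 - j.+3 = j + 2 * d + 7)%N by lia.
have -> : (2 * (j.+1 + d).+4 - j.+4 = j + 2 * d + 6)%N by lia.
by repeat case: ifP => ?; try lia; nia.
Qed.

Lemma simply_laced_E6 : simply_laced (@cartan TE6 6).
Proof.
(* Again the coefficients of [2 rho], as also for E7 below. *)
apply: (@simply_laced_cartan TE6 6 (nth 0%N [:: 16; 30; 42; 30; 16; 22])
  (fun j => [seq i <- iota 0 6 | dyn_adj TE6 6 i.+1 j.+1])).
  by move=> i j _ adj; rewrite mem_filter adj mem_iota ltn_ord.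
by case=> -[|[|[|[|[|[|//]]]]]] j; rewrite unlock.
Qed.

Lemma simply_laced_E7 : simply_laced (@cartan TE7 7).
Proof.
apply: (@simply_laced_cartan TE7 7 (nth 0%N [:: 34; 66; 96; 75; 52; 27; 49])
  (fun j => [seq i <- iota 0 7 | dyn_adj TE7 7 i.+1 j.+1])).
  by move=> i j _ adj; rewrite mem_filter adj mem_iota ltn_ord.
by case=> -[|[|[|[|[|[|[|//]]]]]]] j; rewrite unlock.
Qed.

(** * The models of each type and the conclusion *)

Lemma antichain_model_A (n k : nat) (kn : (k < n)%N) :
  exists M : minuscule_model (@cartan TA n) (Ordinal kn),
    antichain_model M (pair_poset (k.+1 + (n - k)) true k.+1).
Proof.
(* The positions after [k] are read backwards, so that node [p] toggles the last position of each
   block, [k] and [n]. *)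
pose pos (i : 'I_n) : 'I_(k.+1 + (n - k)) :=
  (inord (if i <= k then i : nat else n + k - i)%N : 'I_(k + (n - k)).+1).
pose pos' (i : 'I_n) : 'I_(k.+1 + (n - k)) :=
  (inord (if i == k :> nat then n else (pos i).+1) : 'I_(k + (n - k)).+1).
have posE i : pos i = (if i <= k then i : nat else n + k - i)%N :> nat.
  have b : ((if i <= k then i : nat else n + k - i) < (k + (n - k)).+1)%N.
    by have := ltn_ord i; case: ifP => ?; lia.
  exact: (@inordK (k + (n - k)) _ b).
have pos'E i : pos' i = (if i == k :> nat then n else (pos i).+1) :> nat.
  have b : ((if i == k :> nat then n else (pos i).+1) < (k + (n - k)).+1)%N.
    by have := ltn_ord i; rewrite posE; repeat case: ifP => ?; lia.
  exact: (@inordK (k + (n - k)) _ b).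
have neqE (i : 'I_n) : (i == Ordinal kn) = (i == k :> nat) by rewrite -val_eqE.
eexists; apply: (@pair_antichain_model _ _ _ _ pos pos').
- by move=> i; rewrite pos'E posE; have := ltn_ord i; repeat case: ifP => ?; lia.
- by move=> i; rewrite neqE pos'E => /negbTE->.
- move=> i _; rewrite neqE pos'E posE /low => /negbTE ik; rewrite ik.
  by have := ltn_ord i; case: ifP => ?; lia.
- by rewrite posE /= leqnn.
- by [].
- by rewrite pos'E /= eqxx; lia.
- move=> i j; rewrite /root /pos_sign !neqE -!val_eqE /= !pos'E !posE /cartan.
  rewrite -val_eqE /= /chain_edge; have := ltn_ord i; have := ltn_ord j.
  move: (nat_of_ord i) (nat_of_ord j) => u v ? ?.
  by case: (ltngtP u k) => ?; case: (ltngtP v k) => ?; repeat case: ifP => ?; lia.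
- move=> z zN /= zk; have lz := ltn_ord z.
  have ni : ((if z <= k then z : nat else n + k - z) < n)%N by case: ifP => ?; lia.
  exists (Ordinal ni); first by rewrite neqE /=; case: ifP => ?; lia.
  by apply: val_inj; rewrite /= posE /=; case: (leqP z k) => ? /=; repeat case: ifP => ?; lia.
move=> i j; rewrite !neqE => ik jk /(congr1 val); rewrite /= !posE => E.
apply: val_inj => /=; have := ltn_ord i; have := ltn_ord j.
by move: E; repeat case: ifP => ?; lia.
Qed.

Lemma antichain_model_spin (k : nat) (p : 'I_k.+2) : (2 <= k)%N -> (k <= p)%N ->
  exists M : minuscule_model (@cartan TD k.+2) p,
    antichain_model M (pair_poset k.+2 false 0).
Proof.
move=> k2 kp; have lp := ltn_ord p.
(* Both fork ends act on the positions [k] and [k + 1]: the one that is [p] toggles them, the other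
   exchanges them. *)
pose pos (i : 'I_k.+2) : 'I_k.+2 := inord (minn i k).
pose pos' (i : 'I_k.+2) : 'I_k.+2 := inord (minn i k).+1.
have posE i : pos i = minn i k :> nat by rewrite inordK //; lia.
have pos'E i : pos' i = (minn i k).+1 :> nat by rewrite inordK //; lia.
eexists; apply: (@pair_antichain_model _ _ _ _ pos pos').
- by move=> i; rewrite pos'E posE.
- by move=> i _; rewrite pos'E posE.
- by [].
- by [].
- by rewrite posE; lia.
- by rewrite pos'E; lia.
- move=> i j; rewrite /root /pos_sign -!val_eqE /= !pos'E !posE /cartan.
  rewrite -val_eqE /= /chain_edge; have := ltn_ord i; have := ltn_ord j.
  have : (p = k :> nat) \/ (p = k.+1 :> nat) by lia.
  move: (nat_of_ord i) (nat_of_ord j) (nat_of_ord p) => u v w [->|->] ? ?;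
    case: (ltngtP u k) => ?; case: (ltngtP v k) => ?; repeat case: ifP => ?; lia.
- move=> z zN _; have [zk|zk] := eqVneq (z : nat) k; last first.
    exists z; first by rewrite -val_eqE /=; lia.
    by apply: val_inj; rewrite /= posE; lia.
  have [pk|pk] := eqVneq (p : nat) k.
    exists ord_max; first by rewrite -val_eqE /=; lia.
    by apply: val_inj; rewrite /= posE /=; lia.
  exists z; first by rewrite -val_eqE /=; lia.
  by apply: val_inj; rewrite /= posE; lia.
move=> i j; rewrite -!val_eqE /= => ip jp /(congr1 val); rewrite /= !posE => E.
apply: val_inj => /=; have := ltn_ord i; have := ltn_ord j; lia.
Qed.

Lemma lt06 : (0 < 6)%N. Proof. by []. Qed.
Lemma lt46 : (4 < 6)%N. Proof. by []. Qed.
Lemma lt57 : (5 < 7)%N. Proof. by []. Qed.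

Lemma antichain_model_E6 :
  antichain_model (table_model model_E6_ok lt06) (tab_poset 16 (incl_le ideals2)).
Proof. exact (table_antichain_model model_E6_ok lt06 antichains_E6_ok order_E6_ok). Qed.

Lemma antichain_model_E6' :
  antichain_model (table_model model_E6'_ok lt46) (tab_poset 16 (incl_le ideals2)).
Proof. exact (table_antichain_model model_E6'_ok lt46 antichains_E6_ok order_E6'_ok). Qed.

Lemma antichain_model_E7 :
  antichain_model (table_model model_E7_ok lt57) (tab_poset 27 (incl_le ideals3)).
Proof. exact (table_antichain_model model_E7_ok lt57 antichains_E7_ok order_E7_ok). Qed.

Lemma minuscule_antichain_model t n p : valid_rank t n -> minuscule t n p ->
  exists2 p0 : 'I_n, p0.+1 = p & simply_laced (@cartan t n) /\
    exists M : minuscule_model (@cartan t n) p0, antichain_model M (mposet t n p).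
Proof.
have spin k (q : 'I_k.+2) : (2 <= k)%N -> (k <= q)%N ->
    exists M : minuscule_model (@cartan TD k.+2) q, antichain_model M (mposet TD k.+2 q.+1).
  move=> k2 kq; have [M MA] := antichain_model_spin k2 kq; exists M.
  rewrite /mposet eqSS (_ : (q == 0 :> nat) = false); last by lia.
  rewrite (_ : (k.+2 - 2 = k)%N); last by lia.
  exact: (antichain_model_iso (@Jp_chainprod2_pair_iso k) MA).
case: t => //.
- case: p => // k _ /andP[_ kn]; exists (Ordinal kn) => //; split.
    exact: simply_laced_A.
  have [M MA] := antichain_model_A kn; exists M; rewrite /mposet subSS.
  exact: (antichain_model_iso (@chainprod_pair_iso k.+1 (n - k)) MA).
- case: n => [|[|k]] // rk min; have {rk} n4 : (2 <= k)%N := rk.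
  case/orP: min => [/orP[]|] /eqP ->.
  + exists ord0 => //; split; first exact: simply_laced_D.
    exists (vector_model n4); rewrite /mposet /=.
    have := Jpow_double_tail_iso k.-1; have -> : k.-1.+1 = k by lia.
    case=> g isog.
    rewrite (_ : (k.+2 - 3 = k.-1)%N); last by lia.
    exact: (antichain_model_iso isog (vector_antichain_model n4)).
  + exists (inord k); first by rewrite /= inordK.
    split; first exact: simply_laced_D.
    have [||M MA] := @spin k (inord k); rewrite ?inordK //.
    by exists M; move: MA; rewrite inordK.
  + exists ord_max => //; split; first exact: simply_laced_D.
    by apply: spin => //=.
- move=> /eqP n6; subst n => /orP[] /eqP ->.
  + exists (Ordinal lt06) => //; split; first exact: simply_laced_E6.
    have [g isog] := Jpow2_grid_iso; exists (table_model model_E6_ok lt06).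
    exact: (antichain_model_iso isog antichain_model_E6).
  + exists (Ordinal lt46) => //; split; first exact: simply_laced_E6.
    have [g isog] := Jpow2_grid_iso; exists (table_model model_E6'_ok lt46).
    exact: (antichain_model_iso isog antichain_model_E6').
move=> /eqP n7; subst n => /eqP ->.
exists (Ordinal lt57) => //; split; first exact: simply_laced_E7.
have [g isog] := Jpow3_grid_iso; exists (table_model model_E7_ok lt57).
exact: (antichain_model_iso isog antichain_model_E7).
Qed.

From mathcomp Require Import complex Rstruct.

Lemma Cplx_char0 (m : int) : m%:~R = 0 :> Cplx -> m = 0.
Proof. by move/eqP; rewrite (@intr_eq0 (complex Rdefinitions.R)) => /eqP. Qed.

Theorem theorem5p1 (t : sltype) (n p : nat)
    (g : vectType Cplx) (br : g -> g -> g) (e f h : 'I_n -> g)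
    (L : vectType Cplx) (act : g -> L -> L) (k : {vspace g}) :
  valid_rank t n ->
  lie_bracket br -> simple_lie br ->
  serre_generators t br e f h ->
  minuscule t n p ->
  lie_module br act ->
  highest_weight_fund act e h p ->
  lie_generated br
    (fun x => exists2 i : 'I_n, i.+1 != p & (x = e i \/ x = f i \/ x = h i)) k ->
  let P := mposet t n p in
  exists V : 'I_(width P).+1 -> {vspace L},
    [/\ directv (\sum_(i < (width P).+1) V i)%VS,
        (\sum_(i < (width P).+1) V i)%VS = fullv &
        forall i : 'I_(width P).+1,
          simple_submodule act k (V i) /\
          weights_iso_antichains t act h [set j : 'I_n | j.+1 != p] (V i) P i].
Proof.
move=> rank_n _ _ serre min_p modL hwL genk P.
have [q qp [SL [M MP]]] := minuscule_antichain_model rank_n min_p.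
subst p; exact: (minuscule_decomposition Cplx_char0 SL MP serre modL hwL genk).
Qed.
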